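(* Algorithm 1 (described in the context) is correct: for every $\bar A\in\{0,1\}^{n\times n}$, its execution on input $\mathcal D(\bar A)=(\mathcal X,\mathcal E_{\mathcal X,\mathcal X})$ returns a minimal feasible dedicated input configuration $\mathcal S_u$. Furthermore, it does so with complexity $\mathcal O(|\mathcal X|^3)$. In addition, the minimum number of dedicated inputs ensuring structural controllability of the system is $|\mathcal S_u|$, and its computation incurs the same complexity.
   Context: $(\bar A,\bar B)$ is structurally controllable if there is a controllable real pair $(A_0,B_0)$ (system $\dot x=A_0x+B_0u$) having the same locations of zero and non-zero entries as $(\bar A,\bar B)$. A feasible dedicated input configuration is a set $\mathcal S_u\subset\mathcal X=\{x_1,\dots,x_n\}$ such that taking $\bar B$ whose columns are the canonical unit vectors $e_i$ with $x_i\in\mathcal S_u$ (one dedicated input per state of $\mathcal S_u$) makes $(\bar A,\bar B)$ structurally controllable; it is minimal if it has the smallest cardinality among all such sets. $\mathcal D(\bar A)=(\mathcal X,\mathcal E_{\mathcal X,\mathcal X})$ has $(x_i,x_j)\in\mathcal E_{\mathcal X,\mathcal X}$ iff $\bar A_{ji}=1$. A strongly connected component (SCC) is non-top linked if it has no incoming edge from another SCC. Complexity is the number of elementary operations; a minimum-weight maximum matching is computed by the Hungarian algorithm. Algorithm 1. Step 1: determine the non-top linked SCCs $\mathcal N^T_i$, $i\in\mathcal I=\{1,\dots,\beta\}$, of $\mathcal D(\bar A)$. Step 2: form the weighted bipartite graph with left vertex set $\mathcal X\cup\mathcal I$ (disjoint union), right vertex set $\mathcal X$, and edge set $\mathcal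 E_{\mathcal X,\mathcal X}\cup\mathcal E_{\mathcal I,\mathcal X}$, where $(x_i,x_j)\in\mathcal E_{\mathcal X,\mathcal X}$ joins left $x_i$ to right $x_j$ and $\mathcal E_{\mathcal I,\mathcal X}=\{(i,x_j):x_j\in\mathcal N^T_i\}$ joins left $i$ to right $x_j$. Edges in $\mathcal E_{\mathcal X,\mathcal X}$ have cost $1$, edges in $\mathcal E_{\mathcal I,\mathcal X}$ have cost $2$ (non-edges have infinite cost, i.e. cannot be used). Step 3: let $M'$ be a maximum (cardinality) matching of this graph of minimum total cost among maximum matchings, let $\mathcal U_R$ be its set of right-unmatched vertices (right vertices not covered by $M'$), let $\Theta=\{x_j:(i,x_j)\in M',\ i\in\mathcal I\}$, and set $\mathcal U_R^*=\mathcal U_R\cup\Theta$. Step 4: return $\mathcal S_u=\mathcal U_R^*\cup\mathcal A_u^c$, where $\mathcal A_u^c$ is formed by selecting a single (arbitrary) state variable from each non-top linked SCC $\mathcal N^T_j$ such that $j\in\mathcal I$ is not covered by $M'$. *)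

(* Defs.v *)
From HB Require Import structures.
From mathcomp Require Import all_boot all_order all_algebra.
From mathcomp Require Import reals topology normedtype derive.

Set Implicit Arguments.
Unset Strict Implicit.
Unset Printing Implicit Defensive.

Import Order.TTheory GRing.Theory Num.Theory.
Import numFieldNormedType.Exports.

Section Controllability.
Local Open Scope ring_scope.
Variable R : realType.

(* Inputs are continuous. Letting [u] and [x] live on the whole line rather
   than on [0, T] avoids one-sided derivatives at the end points and changes
   nothing: a continuous input on [0, T] extends continuously, and the solution
   of a linear equation is global. *)
Definition trajectory n m (A : 'M[R]_n) (B : 'M[R]_(n, m))
    (u : R -> 'cV[R]_m) (x : R -> 'cV[R]_n) : Prop :=
  (forall k : 'I_m, continuous (fun t : R => u t k 0)) /\
  (forall (i : 'I_n) (t : R),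
     is_derive t 1 (fun s : R => x s i 0) ((A *m x t + B *m u t) i 0)).

Definition controllable n m (A : 'M[R]_n) (B : 'M[R]_(n, m)) : Prop :=
  forall x0 x1 : 'cV[R]_n,
  exists (T : R) (u : R -> 'cV[R]_m) (x : R -> 'cV[R]_n),
    [/\ 0 < T, trajectory A B u x, x 0 = x0 & x T = x1].

Definition has_pattern p q (P : 'M[bool]_(p, q)) (X : 'M[R]_(p, q)) : Prop :=
  forall i j, (X i j != 0) = P i j.

Definition structurally_controllable n m
    (A : 'M[bool]_n) (B : 'M[bool]_(n, m)) : Prop :=
  exists (A0 : 'M[R]_n) (B0 : 'M[R]_(n, m)),
    [/\ has_pattern A A0, has_pattern B B0 & controllable A0 B0].

Definition dedicated_inputs n (S : {set 'I_n}) : 'M[bool]_(n, #|S|) :=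
  \matrix_(i, k) (i == enum_val k).

Definition feasible n (A : 'M[bool]_n) (S : {set 'I_n}) : Prop :=
  structurally_controllable A (dedicated_inputs S).

Definition minimal_feasible n (A : 'M[bool]_n) (S : {set 'I_n}) : Prop :=
  feasible A S /\
  forall S' : {set 'I_n}, feasible A S' -> (#|S| <= #|S'|)%N.

Definition is_min_number_dedicated n (A : 'M[bool]_n) (k : nat) : Prop :=
  (exists2 S : {set 'I_n}, feasible A S & #|S| = k) /\
  forall S : {set 'I_n}, feasible A S -> (k <= #|S|)%N.

End Controllability.

Section Matching.
Variables (L V : finType) (edge : L -> V -> bool) (cost : L -> V -> nat).

Definition matching (M : {set L * V}) : Prop :=
  [/\ forall p, p \in M -> edge p.1 p.2,
      {in M &, injective fst} & {in M &, injective snd}].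

Definition maximum_matching (M : {set L * V}) : Prop :=
  matching M /\ forall M', matching M' -> #|M'| <= #|M|.

Definition matching_cost (M : {set L * V}) : nat :=
  \sum_(p in M) cost p.1 p.2.

Definition min_weight_maximum_matching (M : {set L * V}) : Prop :=
  maximum_matching M /\
  forall M', maximum_matching M' -> matching_cost M <= matching_cost M'.

End Matching.

Section Algorithm.
Variables (n : nat) (A : 'M[bool]_n).

Definition digraph : rel 'I_n := fun i j => A j i.

Definition SCCs : {set {set 'I_n}} :=
  equivalence_partition
    (fun x y => connect digraph x y && connect digraph y x) [set: 'I_n].

Definition non_top_linked (C : {set 'I_n}) : bool :=
  (C \in SCCs) &&
  [forall x, forall y, digraph x y ==> (y \in C) ==> (x \in C)].

(* [N] lists the non-top linked SCCs without repetition, in an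
   arbitrary order. *)
Definition step1_result beta (N : 'I_beta -> {set 'I_n}) : Prop :=
  injective N /\ forall C, (exists i, N i = C) <-> non_top_linked C.

Section Numbered.
Variables (beta : nat) (N : 'I_beta -> {set 'I_n}).

(* [inl] is a left state vertex, [inr] an SCC index. *)
Definition aug_edge (l : 'I_n + 'I_beta) (x : 'I_n) : bool :=
  match l with inl y => digraph y x | inr i => x \in N i end.

Definition aug_cost (l : 'I_n + 'I_beta) (x : 'I_n) : nat :=
  match l with inl _ => 1 | inr _ => 2 end.

Definition step3_result (M : {set ('I_n + 'I_beta) * 'I_n}) : Prop :=
  min_weight_maximum_matching aug_edge aug_cost M.

Section Matched.
Variable M : {set ('I_n + 'I_beta) * 'I_n}.

Definition right_unmatched : {set 'I_n} :=
  [set x | [forall l, (l, x) \notin M]].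

Definition Theta : {set 'I_n} :=
  [set x | [exists i : 'I_beta, (inr i, x) \in M]].

Definition uncovered_SCCs : {set 'I_beta} :=
  [set i | [forall x, (inr i, x) \notin M]].

(* [sel] is the arbitrary choice of one state in each SCC; only its
   values on uncovered indices matter. *)
Definition step4_result (S : {set 'I_n}) : Prop :=
  exists2 sel : 'I_beta -> 'I_n,
    forall i, i \in uncovered_SCCs -> sel i \in N i &
    S = (right_unmatched :|: Theta) :|: (sel @: uncovered_SCCs).

End Matched.
End Numbered.

(* [S] may be returned by some run. *)
Definition algorithm1_returns (S : {set 'I_n}) : Prop :=
  exists (beta : nat) (N : 'I_beta -> {set 'I_n})
         (M : {set ('I_n + 'I_beta) * 'I_n}),
    [/\ step1_result N, step3_result N M & step4_result N M S].

End Algorithm.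

(* A unit-cost machine on natural-number variables and two-dimensional arrays.
   The elementary operations are reading a constant, a variable or an array
   cell, incrementing, decrementing, comparing, writing, and branching. With no
   addition or multiplication, a stored number exceeds the input and the
   constants of the program by at most the running time, so that unit cost
   cannot be abused by computing on long words. *)

Inductive expr : Type :=
| Const of nat
| Var of nat
| Cell of nat & expr & expr
| Succ of expr
| Pred of expr
| Eqn of expr & expr
| Ltn of expr & expr.

Inductive cmd : Type :=
| Skip
| Assign of nat & expr
| Store of nat & expr & expr & expr
| Seq of cmd & cmd
| If of expr & cmd & cmd
| While of expr & cmd.

Record memory : Type :=
  Memory { var : nat -> nat; arr : nat -> nat -> nat -> nat }.

Fixpoint eval (s : memory) (e : expr) : nat :=
  match e with
  | Const c => c
  | Var v => var s v
  | Cell a e1 e2 => arr s a (eval s e1) (eval s e2)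
  | Succ e1 => (eval s e1).+1
  | Pred e1 => (eval s e1).-1
  | Eqn e1 e2 => eval s e1 == eval s e2
  | Ltn e1 e2 => eval s e1 < eval s e2
  end.

Fixpoint expr_ops (e : expr) : nat :=
  match e with
  | Const _ | Var _ => 1
  | Succ e1 | Pred e1 => (expr_ops e1).+1
  | Cell _ e1 e2 | Eqn e1 e2 | Ltn e1 e2 => (expr_ops e1 + expr_ops e2).+1
  end.

Definition set_var (s : memory) (v c : nat) : memory :=
  Memory (fun w => if w == v then c else var s w) (arr s).

Definition set_cell (s : memory) (a i j c : nat) : memory :=
  Memory (var s)
    (fun b k l => if [&& b == a, k == i & l == j] then c else arr s b k l).

(* [exec c s t s']: started in [s], [c] halts in [s'] after [t] elementary
   operations. *)
Inductive exec : cmd -> memory -> nat -> memory -> Prop :=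
| exec_skip s : exec Skip s 1 s
| exec_assign s v e :
    exec (Assign v e) s (expr_ops e).+1 (set_var s v (eval s e))
| exec_store s a e1 e2 e :
    exec (Store a e1 e2 e) s (expr_ops e1 + expr_ops e2 + expr_ops e).+1
      (set_cell s a (eval s e1) (eval s e2) (eval s e))
| exec_seq s s' s'' c1 c2 t1 t2 :
    exec c1 s t1 s' -> exec c2 s' t2 s'' -> exec (Seq c1 c2) s (t1 + t2) s''
| exec_if s s' g c1 c2 t :
    exec (if eval s g != 0 then c1 else c2) s t s' ->
    exec (If g c1 c2) s (expr_ops g + t).+1 s'
| exec_while_stop s g c :
    eval s g = 0 -> exec (While g c) s (expr_ops g).+1 s
| exec_while_loop s s' s'' g c t1 t2 :
    eval s g != 0 -> exec c s t1 s' -> exec (While g c) s' t2 s'' ->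
    exec (While g c) s (expr_ops g + t1 + t2).+1 s''.

(* Variable 0 holds [n], variable 1 the number of non-top linked SCCs and
   variable 2 the cardinality of the returned set. Array 0 holds the adjacency
   matrix of the digraph, array 1 the incidence matrix of the numbered SCCs,
   array 2 the costs of the bipartite graph (0 standing for a non-edge, i.e.
   for an infinite cost), array 3 the matching and row 0 of array 4 the
   returned set. *)

Section Execution.
Variables (n : nat) (A : 'M[bool]_n).

Definition input_memory : memory :=
  Memory (fun v => if v == 0 then n else 0)
    (fun a i j => [exists k : 'I_n, exists l : 'I_n,
       [&& a == 0, i == k, j == l & digraph A k l]]).

Section Numbered.
Variables (beta : nat) (N : 'I_beta -> {set 'I_n}).

Definition left_row (l : 'I_n + 'I_beta) : nat :=
  match l with inl x => x | inr i => n + i end.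

Definition holds_SCCs (s : memory) : Prop :=
  var s 1 = beta /\
  forall (i : 'I_beta) (x : 'I_n), arr s 1 i x = (x \in N i).

Definition holds_weighted_graph (s : memory) : Prop :=
  forall (l : 'I_n + 'I_beta) (x : 'I_n),
    arr s 2 (left_row l) x = if aug_edge A N l x then aug_cost l x else 0.

Definition holds_matching (M : {set ('I_n + 'I_beta) * 'I_n})
    (s : memory) : Prop :=
  forall (l : 'I_n + 'I_beta) (x : 'I_n),
    arr s 3 (left_row l) x = ((l, x) \in M).

End Numbered.

Definition holds_output (S : {set 'I_n}) (s : memory) : Prop :=
  var s 2 = #|S| /\ forall x : 'I_n, arr s 4 0 x = (x \in S).

(* The programs [c1], ..., [c4], run one after the other on the digraph of [A],
   carry out the four steps, return [S] and compute its cardinality, with [t]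
   elementary operations altogether. *)
Definition executes_algorithm1 (c1 c2 c3 c4 : cmd) (S : {set 'I_n})
    (t : nat) : Prop :=
  exists (beta : nat) (N : 'I_beta -> {set 'I_n})
         (M : {set ('I_n + 'I_beta) * 'I_n})
         (t1 t2 t3 t4 : nat) (s1 s2 s3 s4 : memory),
    [/\ exec c1 input_memory t1 s1 /\ (step1_result A N /\ holds_SCCs N s1),
        exec c2 s1 t2 s2 /\ holds_weighted_graph N s2,
        exec c3 s2 t3 s3 /\ (step3_result A N M /\ holds_matching M s3),
        exec c4 s3 t4 s4 /\ (step4_result N M S /\ holds_output S s4)
      & t = t1 + t2 + t3 + t4].

End Execution.

(* Main.v *)
From mathcomp Require Import all_boot all_order all_algebra all_fingroup.
From mathcomp Require Import boolp functions.
From mathcomp Require Import reals topology normedtype derive realfun sequences exp.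
From mathcomp Require Import ring lra zify.
Require Import Defs.

(** Let D be the digraph of the pattern.  Everything rests on a description of the feasible sets:
S is feasible if and only if
 - every non-top linked SCC meets S, and
 - the states outside S have pairwise distinct predecessors in D.

Necessity.  If a set of states closed under predecessors misses S, its states obey an
autonomous linear equation, so that started at 0 they stay at 0 ([feasible_meets_closed]).
If a real vector v <> 0 annihilates A0 and B0 on the left, then v x(t) is constant along
trajectories ([controllable_left_kernel]); hence the rows of A0 outside S are linearly
independent, and a nonzero term of a maximal minor is the required choice of predecessors
([feasible_cover]).

Sufficiency ([feasible_of_cover]).  The choice of predecessors extends to a permutation s of
the states.  Edges into S are free, since an input can cancel them (feedback,
[silent_feedback]), so that every cycle of s may be used.  Reachability lists the cycles of s
in an order in which each one contains a state of S or receives an edge from an earlier one.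
Adding them in this order keeps the Kalman condition, provided that the weight of the new cycle
is chosen so that X^l - mu^l is prime to a nonzero polynomial that records how the inputs act
on the source of the linking edge ([kalman_add_cycle]).  The resulting matrix may vanish where
the pattern does not; as the Kalman condition is the non-vanishing of a Gram determinant, it
survives a generic perturbation, and this yields the exact pattern ([exists_kalman_pattern]).
Under the Kalman condition, polynomial trajectories reach everything: with N_i the coefficients
of the adjugate of X - A, the curve x = sum_i N_i B phi^(i) is a trajectory for every
polynomial phi, and Hermite interpolation prescribes its two ends ([kalman_controllable]).

Minimality ([step4_card]).  Let beta be the number of non-top linked SCCs.  The returned set
has at most |U_R| + beta elements.  If S' is feasible, then the predecessors of the states
outside S', together with one edge from each SCC to a state of S' in it, form a matching with
n - |S'| + beta edges; a maximum matching is at least as large, so |U_R| + beta <= |S'|.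

Complexity.  The reachability relation is closed by Warshall's algorithm.  For the matching,
the costs 1 and 2 only ask that a maximum matching cover as many state vertices on the left as
possible.  This is achieved by growing a matching along augmenting paths from one left vertex
after the other, the states before the SCCs: a covered left vertex remains covered, and every
prefix of the list of left vertices is optimally covered ([outer_inv]).  Optimality follows
from a certificate: a failed search leaves a dead set of right vertices, all matched, that
contains the neighbours of the failed vertex and of the mates of its members
([dead_certificate]).  Each search costs O(n^2) because it processes at most n + 1 vertices,
each in linear time.  The programs use only loops whose bounds are variables fixed beforehand,
and such a program runs in time O(N^d), where d is its nesting depth and N bounds these
variables ([exec_compile]); all four have depth at most 3. *)

Set Implicit Arguments.
Unset Strict Implicit.
Unset Printing Implicit Defensive.

Import Order.TTheory GRing.Theory Num.Theory.
Import numFieldNormedType.Exports.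

(** * Coefficients of the resolvent *)

Section Resolvent.
Local Open Scope ring_scope.
Variables (F : fieldType) (n : nat) (A : 'M[F]_n.+1).

(** The coefficient of X^i in the adjugate of X - A, as the sum of the X^i resolvent_coef i,
multiplied by X - A, is char_poly A. *)
Definition resolvent_coef i : 'M[F]_n.+1 :=
  horner_mx A (drop_poly i.+1 (char_poly A)).

Lemma drop_polyS (p : {poly F}) i :
  drop_poly i p = drop_poly i.+1 p * 'X + (p`_i)%:P.
Proof.
apply/polyP => k; rewrite coefD coefMX coefC !coef_drop_poly.
by case: k => [|k] /=; rewrite ?add0r ?addr0 // addnS addSn.
Qed.

Lemma resolvent_coefS i :
  resolvent_coef i = A *m resolvent_coef i.+1 + ((char_poly A)`_i.+1)%:M.
Proof.
rewrite /resolvent_coef [in LHS]drop_polyS rmorphD rmorphM /= horner_mx_X.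
rewrite horner_mx_C; congr (_ + _).
by rewrite mulmxE; apply: comm_horner_mx.
Qed.

Lemma resolvent_coef0 :
  A *m resolvent_coef 0 + ((char_poly A)`_0)%:M = 0.
Proof.
rewrite -(Cayley_Hamilton A) -[in RHS](drop_poly0l (char_poly A)).
rewrite [in RHS]drop_polyS rmorphD rmorphM /= horner_mx_X.
rewrite horner_mx_C; congr (_ + _).
by rewrite mulmxE; symmetry; apply: comm_horner_mx.
Qed.

Lemma resolvent_coef_top : resolvent_coef n = 1%:M.
Proof.
rewrite /resolvent_coef.
have -> : drop_poly n.+1 (char_poly A) = 1.
  apply/polyP => k; rewrite coef_drop_poly coefC.
  have := char_poly_monic A; rewrite monicE lead_coefE size_char_poly /=.
  move/eqP => lc; case: k => [|k] //=.
  by rewrite nth_default // size_char_poly; lia.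
by rewrite rmorph1.
Qed.

Lemma resolvent_coef_big i : (n < i)%N -> resolvent_coef i = 0.
Proof.
move=> lt_ni; rewrite /resolvent_coef.
have -> : drop_poly i.+1 (char_poly A) = 0.
  apply/polyP => k; rewrite coef_drop_poly coef0 nth_default //.
  by rewrite size_char_poly; lia.
by rewrite rmorph0.
Qed.

(** By [resolvent_coefS], multiplying by A shifts the resolvent coefficients up to a multiple of
the last one, which is 1; so they generate all the powers of A. *)
Lemma powers_from_resolvent m (u : 'rV[F]_n.+1) (w : 'M[F]_(n.+1, m)) :
  (forall i, (i <= n)%N -> u *m resolvent_coef i *m w = 0) ->
  forall k, u *m A ^+ k *m w = 0.
Proof.
move=> u0 k.
suff : forall i, (i <= n)%N -> u *m A ^+ k *m resolvent_coef i *m w = 0.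
  by move=> /(_ n (leqnn n)); rewrite resolvent_coef_top mulmx1.
elim: k => [|k IHk] i le_in; first by rewrite expr0 mulmx1; apply: u0.
rewrite exprSr mulmxA -!mulmxA; set x := A *m (resolvent_coef i *m w).
have [c Hx] : exists c, A *m resolvent_coef i = 
   (if i is j.+1 then resolvent_coef j else 0) - c%:M.
  case: i {le_in x} => [|i].
    exists ((char_poly A)`_0); have := resolvent_coef0.
    by move/eqP; rewrite addr_eq0 => /eqP ->; rewrite sub0r.
  by exists ((char_poly A)`_i.+1); rewrite (resolvent_coefS i) addrK.
have top : u *m A ^+ k *m w = 0.
  by have := IHk n (leqnn n); rewrite resolvent_coef_top mulmx1.
rewrite /x [A *m _]mulmxA Hx mulmxBl !mulmxBr.
rewrite mul_scalar_mx -!scalemxAr [u *m (_ *m w)]mulmxA top scaler0 subr0.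
case: i le_in {Hx x} => [|i] le_in; first by rewrite mul0mx !mulmx0.
by rewrite !mulmxA; apply: IHk; lia.
Qed.
End Resolvent.

(** * Linear recurrences *)

Section Recurrences.
Local Open Scope ring_scope.
Variable F : fieldType.
Implicit Types (p g h : {poly F}) (d : nat -> F).

(** p(E) d at index m, where E is the shift of sequences; a recurrence satisfied by d is a p
such that p(E) d = 0. *)
Definition shift_action p d m : F := \sum_(i < size p) p`_i * d (m + i)%N.

Lemma shift_action_wide p d m k : (size p <= k)%N ->
  shift_action p d m = \sum_(i < k) p`_i * d (m + i)%N.
Proof.
move=> le_pk; rewrite /shift_action.
rewrite (big_ord_widen _ (fun i => p`_i * d (m + i)%N) le_pk).
rewrite [RHS](bigID (fun i : 'I_k => (i < size p)%N)) /= [X in _ + X]big1 ?addr0 //.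
by move=> i; rewrite -leqNgt => le_pi; rewrite nth_default // mul0r.
Qed.

Lemma shift_actionD p g d m :
  shift_action (p + g) d m = shift_action p d m + shift_action g d m.
Proof.
pose k := maxn (size p) (size g).
rewrite !(@shift_action_wide _ _ _ k) ?leq_maxl ?leq_maxr ?size_polyD //.
by rewrite -big_split; apply: eq_bigr => i _; rewrite coefD mulrDl.
Qed.

Lemma shift_actionZ c p d m :
  shift_action (c *: p) d m = c * shift_action p d m.
Proof.
rewrite (@shift_action_wide _ _ _ (size p)) ?size_scale_leq // mulr_sumr.
by apply: eq_bigr => i _; rewrite coefZ mulrA.
Qed.

Lemma shift_actionMX p d m : shift_action (p * 'X) d m = shift_action p d m.+1.
Proof.
rewrite (@shift_action_wide _ _ _ (size p).+1); last first.
  by apply: leq_trans (size_polyMleq _ _) _; rewrite size_polyX addn2.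
rewrite big_ord_recl coefMX mul0r add0r; apply: eq_bigr => i _.
by rewrite coefMX /= /bump addSn addnS.
Qed.

Lemma shift_action_binomial l w d m :
  shift_action ('X^l - w%:P) d m = d (m + l)%N - w * d m.
Proof.
rewrite -polyCN -[(- w)%:P]mulr1 mul_polyC shift_actionD shift_actionZ mulNr.
have shift1 j : shift_action 1 d j = d j.
  by rewrite /shift_action size_poly1 big_ord1 coef1 addn0 mul1r.
rewrite shift1; congr (_ - _); elim: l m => [|l IHl] m.
  by rewrite expr0 shift1 addn0.
by rewrite exprSr shift_actionMX IHl addnS.
Qed.

Lemma shift_action_ideal g d : (forall m, shift_action g d m = 0) ->
  forall p m, shift_action (p * g) d m = 0.
Proof.
move=> g0; elim/poly_ind => [|p c IHp] m.
  by rewrite mul0r /shift_action size_poly0 big_ord0.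
rewrite mulrDl mulrAC shift_actionD shift_actionMX IHp mul_polyC.
by rewrite shift_actionZ g0 mulr0 addr0.
Qed.

(** A Bezout relation turns two coprime recurrences into the recurrence 1, that is d = 0. *)
Lemma coprime_recurrences g h d : coprimep g h ->
  (forall m, shift_action g d m = 0) -> (forall m, shift_action h d m = 0) ->
  forall m, d m = 0.
Proof.
move=> /Bezout_eq1_coprimepP [[u v] /= uv1] g0 h0 m.
have: shift_action (u * g + v * h) d m = 0.
  by rewrite shift_actionD !shift_action_ideal // addr0.
by rewrite uv1 /shift_action size_poly1 big_ord1 coef1 addn0 mul1r.
Qed.

(** The X^l - w are pairwise coprime, so each w that fails takes its own nonconstant factor out
of g; fewer than size g of them can fail. *)
Lemma coprime_binomial_among l (ws : seq F) g : uniq ws -> g != 0 ->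
  (size g <= size ws)%N -> has (fun w => coprimep g ('X^l - w%:P)) ws.
Proof.
elim: ws g => [|w ws IHws] g /=; first by rewrite leqn0 size_poly_eq0 => _ /negPf->.
case/andP=> w_ws uniq_ws g0 le_g; have [//|not_co] /= := boolP (coprimep _ _).
set D := gcdp g ('X^l - w%:P).
have dvdDg : D %| g := dvdp_gcdl _ _.
have dvdDw : D %| 'X^l - w%:P := dvdp_gcdr _ _.
have gE : g = g %/ D * D by rewrite divpK.
have q0 : g %/ D != 0 by apply: contraNneq g0 => q0; rewrite gE q0 mul0r.
have D0 : D != 0 by apply: contraNneq g0 => D0; rewrite gE D0 mulr0.
have ltD : (1 < size D)%N.
  rewrite ltn_neqAle eq_sym lt0n size_poly_eq0 D0 andbT.
  by move: not_co; rewrite coprimep_def.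
have /(IHws _ uniq_ws q0) : (size (g %/ D)%R <= size ws)%N.
  move: (size_mul q0 D0); rewrite -gE => szg; move: le_g ltD; rewrite szg.
  case: (size D) => [|[|k]] // + _; rewrite !addnS /= ltnS.
  by apply: leq_trans; rewrite leq_addr.
case/hasP=> w' w'_in co'; apply/hasP; exists w' => //.
rewrite gE coprimepMl co' /=; apply: (coprimep_dvdr dvdDw).
have ne_w : w' - w != 0 by rewrite subr_eq0; apply: contraNneq w_ws => <-.
apply/Bezout_eq1_coprimepP.
exists ((w' - w)^-1%:P, - (w' - w)^-1%:P) => /=.
rewrite mulNr -mulrBr opprB [_ + (_ - _)]addrC addrA subrK -polyCB -polyCM.
by rewrite mulVf.
Qed.
End Recurrences.

Lemma coprime_binomial_exists (F : numFieldType) l (g : {poly F}) :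
  (0 < l)%N -> (g != 0)%R ->
  exists2 w : F, (w != 0)%R & coprimep g ('X^l - (w ^+ l)%:P)%R.
Proof.
move=> l0 g0; pose ws := [seq (i.+1%:R ^+ l)%R : F | i <- iota 0 (size g)].
have /hasP[_ /mapP[i _ ->] co] : has (fun w => coprimep g ('X^l - w%:P)%R) ws.
  apply: coprime_binomial_among => //; last by rewrite size_map size_iota.
  rewrite map_inj_uniq ?iota_uniq // => i j.
  rewrite -!natrX => /eqP; rewrite eqr_nat eqn_exp2r // => /eqP [] //.
by exists (i.+1%:R)%R => //; rewrite pnatr_eq0.
Qed.

(** * Adding a cycle to a controllable system *)

Section CycleExtension.
Local Open Scope ring_scope.
Variables (F : numFieldType) (n : nat).
Implicit Types (A : 'M[F]_n.+1) (v e : 'rV[F]_n.+1) (S U : {set 'I_n.+1}).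

(** Controllability of (A, B) is tested on row vectors v, through the products v A^k B. *)
Definition supported U v := forall i, i \notin U -> v 0 i = 0.

(** v is orthogonal to everything that the dedicated inputs of S can reach. *)
Definition silent S A v := forall k i, i \in S -> (v *m A ^+ k) 0 i = 0.

Definition kalman_on U S A := forall v, supported U v -> silent S A v -> v = 0.

Definition cycle_mx (c : {set 'I_n.+1}) (s : {perm 'I_n.+1}) : 'M[F]_n.+1 :=
  \matrix_(x, y) ((x \in c) && (y == s x))%:R.

Variables (s : {perm 'I_n.+1}) (U S : {set 'I_n.+1}) (A1 : 'M[F]_n.+1).
Variables (k : 'I_n.+1) (e : 'rV[F]_n.+1) (mu : F).
Hypothesis U_stable : forall x, (s x \in U) = (x \in U).
Hypothesis A1_supp : forall i j, A1 i j != 0 -> (i \in U) && (j \in U).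
Hypothesis e_supp : supported U e.
Hypothesis k_notin : k \notin U.
Hypothesis A1_kalman : kalman_on U S A1.

Let c := porbit s k.
(** A new cycle with all weights mu, fed by the earlier states U through the row e into its
state k. *)
Definition extended_mx := A1 + mu *: cycle_mx c s + delta_mx k 0 *m e.
Let A2 := extended_mx.

Lemma porbit_disjoint x : x \in c -> x \notin U.
Proof.
case/porbitP=> i ->; elim: i => [|i IHi]; first by rewrite expg0 perm1.
by rewrite expgSr permM U_stable.
Qed.

Lemma extended_mxE x y : A2 x y =
  A1 x y + mu * ((x \in c) && (y == s x))%:R + (x == k)%:R * e 0 y.
Proof.
rewrite /A2 /extended_mx !mxE big_ord_recl big_ord0 addr0 !mxE.
by rewrite eqxx andbT.
Qed.

(** The only entry of A2 in the column of a state of the new cycle comes from the cycle. *)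
Lemma row_extended_cycle v y : y \in c -> (v *m A2) 0 (s y) = mu * v 0 y.
Proof.
move=> yc; have syU : s y \notin U by rewrite U_stable porbit_disjoint.
rewrite mxE (bigD1 y) //= big1 => [|x neq_xy].
  rewrite extended_mxE yc eqxx /= e_supp // mulr0 !addr0 mulr1.
  have -> : A1 y (s y) = 0.
    by apply/eqP; apply: contraNT syU => /A1_supp/andP[].
  by rewrite add0r mulrC.
rewrite extended_mxE e_supp // (inj_eq perm_inj) [y == x]eq_sym.
rewrite (negPf neq_xy) andbF !mulr0 !addr0.
have -> : A1 x (s y) = 0; last by rewrite mulr0.
by apply/eqP; apply: contraNT syU => /A1_supp/andP[].
Qed.

Definition restrict v : 'rV[F]_n.+1 := \row_i (if i \in U then v 0 i else 0).

Lemma restrict_supported v : supported U (restrict v).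
Proof. by move=> i iU; rewrite mxE (negPf iU). Qed.

(** Seen from U, the new cycle is a scalar disturbance v 0 k along e: this is what reduces the
extended system to the old one. *)
Lemma row_extended_restrict v :
  restrict (v *m A2) = restrict v *m A1 + v 0 k *: e.
Proof.
apply/rowP => y; rewrite !mxE; have [yU|yU] := ifPn; last first.
  rewrite e_supp // mulr0 addr0 big1 // => x _.
  suff -> : A1 x y = 0 by rewrite mulr0.
  by apply/eqP; apply: contraNT yU => /A1_supp/andP[].
transitivity (\sum_x v 0 x * A1 x y + \sum_x v 0 x * ((x == k)%:R * e 0 y)).
  rewrite -big_split /=; apply: eq_bigr => x _; rewrite extended_mxE.
  have -> : (x \in c) && (y == s x) = false.
    apply/negP => /andP[/porbit_disjoint xU /eqP ys].
    by rewrite ys U_stable (negPf xU) in yU.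
  by rewrite mulr0 addr0 mulrDr.
congr (_ + _).
  apply: eq_bigr => x _; rewrite mxE; have [//|xU] := ifPn.
  suff -> : A1 x y = 0 by rewrite !mulr0.
  by apply/eqP; apply: contraNT xU => /A1_supp/andP[].
rewrite (bigD1 k) //= big1 => [|x /negPf ->]; last by rewrite mul0r mulr0.
by rewrite eqxx mul1r addr0.
Qed.

Let d v m := (v *m A2 ^+ m) 0 k.

Lemma row_extended_iter v m y : y \in c ->
  (v *m A2 ^+ m) 0 ((s ^+ m)%g y) = mu ^+ m * v 0 y.
Proof.
move=> yc; elim: m => [|m IHm]; first by rewrite !expr0 mulmx1 mul1r expg0 perm1.
have sc : (s ^+ m)%g y \in c by rewrite -eq_porbit_mem porbit_perm eq_porbit_mem.
by rewrite exprSr mulmxA expgSr permM row_extended_cycle // IHm exprS mulrA.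
Qed.

(** Along the cycle a vector is rotated and multiplied by mu, so the disturbance d is periodic
up to a factor. *)
Lemma entry_recurrence v m l : (s ^+ l)%g k = k -> d v (m + l) = mu ^+ l * d v m.
Proof.
move=> slk; rewrite /d exprD mulmxA -[in LHS]slk row_extended_iter //.
exact: porbit_id.
Qed.

(** If the disturbance vanishes, then so does v on the cycle, whose states all pass through k,
and the part of v on U is silent for the old system. *)
Lemma entries_determine v : supported (U :|: c) v -> silent S A2 v ->
  mu != 0 -> (forall m, d v m = 0) -> v = 0.
Proof.
move=> supp_v silent_v mu0 d0.
have v_on_c y : y \in c -> v 0 y = 0.
  rewrite /c porbit_sym => /porbitP[i def_k].
  have := d0 i; rewrite /d def_k row_extended_iter; last first.
    by rewrite /c porbit_sym def_k mem_porbit.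
  by move/eqP; rewrite mulf_eq0 expf_eq0 (negPf mu0) andbF => /eqP.
have resE m : restrict (v *m A2 ^+ m) = restrict v *m A1 ^+ m.
  elim: m => [|m IHm]; first by rewrite !expr0 !mulmx1.
  rewrite !exprSr !mulmxA row_extended_restrict IHm.
  by rewrite -[(v *m _) 0 k]/(d v m) d0 scale0r addr0.
have res0 : restrict v = 0.
  apply: A1_kalman => [|m i iS]; first exact: restrict_supported.
  by rewrite -resE mxE silent_v // if_same.
apply/rowP => y; rewrite mxE; have [yU|yU] := boolP (y \in U).
  by have /rowP/(_ y) := res0; rewrite !mxE yU.
have [yc|yc] := boolP (y \in c); first exact: v_on_c.
by rewrite supp_v // inE negb_or yU.
Qed.

(** The transfer function e (X - A1)^-1 from the input at i to the linking edge, with its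
denominator char_poly A1 cleared. *)
Definition transfer_poly (i : 'I_n.+1) : {poly F} :=
  \poly_(j < n.+1) (e *m resolvent_coef A1 j) 0 i.

(** Let E be the shift, r the orbit of v restricted to U and N_j = [resolvent_coef] j.  Then
E r = r A1 + d e, and multiplying by the adjugate gives
char_poly A1 (E) r = sum_j (E^j d) e N_j, whose left hand side vanishes at the inputs. *)
Lemma transfer_annihilates v i : silent S A2 v -> i \in S ->
  forall m, shift_action (transfer_poly i) (d v) m = 0.
Proof.
move=> silent_v iS m; pose r t := restrict (v *m A2 ^+ (m + t)).
pose chi := char_poly A1.
have rS t : r t.+1 = r t *m A1 + d v (m + t) *: e.
  by rewrite /r addnS exprSr mulmxA row_extended_restrict.
have telescope t : \sum_(j < t.+1) chi`_j *: r j =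
    (\sum_(j < t) d v (m + j) *: (e *m resolvent_coef A1 j))
    - r t *m A1 *m resolvent_coef A1 t.
  elim: t => [|t IHt].
    rewrite big_ord1 big_ord0 sub0r -mulmxA -mulmxN.
    move/eqP: (resolvent_coef0 A1); rewrite addrC addr_eq0 => /eqP <-.
    by rewrite mul_mx_scalar.
  rewrite big_ord_recr IHt [in RHS]big_ord_recr /= -!addrA; congr (_ + _).
  have stepl : r t.+1 *m resolvent_coef A1 t =
      r t.+1 *m A1 *m resolvent_coef A1 t.+1 + chi`_t.+1 *: r t.+1.
    by rewrite (resolvent_coefS A1 t) mulmxDr mulmxA mul_mx_scalar.
  have stepr : r t.+1 *m resolvent_coef A1 t =
      r t *m A1 *m resolvent_coef A1 t + d v (m + t) *: (e *m resolvent_coef A1 t).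
    by rewrite rS mulmxDl -scalemxAl.
  have -> : chi`_t.+1 *: r t.+1 = r t *m A1 *m resolvent_coef A1 t +
      (d v (m + t) *: (e *m resolvent_coef A1 t)
       - r t.+1 *m A1 *m resolvent_coef A1 t.+1).
    by rewrite addrA -stepr stepl addrC addKr.
  by rewrite addKr.
have /matrixP/(_ 0 i) := telescope n.+1.
rewrite resolvent_coef_big // mulmx0 subr0 !summxE big1 => [|j _]; last first.
  by rewrite mxE /r mxE silent_v // if_same mulr0.
move=> sum0; rewrite (@shift_action_wide _ _ _ _ n.+1) ?size_poly // [RHS]sum0.
by apply: eq_bigr => j _; rewrite coef_poly ltn_ord [in RHS]mxE mulrC.
Qed.
End CycleExtension.

(** If k is an input state, then the disturbance vanishes by assumption.  Otherwise it satisfies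
the recurrences X^l - mu^l and [transfer_poly]; one transfer polynomial is nonzero because e
itself is not silent, so a good choice of mu makes the two coprime. *)
Lemma kalman_add_cycle (F : numFieldType) n (s : {perm 'I_n.+1})
    (U S : {set 'I_n.+1}) (A1 : 'M[F]_n.+1) (k : 'I_n.+1) (e : 'rV[F]_n.+1) :
  (forall x, (s x \in U) = (x \in U)) ->
  (forall i j, A1 i j != 0%R -> (i \in U) && (j \in U)) ->
  supported U e -> k \notin U -> kalman_on U S A1 -> (k \in S) || (e != 0%R) ->
  exists2 mu : F, mu != 0%R &
    kalman_on (U :|: porbit s k) S (extended_mx s A1 k e mu).
Proof.
move=> Us A1s es kU kalA1; have [kS _|kS /= e0] := boolP (k \in S).
  exists 1%R; first exact: oner_neq0.
  move=> v suppv sil.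
  apply: (entries_determine Us A1s es kU kalA1 suppv sil) => [|m].
    exact: oner_neq0.
  exact: sil.
have [i /andP[iS gi0] | no_i] :=
  pickP [pred i | (i \in S) && (transfer_poly A1 e i != 0%R)].
  (* The order of s is a multiple of the length of every cycle. *)
  have [mu mu0 co] := coprime_binomial_exists (order_gt0 s) gi0.
  exists mu => // v suppv sil.
  apply: (entries_determine Us A1s es kU kalA1 suppv sil) => //.
  apply: (coprime_recurrences co) => m.
    exact: (transfer_annihilates Us A1s es kU sil iS).
  rewrite shift_action_binomial.
  have /= -> := @entry_recurrence F n s U A1 k e mu Us A1s es kU v m #[s]%g; last first.
    by rewrite expg_order perm1.
  exact: subrr.
case/eqP: e0; apply: kalA1 => // m i iS.
pose w : 'cV[F]_n.+1 := delta_mx i 0%R.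
have col_i (B : 'M[F]_n.+1) : ((e *m B) 0 i = (e *m B *m w) 0 0)%R.
  by rewrite -[in RHS]colE [RHS]mxE.
rewrite col_i (powers_from_resolvent (A := A1) (w := w)) ?mxE // => j le_jn.
apply/matrixP=> a b; rewrite !ord1 -col_i [RHS]mxE.
have := no_i i; rewrite /= iS /= => /negbFE/eqP/polyP/(_ j).
by rewrite coef_poly coef0 ltnS le_jn.
Qed.

(** * Weights satisfying the Kalman condition *)

Section Weights.
Local Open Scope ring_scope.
Variables (F : numFieldType) (n : nat) (P : rel 'I_n.+1) (S : {set 'I_n.+1}).

(** Edges into S are unconstrained here, so each cycle of s counts as a cycle of edges.
The set U of states already treated is a union of cycles of s; reachability from S provides
the next cycle. *)
Lemma exists_kalman_weights (s : {perm 'I_n.+1}) :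
  (forall x, x \notin S -> P (s x) x) ->
  (forall x, exists2 y, y \in S & connect P y x) ->
  exists A1 : 'M[F]_n.+1,
    (forall i j, i \notin S -> A1 i j != 0 -> P j i) /\
    (forall v, silent S A1 v -> v = 0).
Proof.
move=> sP reach.
suff: forall m (U : {set 'I_n.+1}), (#|~: U| <= m)%N ->
   (forall x, (s x \in U) = (x \in U)) ->
   (exists A1 : 'M[F]_n.+1, [/\ forall i j, i \notin S -> A1 i j != 0 -> P j i,
     forall i j, A1 i j != 0 -> (i \in U) && (j \in U) & kalman_on U S A1]) ->
   exists A1 : 'M[F]_n.+1,
    (forall i j, i \notin S -> A1 i j != 0 -> P j i) /\
    (forall v, silent S A1 v -> v = 0).
  apply; [exact: leqnn (#|~: set0|) | by move=> x; rewrite !inE |].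
  exists 0; split=> [i j _|i j|v supp_v _]; rewrite ?mxE ?eqxx //.
  by apply/rowP => i; rewrite supp_v ?mxE // inE.
elim=> [|m IHm] U leU Us [A1 [A1P A1s kalA1]].
  exists A1; split=> // v; apply: kalA1 => i /negP[].
  move: leU; rewrite leqn0 cards_eq0 => /eqP/setP/(_ i).
  by rewrite !inE => /negbFE.
have [/setP UT|] := eqVneq U setT.
  by exists A1; split=> // v; apply: kalA1 => i; rewrite UT inE.
rewrite eqEsubset subsetT /= => /subsetPn[x0 _ x0U].
(* Either some input state is not in U yet, or a path from S leaves U. *)
have [k [kU link]] : exists k, k \notin U /\
    (k \in S \/ exists2 j, j \in U & P j k).
  have [[k kS kU]|SU] : (exists2 k, k \in S & k \notin U) \/ S \subset U.
    by have [SU|/subsetPn[k]] := boolP (S \subset U); [right|left; exists k].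
    by exists k; split=> //; left.
  have [y yS /connectP[p pP def_x0]] := reach x0.
  have yU := subsetP SU y yS.
  elim: p y yU pP def_x0 {yS} => [|z p IHp] y yU /=.
    by move=> _ eq_x0; rewrite eq_x0 yU in x0U.
  case/andP=> Pyz pP def_x0; have [zU|zU] := boolP (z \in U).
    exact: IHp zU pP def_x0.
  by exists z; split=> //; right; exists y.
have [e [es eP e0]] : exists e : 'rV[F]_n.+1, [/\ supported U e,
    forall j, e 0 j != 0 -> k \in S \/ P j k & (k \in S) || (e != 0)].
  have [kS | kS] := boolP (k \in S).
    exists 0; split=> [i|j|]; rewrite ?mxE ?eqxx //.
  case: link => [kS'|[j jU Pjk]]; first by rewrite kS' in kS.
  exists (delta_mx 0 j); split=> [i|i|] /=.
  - by rewrite mxE eqxx /=; case: eqP => // ->; rewrite jU.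
  - by rewrite mxE eqxx /=; have [->|] := eqVneq i j; [right | rewrite eqxx].
  - by apply/eqP => /rowP/(_ j); rewrite !mxE !eqxx => /eqP; rewrite oner_eq0.
have [mu mu0 kalA2] := kalman_add_cycle Us A1s es kU kalA1 e0.
have c_stable x : (s x \in porbit s k) = (x \in porbit s k).
  rewrite -eq_porbit_mem; have := porbit_perm s 1 x.
  by rewrite expg1 => ->; rewrite eq_porbit_mem.
apply: (IHm (U :|: porbit s k)).
- rewrite -ltnS; apply: leq_trans leU; apply/proper_card/properP; split.
    by rewrite setCS subsetUl.
  by exists k; rewrite !inE // porbit_id orbT.
- by move=> x; rewrite !inE Us c_stable.
exists (extended_mx s A1 k e mu); split=> // i j.
- move=> iS; rewrite extended_mxE => nz.
  have [/eqP A10|/A1P] := boolP (A1 i j == 0); last by apply.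
  rewrite A10 add0r in nz.
  have [/andP[ic /eqP ->]|nc] := boolP ((i \in porbit s k) && (j == s i)).
    exact: sP.
  rewrite (negPf nc) mulr0 add0r in nz.
  have [def_i|ik] := eqVneq i k; last by rewrite (negPf ik) mul0r eqxx in nz.
  rewrite def_i eqxx mul1r in nz; case: (eP j nz) => // [kS|]; last by rewrite def_i.
  by rewrite def_i kS in iS.
rewrite extended_mxE => nz; rewrite !inE.
have [/eqP A10|/A1s/andP[-> ->] //] := boolP (A1 i j == 0).
rewrite A10 add0r in nz.
have [/andP[ic /eqP ->]|nc] := boolP ((i \in porbit s k) && (j == s i)).
  by rewrite c_stable ic !orbT.
rewrite (negPf nc) mulr0 add0r in nz.
have [def_i|ik] := eqVneq i k; last by rewrite (negPf ik) mul0r eqxx in nz.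
rewrite def_i eqxx mul1r in nz; rewrite def_i porbit_id orbT /=.
by have [//|jU] := boolP (j \in U); rewrite es ?eqxx in nz.
Qed.

(** A silent orbit vanishes on S, so it never sees the rows of A indexed by S: state feedback
does not change the Kalman condition. *)
Lemma silent_feedback (A A' : 'M[F]_n.+1) v :
  (forall i, i \notin S -> row i A = row i A') -> silent S A v -> silent S A' v.
Proof.
move=> eqA sil; suff pow_eq k : v *m A' ^+ k = v *m A ^+ k.
  by move=> k i iS; rewrite pow_eq sil.
elim: k => [|k IHk]; first by rewrite !expr0.
rewrite !exprSr !mulmxA IHk; apply/rowP => y; rewrite !mxE.
apply: eq_bigr => x _; have [xS|/eqA/rowP/(_ y)] := boolP (x \in S).
  by rewrite sil // !mul0r.
by rewrite !mxE => ->.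
Qed.
End Weights.

(** * Perturbation to the exact pattern *)

Section Perturbation.
Local Open Scope ring_scope.

Lemma powers_below (F : fieldType) n m (A : 'M[F]_n.+1) (u : 'rV[F]_n.+1)
    (w : 'M[F]_(n.+1, m)) :
  (forall k, (k <= n)%N -> u *m A ^+ k *m w = 0) ->
  forall k, u *m A ^+ k *m w = 0.
Proof.
move=> u0 k; have chi0 : char_poly A != 0 := monic_neq0 (char_poly_monic A).
have -> : A ^+ k = horner_mx A ('X^k %% char_poly A).
  rewrite -[in LHS](horner_mx_X A) -rmorphXn [in LHS](divp_eq 'X^k (char_poly A)).
  by rewrite rmorphD rmorphM /= Cayley_Hamilton mulr0 add0r.
have : (size ('X^k %% char_poly A)%R <= n.+1)%N.
  by rewrite -ltnS -[X in (_ < X)%N](size_char_poly A) ltn_modp.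
move: (_ %% _) => r size_r.
have rE : horner_mx A r = \sum_(i < size r) r`_i *: A ^+ i.
  rewrite -[r in LHS]coefK poly_def rmorph_sum; apply: eq_bigr => i _.
  by rewrite /= horner_mxZ rmorphXn /= horner_mx_X.
rewrite rE mulmx_sumr mulmx_suml big1 // => i _.
rewrite -scalemxAr -scalemxAl u0 ?scaler0 // -ltnS.
exact: leq_trans (ltn_ord i) size_r.
Qed.

Definition gram (K : comNzRingType) n m l (C : 'I_l -> 'M[K]_(n, m)) : 'M[K]_n :=
  \sum_k C k *m (C k)^T.

Lemma map_gram (K K' : comNzRingType) (f : {rmorphism K -> K'}) n m l
    (C : 'I_l -> 'M[K]_(n, m)) :
  map_mx f (gram C) = gram (fun k => map_mx f (C k)).
Proof.
by rewrite /gram map_mx_sum; apply: eq_bigr => k _; rewrite map_mxM map_trmx.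
Qed.

(** Over an ordered field v (gram C) v^T is a sum of squares. *)
Lemma gram_det_neq0 (F : realFieldType) n m l (C : 'I_l -> 'M[F]_(n, m)) :
  (forall v : 'rV[F]_n, (forall k, v *m C k = 0) -> v = 0) <->
  \det (gram C) != 0.
Proof.
split=> [inj | /det0P no_ker v vC0].
  apply/negP => /det0P[v v0 vG]; case/eqP: v0; apply: inj => k.
  have sumsq0 : \sum_k \sum_j (v *m C k) 0 j ^+ 2 = 0.
    transitivity ((v *m gram C *m v^T) 0 0); last by rewrite vG mul0mx mxE.
    rewrite /gram mulmx_sumr mulmx_suml summxE; apply: eq_bigr => {}k _.
    rewrite !mulmxA -mulmxA -trmx_mul mxE.
    by apply: eq_bigr => j _; rewrite [(_^T) _ _]mxE expr2.
  apply/rowP => j; rewrite [RHS]mxE; apply/eqP; rewrite -sqrf_eq0; apply/eqP.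
  have /psumr_eq0P : forall k, true -> 0 <= \sum_j (v *m C k) 0 j ^+ 2.
    by move=> *; apply: sumr_ge0 => *; apply: sqr_ge0.
  move=> /(_ sumsq0 k isT).
  by move/psumr_eq0P; apply=> // *; apply: sqr_ge0.
have [->//|v0] := eqVneq v 0; case: no_ker; exists v => //.
by rewrite /gram mulmx_sumr big1 // => k _; rewrite !mulmxA vC0 mul0mx.
Qed.

Definition input_mask (K : nzRingType) n (S : {set 'I_n}) : 'M[K]_n :=
  \matrix_(i, j) ((i == j) && (i \in S))%:R.

Lemma row_mask (K : nzRingType) n (S : {set 'I_n}) (v : 'rV[K]_n) i :
  (v *m input_mask K S) 0 i = if i \in S then v 0 i else 0.
Proof.
rewrite mxE (bigD1 i) //= big1 => [|j /negPf ne]; rewrite mxE ?ne ?mulr0 //.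
by rewrite eqxx addr0; case: (i \in S); rewrite ?mulr1 ?mulr0.
Qed.

(** The first n + 1 powers suffice by Cayley-Hamilton; a determinant depends polynomially on the
entries of A, which a condition on all v does not show. *)
Definition kalman_gram (K : comNzRingType) n (S : {set 'I_n.+1})
    (A : 'M[K]_n.+1) : 'M[K]_n.+1 :=
  gram (fun k : 'I_n.+1 => A ^+ k *m input_mask K S).

Lemma kalman_gramP (F : realFieldType) n (S : {set 'I_n.+1}) (A : 'M[F]_n.+1) :
  (forall v : 'rV[F]_n.+1, silent S A v -> v = 0) <->
  \det (kalman_gram S A) != 0.
Proof.
have maskP v : (forall k : 'I_n.+1, v *m (A ^+ k *m input_mask F S) = 0) <->
    silent S A v.
  split=> [v0 k i iS | sil k]; last first.
    by apply/rowP => i; rewrite mulmxA row_mask [RHS]mxE; case: ifP => // /sil->.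
  have /rowP/(_ i) : v *m A ^+ k *m input_mask F S = 0.
    apply: powers_below => l le_ln; rewrite -mulmxA.
    exact: (v0 (Ordinal (le_ln : l < n.+1)%N)).
  by rewrite row_mask iS => ->; rewrite mxE.
split=> [kalA|/gram_det_neq0 kalA v /maskP]; last exact: kalA.
by apply/gram_det_neq0 => v /maskP; apply: kalA.
Qed.

Lemma map_kalman_gram (K K' : comNzRingType) (f : {rmorphism K -> K'}) n
    (S : {set 'I_n.+1}) (A : 'M[K]_n.+1) :
  map_mx f (kalman_gram S A) = kalman_gram S (map_mx f A).
Proof.
have mapE k : map_mx f (A ^+ k *m input_mask K S) =
    map_mx f A ^+ k *m input_mask K' S.
  rewrite map_mxM rmorphXn; congr (_ *m _).
  by apply/matrixP => i j; rewrite !mxE rmorph_nat.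
by rewrite /kalman_gram map_gram; apply: eq_bigr => k _; rewrite mapE.
Qed.

Lemma exists_nonroot (F : numDomainType) (p : {poly F}) :
  p != 0 -> exists x, ~~ root p x.
Proof.
move=> p0; pose rs := [seq i%:R : F | i <- iota 0 (size p)].
have [all_roots|/allPn[x _ px]] := boolP (all (root p) rs); last by exists x.
have uniq_rs : uniq rs.
  by rewrite map_inj_uniq ?iota_uniq // => i j /eqP; rewrite eqr_nat => /eqP.
by have := max_poly_roots p0 all_roots uniq_rs; rewrite size_map size_iota ltnn.
Qed.

(** A1 need only be supported on the pattern outside S.  Drop its other entries (feedback), then
add x to every entry of the pattern: only finitely many x spoil the Gram determinant or cancel
an entry. *)
Lemma exists_kalman_pattern (F : realFieldType) n (S : {set 'I_n.+1})
    (P : 'M[bool]_n.+1) (A1 : 'M[F]_n.+1) :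
  (forall i j, i \notin S -> A1 i j != 0 -> P i j) ->
  (forall v : 'rV[F]_n.+1, silent S A1 v -> v = 0) ->
  exists A : 'M[F]_n.+1, (forall i j, (A i j != 0) = P i j) /\
    (forall v : 'rV[F]_n.+1, silent S A v -> v = 0).
Proof.
move=> A1P kal1; pose A2 : 'M[F]_n.+1 := \matrix_(i, j) (if P i j then A1 i j else 0).
have kal2 v : silent S A2 v -> v = 0.
  move=> sil2; apply/kal1/(silent_feedback _ sil2) => i iS; apply/rowP => j.
  rewrite !mxE; case: ifPn => // nP; apply/esym/eqP/negP => nz.
  by move: nP; rewrite (A1P i j) //; apply/negP.
pose B : 'M[{poly F}]_n.+1 := \matrix_(i, j) ((A2 i j)%:P + (P i j)%:R *: 'X).
(* A non-root of p is a value of the perturbation that is good for all entries at once. *)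
pose p := \det (kalman_gram S B) * \prod_i \prod_(j | P i j) ((A2 i j)%:P + 'X).
have evalB x : map_mx (horner_eval x) B = \matrix_(i, j) (A2 i j + (P i j)%:R * x).
  by apply/matrixP => i j; rewrite !mxE /horner_eval !hornerE.
have det_eval x : (\det (kalman_gram S B)).[x] =
    \det (kalman_gram S (map_mx (horner_eval x) B)).
  by rewrite -map_kalman_gram det_map_mx.
have detB0 : \det (kalman_gram S B) != 0.
  apply/eqP => det0; have /kalman_gramP := kal2.
  have -> : A2 = map_mx (horner_eval 0) B.
    by rewrite evalB; apply/matrixP => i j; rewrite [RHS]mxE mulr0 addr0.
  by rewrite -det_eval det0 horner0 eqxx.
have p0 : p != 0.
  rewrite mulf_neq0 //; apply/prodf_neq0 => i _; apply/prodf_neq0 => j _.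
  by rewrite addrC -[A2 i j]opprK polyCN polyXsubC_eq0.
have [x] := exists_nonroot p0; rewrite rootE hornerM mulf_eq0 negb_or.
case/andP=> detx prodx; exists (map_mx (horner_eval x) B); split; last first.
  by apply/kalman_gramP; rewrite -det_eval.
move=> i j; rewrite evalB [X in X != 0]mxE; case Pij: (P i j); last first.
  by rewrite mxE Pij mul0r addr0 eqxx.
rewrite mul1r; apply: contraNneq prodx => sum0; apply/eqP.
rewrite horner_prod (bigD1 i) //= horner_prod (bigD1 j) //=.
by rewrite hornerD hornerC hornerX sum0 !mul0r.
Qed.
End Perturbation.

(** * Hermite interpolation *)

Section Hermite.
Local Open Scope ring_scope.
Variable F : numFieldType.
Implicit Types (p q m : {poly F}).

Lemma derivn_root_power a k q i : (i <= k)%N ->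
  (('X - a%:P) ^+ k * q)^`(i).[a] = if i == k then k`!%:R * q.[a] else 0.
Proof.
elim: k q i => [|k IHk] q [|i] // le_ik.
- by rewrite derivn0 expr0 !mul1r.
- by rewrite derivn0 exprS !hornerE subrr !mul0r.
rewrite derivSn derivM deriv_exp derivXsubC mul1r /= [(_ *+ k.+1) * q]mulrnAl.
rewrite -mulrnAr exprSr -mulrA -mulrDr IHk // eqSS; case: eqP => // _.
rewrite hornerD hornerM hornerXsubC subrr mul0r addr0 hornerMn factS natrM.
by rewrite -[_ *+ k.+1]mulr_natl mulrCA mulrA.
Qed.

(** The corrections m * ('X - a)^i are triangular with respect to the jet at a. *)
Lemma adjust_jet a m p (f : nat -> F) n : m.[a] != 0 ->
  exists q, forall i, (i < n)%N -> (p + m * q)^`(i).[a] = f i.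
Proof.
move=> ma0; elim: n => [|n [q Hq]]; first by exists 0.
(* n! m(a) is the n-th derivative at a of m * ('X - a)^n. *)
pose c := (f n - (p + m * q)^`(n).[a]) / (n`!%:R * m.[a]).
exists (q + c *: ('X - a%:P) ^+ n) => i; rewrite ltnS => le_in.
rewrite mulrDr addrA derivnD hornerD -scalerAr derivnZ hornerZ.
rewrite [m * _ ^+ _]mulrC derivn_root_power //.
have [->|ne] := eqVneq i n; last by rewrite mulr0 addr0 Hq // ltn_neqAle ne.
rewrite divfK; last by rewrite mulf_neq0 // pnatr_eq0 -lt0n fact_gt0.
by rewrite [LHS]addrC subrK.
Qed.

(** First fix the jet at 0, then the jet at 1 by multiples of X^n, which leave the former alone. *)
Lemma hermite_interpolation n (f g : nat -> F) :
  exists p, forall i, (i < n)%N -> p^`(i).[0] = f i /\ p^`(i).[1] = g i.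
Proof.
have [p0 Hp0] := @adjust_jet 0 1 0 f n ltac:(by rewrite hornerC oner_neq0).
have [q Hq] := @adjust_jet 1 ('X^n) p0 g n ltac:(by rewrite hornerXn expr1n oner_neq0).
exists (p0 + 'X^n * q) => i lt_in; split; last exact: Hq.
rewrite derivnD hornerD.
have -> : 'X^n * q = ('X - 0%:P) ^+ n * q by rewrite polyC0 subr0.
rewrite derivn_root_power ?(ltnW lt_in) // ltn_eqF // addr0 -Hp0 //.
by rewrite add0r mul1r.
Qed.
End Hermite.

(** * Steering by polynomial trajectories *)

Section KalmanSteering.
Local Open Scope ring_scope.
Variable R : realType.

Lemma resolvent_spans n m (A : 'M[R]_n.+1) (B : 'M[R]_(n.+1, m)) :
  (forall v : 'rV[R]_n.+1, (forall k, v *m A ^+ k *m B = 0) -> v = 0) ->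
  forall x0 : 'cV[R]_n.+1, exists y : nat -> 'cV[R]_m,
    x0 = \sum_(i < n.+1) resolvent_coef A i *m B *m y i.
Proof.
move=> kal x0; pose C (i : 'I_n.+1) := resolvent_coef A i *m B.
have detC : \det (gram C) != 0.
  apply/gram_det_neq0 => v v0; apply: kal; apply: powers_from_resolvent => i le_in.
  by rewrite -mulmxA; apply: (v0 (Ordinal (le_in : i < n.+1)%N)).
have uC : gram C \in unitmx by rewrite unitmxE unitfE.
exists (fun i => (resolvent_coef A i *m B)^T *m (invmx (gram C) *m x0)).
rewrite -[LHS](mulKVmx uC) {1}/gram mulmx_suml.
by apply: eq_bigr => i _; rewrite !mulmxA.
Qed.

(** The polynomial curve x = sum_i N_i B phi^(i) is driven by u = sum_i chi_i phi^(i), where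
N_i = [resolvent_coef] i and chi is the characteristic polynomial: this is
N_(i-1) = A N_i + chi_i.  Since the N_i B span the state space, both ends of x can be
prescribed through the derivatives of phi at 0 and 1. *)
Lemma kalman_controllable n m (A : 'M[R]_n.+1) (B : 'M[R]_(n.+1, m)) :
  (forall v : 'rV[R]_n.+1, (forall k, v *m A ^+ k *m B = 0) -> v = 0) ->
  controllable A B.
Proof.
move=> kal x0 x1.
have [y0 Hy0] := resolvent_spans kal x0; have [y1 Hy1] := resolvent_spans kal x1.
have [phi Hphi] : exists phi : 'I_m -> {poly R}, forall k i, (i < n.+1)%N ->
    (phi k)^`(i).[0] = y0 i k 0 /\ (phi k)^`(i).[1] = y1 i k 0.
  have [phi Hphi] := fin_all_exists (fun k : 'I_m =>
    @hermite_interpolation _ n.+1 (fun i => y0 i k 0) (fun i => y1 i k 0)).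
  by exists phi => k i; apply: Hphi.
pose z i t : 'cV[R]_m := \col_k ((phi k)^`(i)).[t].
pose u t : 'cV[R]_m := \sum_(i < n.+2) (char_poly A)`_i *: z i t.
pose x t : 'cV[R]_n.+1 := \sum_(i < n.+1) resolvent_coef A i *m B *m z i t.
pose pu k : {poly R} := \sum_(i < n.+2) (char_poly A)`_i *: (phi k)^`(i).
pose px j a : {poly R} :=
  \sum_(i < n.+1) \sum_k (resolvent_coef A i *m B) a k *: (phi k)^`(j + i).
have uE t k : u t k 0 = (pu k).[t].
  rewrite /u /pu summxE horner_sum; apply: eq_bigr => i _.
  by rewrite !mxE hornerZ.
have xE j t a :
    (\sum_(i < n.+1) resolvent_coef A i *m B *m z (j + i)%N t) a 0 = (px j a).[t].
  rewrite summxE horner_sum; apply: eq_bigr => i _; rewrite mxE horner_sum.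
  by apply: eq_bigr => k _; rewrite hornerZ [z _ _ _ _]mxE.
have dpx a : (px 0 a)^`() = px 1 a.
  rewrite /px raddf_sum; apply: eq_bigr => i _; rewrite raddf_sum /=.
  by apply: eq_bigr => k _; rewrite derivZ -derivnS add0n.
exists 1, u, x; split; rewrite ?ltr01 //; last 2 first.
- rewrite Hy0; apply: eq_bigr => i _; congr (_ *m _).
  by apply/colP => k; rewrite mxE; apply: (Hphi k i (ltn_ord i)).1.
- rewrite Hy1; apply: eq_bigr => i _; congr (_ *m _).
  by apply/colP => k; rewrite mxE; apply: (Hphi k i (ltn_ord i)).2.
split=> [k|a t].
  have -> : (fun t => u t k 0) = horner (pu k) by apply/boolp.funext => t; apply: uE.
  exact: continuous_horner.
have -> : (fun t => x t a 0) = horner (px 0 a).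
  by apply/boolp.funext => r; rewrite -xE.
have := is_derive_poly (px 0 a) t; rewrite dpx -xE.
suff -> : \sum_(i < n.+1) resolvent_coef A i *m B *m z (1 + i)%N t =
  A *m x t + B *m u t by [].
have -> : A *m x t = \sum_(i < n.+2) A *m resolvent_coef A i *m B *m z i t.
  rewrite big_ord_recr /= resolvent_coef_big // mulmx0 !mul0mx addr0 mulmx_sumr.
  by apply: eq_bigr => i _; rewrite !mulmxA.
rewrite /u mulmx_sumr -big_split /=.
have term i (w : 'cV[R]_m) : A *m resolvent_coef A i *m B *m w +
    B *m ((char_poly A)`_i *: w) =
    (A *m resolvent_coef A i + ((char_poly A)`_i)%:M) *m B *m w.
  by rewrite !mulmxDl mul_scalar_mx -!scalemxAl scalemxAr.
rewrite [in RHS]big_ord_recl term resolvent_coef0 !mul0mx add0r.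
by apply: eq_bigr => i _; rewrite term -resolvent_coefS.
Qed.
End KalmanSteering.

(** * Feasible sets *)

Lemma partial_injection_perm (T : finType) (D : {set T}) (f : T -> T) :
  {in D &, injective f} -> exists s : {perm T}, {in D, s =1 f}.
Proof.
move=> injf; pose E := f @: D.
have cardC : #|~: D| = #|~: E|.
  by have := cardsC D; have := cardsC E; rewrite card_in_imset // => <- /addnI.
(* The complements of D and of its image have the same size; match their enumerations. *)
have [g gE g_inj] : exists2 g : T -> T, {in ~: D, forall x, g x \in ~: E} &
    {in ~: D &, injective g}.
  exists (fun x => nth x (enum (~: E)) (index x (enum (~: D)))) => [x xD|x y xD yD].
    by rewrite -mem_enum mem_nth // -cardE -cardC cardE index_mem mem_enum.
  have lt z : z \in ~: D -> index z (enum (~: D)) < size (enum (~: E)).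
    by move=> zD; rewrite -cardE -cardC cardE index_mem mem_enum.
  rewrite (set_nth_default x) ?lt // => /eqP; rewrite nth_uniq ?lt ?enum_uniq //.
  by move=> /eqP /(congr1 (nth x (enum (~: D)))); rewrite !nth_index ?mem_enum.
pose h x := if x \in D then f x else g x.
have h_inj : injective h.
  move=> x y; rewrite /h; case: ifPn => xD; case: ifPn => yD.
  - exact: injf.
  - move=> eqfg; have := gE y; rewrite inE yD -eqfg => /(_ isT).
    by rewrite inE imset_f.
  - move=> eqfg; have := gE x; rewrite inE xD eqfg => /(_ isT).
    by rewrite inE imset_f.
  - by apply: g_inj; rewrite inE.
by exists (perm h_inj) => x xD; rewrite permE /h xD.
Qed.

Section Feasibility.
Local Open Scope ring_scope.
Variable R : realType.

Definition unit_inputs n (S : {set 'I_n}) : 'M[R]_(n, #|S|) :=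
  \matrix_(i, k) (i == enum_val k)%:R.

Lemma row_unit_inputs n (S : {set 'I_n}) (v : 'rV[R]_n) k :
  (v *m unit_inputs S) 0 k = v 0 (enum_val k).
Proof.
rewrite mxE (bigD1 (enum_val k)) //= big1 => [|i /negPf ne].
  by rewrite mxE eqxx mulr1 addr0.
by rewrite mxE ne mulr0.
Qed.

Lemma feasible_of_cover n (A : 'M[bool]_n) (S : {set 'I_n}) (f : 'I_n -> 'I_n) :
  (forall x, x \notin S -> A x (f x)) -> {in ~: S &, injective f} ->
  (forall x, exists2 y, y \in S & connect (digraph A) y x) ->
  feasible R A S.
Proof.
case: n A S f => [|n] A S f Af injf reach.
  exists 0, 0; split; [by case | by case |] => x0 x1.
  exists 1, (fun=> 0), (fun=> x0); split; rewrite ?ltr01 //; last by apply/colP => -[].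
  split; last by case.
  move=> k; have -> : (fun t : R => (0 : 'cV[R]_#|S|) k 0) = cst 0.
    by apply/funext => t; rewrite mxE.
  exact: cst_continuous.
have [s sE] := partial_injection_perm injf.
have [x xS | y|A1 [A1P kal1]] := @exists_kalman_weights R n (digraph A) S s.
- by rewrite sE ?inE // /digraph Af.
- exact: reach.
have [A0 [A0P kal0]] := exists_kalman_pattern A1P kal1.
exists A0, (unit_inputs S); split=> [//|i k|].
  by rewrite !mxE; case: (i == enum_val k); rewrite ?oner_eq0 ?eqxx.
apply: kalman_controllable => v v0; apply: kal0 => k i iS.
have := congr1 (fun M : 'rV__ => M 0 (enum_rank_in iS i)) (v0 k).
by rewrite row_unit_inputs enum_rankK_in // => ->; rewrite mxE.
Qed.

Lemma pattern_row0 n (S : {set 'I_n}) (B : 'M[R]_(n, #|S|)) i :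
  has_pattern (dedicated_inputs S) B -> i \notin S -> row i B = 0.
Proof.
move=> BP iS; apply/rowP => k; rewrite !mxE; apply/eqP; rewrite -[_ == _]negbK BP mxE.
by apply: contraNN iS => /eqP ->; apply: enum_valP.
Qed.

(** v x(t) is constant, while a trajectory from 0 to v^T makes it grow from 0 to |v|^2. *)
Lemma controllable_left_kernel n m (A : 'M[R]_n) (B : 'M[R]_(n, m)) (v : 'rV[R]_n) :
  controllable A B -> v *m A = 0 -> v *m B = 0 -> v = 0.
Proof.
move=> ctrl vA vB; have [T [u [x [T0 [_ dx] x0 xT]]]] := ctrl 0 v^T.
have cst_vx : forall t, (v *m x t) 0 0 = (v *m x 0) 0 0.
  move=> t; apply: (@is_derive_0_is_cst _ (fun t => (v *m x t) 0 0)) => r.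
  have -> : (fun t => (v *m x t) 0 0) = \sum_(i < n) (v 0 i \*: (fun s => x s i 0)).
    by apply/funext => q; rewrite mxE fct_sumE.
  have : is_derive r 1 (\sum_(i < n) (v 0 i \*: (fun s : R => x s i 0)))
    (\sum_(i < n) (v 0 i *: (A *m x r + B *m u r) i 0)).
    by apply: is_derive_sum => i; apply: is_deriveZ.
  suff -> : \sum_(i < n) (v 0 i *: (A *m x r + B *m u r) i 0) = 0 by [].
  transitivity ((v *m (A *m x r + B *m u r)) 0 0); first by rewrite mxE.
  by rewrite mulmxDr !mulmxA vA vB !mul0mx addr0 mxE.
have := cst_vx T; rewrite x0 xT mulmx0 mxE [RHS]mxE => sumsq.
have sq0 : \sum_i v 0 i ^+ 2 = 0.
  by rewrite -[RHS]sumsq; apply: eq_bigr => i _; rewrite mxE expr2.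
apply/rowP => i; rewrite [RHS]mxE; apply/eqP; rewrite -sqrf_eq0; apply/eqP.
by move/psumr_eq0P: sq0; apply=> // j _; apply: sqr_ge0.
Qed.

(** The rows of A0 outside S are independent, since B0 has no entry in them; a nonvanishing
product in the expansion of a maximal minor selects distinct columns with nonzero entries. *)
Lemma feasible_cover n (A : 'M[bool]_n) (S : {set 'I_n}) : feasible R A S ->
  exists2 f : 'I_n -> 'I_n, (forall x, x \notin S -> A x (f x)) &
    {in ~: S &, injective f}.
Proof.
case=> A0 [B0 [A0P B0P ctrl]]; pose k := #|~: S|.
pose Q : 'M[R]_(k, n) := rowsub (enum_val : 'I_k -> 'I_n) A0.
have freeQ : row_free Q.
  rewrite -kermx_eq0; apply/eqP/row_matrixP => i; rewrite row0.
  set w := row i _; have wQ : w *m Q = 0 by apply/sub_kermxP; apply: row_sub.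
  pose E : 'M[R]_(k, n) := rowsub (enum_val : 'I_k -> 'I_n) 1%:M.
  have wE0 : w *m E = 0.
    apply: (controllable_left_kernel ctrl); first by rewrite -mulmxA -rowsubE.
    rewrite -mulmxA -rowsubE (_ : rowsub _ _ = 0) ?mulmx0 //.
    apply/row_matrixP => l; rewrite row_rowsub row0.
    by apply: pattern_row0 B0P _; have := enum_valP l; rewrite inE.
  apply/rowP => l; rewrite [RHS]mxE.
  have /rowP/(_ (enum_val l)) := wE0; rewrite [RHS]mxE => <-.
  rewrite [RHS]mxE (bigD1 l) //= big1 => [|a /negPf ne]; rewrite !mxE.
    by rewrite eqxx mulr1 addr0.
  by rewrite (inj_eq enum_val_inj) ne mulr0.
have fullQ : row_full Q^T by rewrite /row_full mxrank_tr.
pose g := fullrankfun fullQ; pose D := rowsub g Q^T.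
have detD : \det D != 0 by rewrite -unitfE -unitmxE fullrowsub_unit.
have [s Ds] : exists s : 'S_k, forall i, D i (s i) != 0.
  have [s /forallP Ds|no_s] := pickP [pred s : 'S_k | [forall i, D i (s i) != 0]].
    by exists s.
  case/eqP: detD; rewrite /determinant big1 // => s _.
  have /negbT/forallPn[i] := no_s s; rewrite negbK => /eqP Di0.
  by rewrite (bigD1 i) //= Di0 mul0r mulr0.
have [f fP] : exists f : 'I_n -> 'I_n, forall x, x \notin S ->
    exists2 i, x = enum_val (s i) & f x = g i.
  apply: (@fin_all_exists _ _ (fun x y => x \notin S ->
    exists2 i, x = enum_val (s i) & y = g i)) => x.
  have [xS|xS] := boolP (x \in S); first by exists x.
  have xS' : x \in ~: S by rewrite inE.
  exists (g ((s^-1)%g (enum_rank_in xS' x))) => _.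
  by exists ((s^-1)%g (enum_rank_in xS' x)); rewrite ?permKV ?enum_rankK_in.
exists f => [x /fP[i -> ->]|x y]; first by have := Ds i; rewrite !mxE A0P.
rewrite !inE => /fP[i -> ->] /fP[j -> ->] /fullrankfun_inj -> //.
Qed.

(** Otherwise the states of C form an autonomous system.  Its energy V satisfies V' <= K V, so
exp (- K t) V(t) does not increase, and V stays at 0 when it starts there. *)
Lemma feasible_meets_closed n (A : 'M[bool]_n) (S C : {set 'I_n}) :
  feasible R A S -> C != set0 ->
  (forall x y, digraph A x y -> y \in C -> x \in C) -> S :&: C != set0.
Proof.
case=> A0 [B0 [A0P B0P ctrl]] /set0Pn[c cC] closedC; apply/negP => /eqP SC0.
have notS i : i \in C -> i \notin S.
  by move=> iC; apply/negP => iS; have := in_set0 i; rewrite -SC0 inE iS iC.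
have [T [u [x [T0 [_ dx] x0 xT]]]] := ctrl 0 (const_mx 1).
pose V t := \sum_(i in C) x t i 0 ^+ 2.
pose dV t := \sum_(i in C) 2 * x t i 0 * (\sum_(j in C) A0 i j * x t j 0).
pose K := 2 * \sum_(i in C) \sum_(j in C) `|A0 i j|.
have dxC i t : i \in C ->
    is_derive t (1 : R) (fun s => x s i 0) (\sum_(j in C) A0 i j * x t j 0).
  move=> iC; suff <- : (A0 *m x t + B0 *m u t) i 0 = \sum_(j in C) A0 i j * x t j 0.
    exact: dx.
  have Bu : (B0 *m u t) i 0 = 0.
    have /rowP r0 := pattern_row0 B0P (notS i iC).
    by rewrite mxE big1 // => k _; have := r0 k; rewrite !mxE => ->; rewrite mul0r.
  rewrite mxE Bu addr0 mxE [RHS]big_mkcond /=; apply: eq_bigr => j _.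
  case: ifPn => // jC; suff -> : A0 i j = 0 by rewrite mul0r.
  apply/eqP; rewrite -[_ == _]negbK A0P; apply: contraNN jC => Aij.
  exact: closedC Aij iC.
have derivV t : is_derive t (1 : R) V (dV t).
  have -> : V = \sum_(i in C) (fun s => x s i 0) ^+ 2.
    by apply/funext => s; rewrite fct_sumE; apply: eq_bigr.
  rewrite /dV; elim/big_ind2 : _ => [|f df g dg|i iC].
  - exact: is_derive_cst.
  - exact: is_deriveD.
  by apply: (is_derive_eq (is_deriveX 2 (dxC i t iC))); rewrite expr1.
have bound t : dV t <= K * V t.
  have Vge i : i \in C -> x t i 0 ^+ 2 <= V t.
    move=> iC; rewrite /V (bigD1 i) //= lerDl; apply: sumr_ge0 => *; apply: sqr_ge0.
  rewrite /dV /K -mulrA mulr_suml mulr_sumr; apply: ler_sum => i iC.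
  rewrite -mulrA ler_pM2l ?ltr0n // mulr_suml mulr_sumr; apply: ler_sum => j jC.
  apply: le_trans (ler_norm _) _; rewrite !normrM mulrCA ler_wpM2l //.
  have Hi := Vge i iC; have Hj := Vge j jC.
  rewrite -![x _ _ _ ^+ 2]real_normK ?num_real // in Hi Hj.
  nra.
pose W t := expR (- K * t) * V t.
have derivW t : is_derive t (1 : R) W (expR (- K * t) * (dV t - K * V t)).
  have dexp : is_derive t (1 : R) (fun r => expR (- K * r)) (expR (- K * t) * - K).
    have dlin : is_derive t (1 : R) (fun r => - K * r) (- K).
      by apply: (is_derive_eq (is_deriveZ (- K) (is_derive_id t 1))); rewrite scaler1.
    exact: (is_derive1_comp (is_derive_expR (- K * t)) dlin).
  apply: (is_derive_eq (is_deriveM dexp (derivV t))).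
  by rewrite /GRing.scale /=; ring.
have W0 : W 0 = 0.
  by rewrite /W /V big1 ?mulr0 // => i _; rewrite x0 mxE expr0n.
have : W T <= W 0.
  apply: (@ler0_derive1_le_cc R W 0 T); rewrite ?in_itv /= ?lexx ?ltW //.
  - move=> t _; rewrite derive1E (@derive_val _ _ _ _ _ _ _ (derivW t)).
    by rewrite pmulr_rle0 ?expR_gt0 // subr_le0.
  - by apply: derivable_within_continuous => t _; case: (derivW t).
rewrite W0 /W pmulr_rle0 ?expR_gt0 //; apply/negP; rewrite -ltNge.
rewrite /V (bigD1 c) //= xT mxE expr1n.
by apply: ltr_pwDl => //; apply: sumr_ge0 => *; apply: sqr_ge0.
Qed.
End Feasibility.

(** * Non-top linked components *)

Section TopComponents.
Variables (n : nat) (A : 'M[bool]_n).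
Local Notation reach := (connect (digraph A)).

Definition scc x : {set 'I_n} := [set y | reach x y && reach y x].

Definition is_source x := [forall y, reach y x ==> reach x y].

Lemma scc_refl x : x \in scc x.
Proof. by rewrite inE connect0. Qed.

Lemma eq_scc x y : y \in scc x -> scc y = scc x.
Proof.
rewrite inE => /andP[xy yx]; apply/setP => z; rewrite !inE.
by apply/andP/andP => -[h1 h2]; split; apply: connect_trans; eassumption.
Qed.

(** A more usable form of having no incoming edge: whatever reaches x is reached from x. *)
Lemma non_top_linkedP C :
  reflect (exists2 x, is_source x & C = scc x) (non_top_linked A C).
Proof.
apply: (iffP andP) => [[/imsetP[x _ ->] /forallP closed] | [x /forallP src ->]].
  have setE : [set y in [set: 'I_n] | reach x y && reach y x] = scc x.
    by apply/setP => y; rewrite !inE.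
  rewrite setE in closed *; exists x => //; apply/forallP => y; apply/implyP.
  case/connectP=> p; have: last y p = x -> last y p \in scc x.
    by move=> ->; apply: scc_refl.
  move=> last_in pP def_x; have {last_in def_x} := last_in (esym def_x).
  suff: last y p \in scc x -> y \in scc x.
    by move=> + lx => /(_ lx); rewrite inE => /andP[].
  elim: p y pP => //= z p IHp y /andP[Ayz pP] /(IHp _ pP) zC.
  by have /forallP/(_ z)/implyP/(_ Ayz)/implyP/(_ zC) := closed y.
split; first by apply/imsetP; exists x => //; apply/setP => y; rewrite !inE.
apply/forallP => y; apply/forallP => z; apply/implyP => Ayz; apply/implyP.
rewrite !inE => /andP[_ zx].
have yx : reach y x by apply: connect_trans zx; apply: connect1.
by rewrite yx andbT; apply: (implyP (src y)).
Qed.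

(** Among the vertices from which x can be reached, take one that has the fewest ancestors. *)
Lemma source_above x : exists2 y, is_source y & reach y x.
Proof.
have [y yx min_y] := @arg_minnP _ x (reach^~ x) (fun y => #|[set z | reach z y]|)
  (connect0 (digraph A) x).
exists y => //; apply/forallP => z; apply/implyP => zy.
have sub : [set w | reach w z] \subset [set w | reach w y].
  by apply/subsetP => w; rewrite !inE => wz; apply: connect_trans zy.
have le : #|[set w | reach w y]| <= #|[set w | reach w z]|.
  by apply: min_y; apply: connect_trans zy yx.
have /eqP eq_anc : [set w | reach w z] == [set w | reach w y] by rewrite eqEcard sub.
by move/setP/(_ y): eq_anc; rewrite !inE connect0.
Qed.
End TopComponents.

(** * Correctness of the algorithm *)

Section Correctness.
Variables (R : realType) (n : nat) (A : 'M[bool]_n) (beta : nat).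
Variables (N : 'I_beta -> {set 'I_n}) (M : {set ('I_n + 'I_beta) * 'I_n}).
Hypothesis N_step1 : step1_result A N.

Lemma step1_source i : exists2 x, is_source A x & N i = scc A x.
Proof. by case: N_step1 => _ NP; apply/non_top_linkedP/NP; exists i. Qed.

Lemma step1_disjoint i j x : x \in N i -> x \in N j -> i = j.
Proof.
have [y _ Ni] := step1_source i; have [z _ Nj] := step1_source j.
rewrite Ni Nj => xi xj; case: N_step1 => N_inj _; apply: N_inj.
by rewrite Ni Nj -(eq_scc xi) (eq_scc xj).
Qed.

(** A state outside the returned set is matched by an edge between states, which provides its
predecessor; the SCCs covered by M contribute an element of Theta, the others a selected state. *)
Lemma step4_feasible S :
  matching (aug_edge A N) M -> step4_result N M S -> feasible R A S.
Proof.
move=> [M_edge M_fst _] [sel selP ->].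
set S' := _ :|: _.
have [f fP] : exists f : 'I_n -> 'I_n, forall x, x \notin S' -> (inl (f x), x) \in M.
  apply: (@fin_all_exists _ _ (fun x y => x \notin S' -> (inl y, x) \in M)) => x.
  have [|xS] := boolP (x \in S'); first by exists x.
  move: xS; rewrite !inE !negb_or -andbA => /and3P[/forallPn[l]].
  rewrite negbK; case: l => [y yx _ _|i ix]; first by exists y.
  by case/existsPn/(_ i)/negP.
apply: (@feasible_of_cover R n A S' f) => [x /fP/M_edge //|x y|x].
- rewrite !in_setC => xS yS eqf.
  have := M_fst _ _ (fP x xS) (fP y yS); rewrite /= eqf => /(_ erefl) [].
  by [].
have [y src_y yx] := source_above A x.
have [i Ni] : exists i, N i = scc A y.
  by case: N_step1 => _ /(_ (scc A y)) [_ Nex]; apply/Nex/non_top_linkedP; exists y.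
suff [z zS] : exists2 z, z \in S' & z \in N i.
  by rewrite Ni inE => /andP[_ zy]; exists z => //; apply: connect_trans yx.
have [iU|] := boolP (i \in uncovered_SCCs M).
  by exists (sel i); [rewrite !inE imset_f ?orbT | apply: selP].
rewrite inE => /forallPn[z]; rewrite negbK => iz; exists z; last exact: (M_edge _ iz).
by rewrite !inE; apply/orP; left; apply/orP; right; apply/existsP; exists i.
Qed.

(** A feasible S' yields a matching with n - |S'| + beta edges, while S has at most |U_R| + beta
elements, where |U_R| = n - |M|. *)
Lemma step4_card S S' : maximum_matching (aug_edge A N) M ->
  step4_result N M S -> feasible R A S' -> #|S| <= #|S'|.
Proof.
move=> [[M_edge M_fst M_snd] M_max] [sel selP ->] feas.
have [f fP f_inj] := feasible_cover feas.
have [rep repP] : exists rep : 'I_beta -> 'I_n,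
    forall i, (rep i \in S') && (rep i \in N i).
  apply: (@fin_all_exists _ _ (fun i y => (y \in S') && (y \in N i))) => i.
  have [x /forallP src_x ->] := step1_source i.
  have [||y] := set0Pn _ (feasible_meets_closed feas (C := scc A x) _ _).
  - by apply/set0Pn; exists x; apply: scc_refl.
  - move=> y z Ayz; rewrite !inE => /andP[_ zx].
    have yx : connect (digraph A) y x by apply: connect_trans zx; apply: connect1.
    by rewrite yx andbT; apply: (implyP (src_x y)).
  by rewrite inE; exists y.
have rep_inj : injective rep.
  move=> i j eq_rep; have /andP[_ ri] := repP i; have /andP[_ rj] := repP j.
  by apply: step1_disjoint ri _; rewrite eq_rep.
(* M1 covers the states outside S', and M2 one state of S' in each SCC. *)
pose M1 : {set ('I_n + 'I_beta) * 'I_n} := [set (inl (f x), x) | x in ~: S'].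
pose M2 : {set ('I_n + 'I_beta) * 'I_n} := [set (inr i, rep i) | i in [set: 'I_beta]].
have M12_matching : matching (aug_edge A N) (M1 :|: M2).
  split=> [p|p q|p q].
  - case/setUP => /imsetP[]; first by move=> x; rewrite inE => /fP Axf ->.
    by move=> i _ -> /=; case/andP: (repP i).
  - case/setUP => /imsetP[x xP ->]; case/setUP => /imsetP[y yP ->] //= [eqxy].
      by rewrite (f_inj _ _ xP yP eqxy).
    by rewrite eqxy.
  - case/setUP => /imsetP[x xP ->]; case/setUP => /imsetP[y yP ->] //= eqxy.
    - by rewrite eqxy.
    - by move: xP; rewrite eqxy inE; case/andP: (repP y) => ->.
    - by move: yP; rewrite -eqxy inE; case/andP: (repP x) => ->.
    by rewrite (rep_inj _ _ eqxy).
have card12 : #|M1 :|: M2| = (n - #|S'|) + beta.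
  rewrite cardsU (_ : M1 :&: M2 = set0); last first.
    apply/setP => p; rewrite !inE; apply/negP => /andP[/imsetP[x _ ->]].
    by case/imsetP.
  rewrite cards0 subn0 !card_imset ?cardsT ?card_ord; last 2 first.
  - by move=> x y [].
  - by move=> i j [].
  congr (_ + _); have := cardsC S'; rewrite card_ord => e.
  by rewrite -[X in X - _]e addKn.
have := M_max _ M12_matching; rewrite card12 => geM.
have cardU : #|right_unmatched M| + #|M| = n.
  rewrite -[RHS]card_ord -(cardsC (right_unmatched M)); congr (_ + _).
  rewrite -(card_in_imset M_snd); apply: eq_card => x; rewrite !inE.
  apply/imsetP/forallPn => [[[l y] ly ->]|[l]]; first by exists l; rewrite negbK.
  by rewrite negbK => lx; exists (l, x).
have cardT : #|Theta M| <= #|~: uncovered_SCCs M|.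
  have [g gP] : exists g : 'I_n -> 'I_beta + unit, forall x, x \in Theta M ->
      exists2 i, g x = inl i & (inr i, x) \in M.
    apply: (@fin_all_exists _ _ (fun x y => x \in Theta M ->
      exists2 i, y = inl i & (inr i, x) \in M)) => x.
    have [|xT] := boolP (x \in Theta M); last by exists (inr tt).
    by rewrite inE => /existsP[i ix]; exists (inl i) => _; exists i.
  rewrite -(card_in_imset (f := g)) => [|x y /gP[i -> ix] /gP[j -> jy] [eqij]].
    rewrite -(card_imset (mem (~: uncovered_SCCs M)) (@inl_inj _ unit)).
    apply/subset_leq_card/subsetP.
    move=> _ /imsetP[x /gP[i -> ix] ->]; apply: imset_f; rewrite !inE.
    by apply/forallPn; exists x; rewrite negbK.
  by rewrite eqij in ix; have := M_fst _ _ ix jy erefl => -[].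
have := cardsC (uncovered_SCCs M); rewrite card_ord => cardI.
have leS' : #|S'| <= n by rewrite -[X in _ <= X]card_ord max_card.
have := leq_imset_card sel (mem (uncovered_SCCs M)).
have := leq_card_setU (right_unmatched M :|: Theta M) (sel @: uncovered_SCCs M).
have := leq_card_setU (right_unmatched M) (Theta M).
move=> [leUT _] [leS _] leSel; apply: leq_trans leS _.
have {}leSel : #|sel @: uncovered_SCCs M| <= #|uncovered_SCCs M| by [].
move: cardU cardT cardI leS' geM leUT leSel.
move: (#|right_unmatched M|) (#|M|) (#|Theta M|) (#|~: _|) (#|uncovered_SCCs M|).
move: (#|S'|) (#|_ :|: _|) (#|_ @: _|).
by clear; lia.
Qed.
End Correctness.

Lemma algorithm1_correct (R : realType) n (A : 'M[bool]_n) S :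
  algorithm1_returns A S ->
  minimal_feasible R A S /\ is_min_number_dedicated R A #|S|.
Proof.
case=> beta [N [M [NP [M_max _] MS]]].
have feasS : feasible R A S.
  by case: M_max => M_matching _; apply: (step4_feasible R NP M_matching MS).
have minS S' := step4_card (R := R) (S' := S') NP M_max MS.
by split; split=> //; exists S.
Qed.

(** * Programs with counting loops *)

(** Programs with counting loops: PFor v b p runs p with v = 0, 1, up to the value of b, excluded,
where b is a variable.  They have a total denotation [run], and a bound on their running time
can be read off from their syntax. *)
Inductive prog : Type :=
| PSkip
| PAssign of nat & expr
| PStore of nat & expr & expr & expr
| PSeq of prog & prog
| PIf of expr & prog & prog
| PFor of nat & nat & prog.

Declare Scope prog_scope.
Notation "p ;; q" := (PSeq p q) (at level 61, right associativity) : prog_scope.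
Open Scope prog_scope.

Fixpoint compile (p : prog) : cmd :=
  match p with
  | PSkip => Skip
  | PAssign v e => Assign v e
  | PStore a e1 e2 e => Store a e1 e2 e
  | PSeq p q => Seq (compile p) (compile q)
  | PIf g p q => If g (compile p) (compile q)
  | PFor v b p => Seq (Assign v (Const 0))
      (While (Ltn (Var v) (Var b)) (Seq (compile p) (Assign v (Succ (Var v)))))
  end.

Fixpoint run (p : prog) (s : memory) : memory :=
  match p with
  | PSkip => s
  | PAssign v e => set_var s v (eval s e)
  | PStore a e1 e2 e => set_cell s a (eval s e1) (eval s e2) (eval s e)
  | PSeq p q => run q (run p s)
  | PIf g p q => if eval s g != 0 then run p s else run q s
  | PFor v b p =>
      iter (var s b) (fun s => set_var (run p s) v (var (run p s) v).+1)
        (set_var s v 0)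
  end.

Fixpoint assigned (p : prog) : seq nat :=
  match p with
  | PSkip | PStore _ _ _ _ => [::]
  | PAssign v _ => [:: v]
  | PSeq p q | PIf _ p q => assigned p ++ assigned q
  | PFor v _ p => v :: assigned p
  end.

Fixpoint stored (p : prog) : seq nat :=
  match p with
  | PSkip | PAssign _ _ => [::]
  | PStore a _ _ _ => [:: a]
  | PSeq p q | PIf _ p q => stored p ++ stored q
  | PFor _ _ p => stored p
  end.

(** The bounds of all loops are in bs and are never assigned, and no loop body touches its own
counter: then each loop runs exactly as often as announced. *)
Fixpoint bounded_by (bs : seq nat) (p : prog) : bool :=
  match p with
  | PSkip | PStore _ _ _ _ => true
  | PAssign v _ => v \notin bs
  | PSeq p q | PIf _ p q => bounded_by bs p && bounded_by bs q
  | PFor v b p =>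
      [&& v \notin bs, b \in bs, v \notin assigned p & bounded_by bs p]
  end.

Fixpoint depth (p : prog) : nat :=
  match p with
  | PSkip | PAssign _ _ | PStore _ _ _ _ => 0
  | PSeq p q | PIf _ p q => maxn (depth p) (depth q)
  | PFor _ _ p => (depth p).+1
  end.

(** 13 pays for the overhead of a loop: 2 to reset the counter and 4 for the last test, both
charged once, and 7 for the test and the increment in each round. *)
Fixpoint weight (p : prog) : nat :=
  match p with
  | PSkip => 1
  | PAssign _ e => (expr_ops e).+1
  | PStore _ e1 e2 e => (expr_ops e1 + expr_ops e2 + expr_ops e).+1
  | PSeq p q => weight p + weight q
  | PIf g p q => (expr_ops g + (weight p + weight q)).+1
  | PFor _ _ p => 13 + weight p
  end.

Definition agree_outside (vs ars : seq nat) (s s' : memory) : Prop :=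
  (forall w, w \notin vs -> var s' w = var s w) /\
  (forall a, a \notin ars -> arr s' a = arr s a).

Lemma run_frame p s : agree_outside (assigned p) (stored p) s (run p s).
Proof.
elim: p s => [|v e|a e1 e2 e|p IHp q IHq|g p IHp q IHq|v b p IHp] s //=.
- by split=> // w; rewrite inE => /negPf wv; rewrite /= wv.
- split=> // a'; rewrite inE => /negPf aa.
  by apply/funext => i; apply/funext => j; rewrite /= aa.
- have [vp ap] := IHp s; have [vq aq] := IHq (run p s).
  split=> [w|a]; rewrite mem_cat negb_or => /andP[np nq].
    by rewrite vq // vp.
  by rewrite aq // ap.
- have [vp ap] := IHp s; have [vq aq] := IHq s.
  by split=> [w|a]; rewrite mem_cat negb_or => /andP[np nq]; case: ifP => _; auto.
- elim: (var s b) => [|k [IHv IHa]] /=.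
    by split=> // w; rewrite inE negb_or => /andP[/negPf wv _]; rewrite /= wv.
  set s' := iter _ _ _ in IHv IHa *; have [vp ap] := IHp s'.
  split=> [w wp|a np]; last by rewrite ap // IHa.
  move: (wp); rewrite inE negb_or => /andP[/negPf wv np].
  by rewrite /= wv vp // IHv.
Qed.

Lemma run_var p s w : w \notin assigned p -> var (run p s) w = var s w.
Proof. by case: (run_frame p s) => + _; apply. Qed.

Lemma run_arr p s a : a \notin stored p -> arr (run p s) a = arr s a.
Proof. by case: (run_frame p s) => _; apply. Qed.

(** Loop rule.  The body may use that everything it cannot modify still has the value it had
before the loop. *)
Lemma run_for_ind (I : nat -> memory -> Prop) v b p s :
  v \notin assigned p -> I 0 (set_var s v 0) ->
  (forall k s', k < var s b -> var s' v = k ->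
     agree_outside (v :: assigned p) (stored p) s s' ->
     I k s' -> I k.+1 (set_var (run p s') v k.+1)) ->
  I (var s b) (run (PFor v b p) s).
Proof.
move=> v_p I0 step /=; set f := fun s => _.
suff: forall k, k <= var s b -> [/\ I k (iter k f (set_var s v 0)),
    var (iter k f (set_var s v 0)) v = k &
    agree_outside (v :: assigned p) (stored p) s (iter k f (set_var s v 0))].
  by case/(_ _ (leqnn _)).
elim=> [_|k IHk lt_kb] /=.
  split=> //=; first by rewrite eqxx.
  by split=> // w; rewrite inE negb_or => /andP[/negPf wv _]; rewrite /= wv.
have [Ik vk fk] := IHk (ltnW lt_kb); set s' := iter _ _ _ in Ik vk fk *.
have vS : var (run p s') v = k by rewrite run_var.
split; rewrite /f /= ?vS ?eqxx //; first exact: step.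
have [fv fa] := fk; split=> [w wp|a np] /=; last by rewrite run_arr // fa.
by move: (wp); rewrite inE negb_or => /andP[/negPf -> np]; rewrite run_var // fv.
Qed.

Lemma exec_compile bs p s N : bounded_by bs p -> 0 < N ->
  (forall b, b \in bs -> var s b <= N) ->
  exists2 t, exec (compile p) s t (run p s) & t <= weight p * N ^ depth p.
Proof.
move=> + N0; have bs_inv q s' : bounded_by bs q -> forall b, b \in bs ->
    var (run q s') b = var s' b.
  move=> + b bin; suff: bounded_by bs q -> b \notin assigned q.
    by move=> h /h; apply: run_var.
  elim: q => //= [v e|q IHq r IHr|_ q IHq r IHr|v c q IHq].
  - by rewrite inE; apply: contraNN => /eqP <-.
  - by rewrite mem_cat negb_or => /andP[/IHq -> /IHr ->].
  - by rewrite mem_cat negb_or => /andP[/IHq -> /IHr ->].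
  case/and4P=> v_bs _ _ /IHq bq; rewrite inE negb_or bq andbT.
  by apply: contraNneq v_bs => <-.
have powN i j : i <= j -> N ^ i <= N ^ j by move=> ?; rewrite leq_pexp2l.
elim: p s => [|v e|a e1 e2 e|p IHp q IHq|g p IHp q IHq|v b p IHp] s /= wf sN.
- by exists 1; [constructor|].
- by exists (expr_ops e).+1; [constructor|rewrite muln1].
- by exists (expr_ops e1 + expr_ops e2 + expr_ops e).+1; [constructor|rewrite muln1].
- case/andP: wf => wp wq; have [t1 e1 l1] := IHp s wp sN.
  have [|t2 e2 l2] := IHq (run p s) wq; first by move=> b bin; rewrite bs_inv ?sN.
  exists (t1 + t2); first exact: exec_seq e1 e2.
  rewrite mulnDl leq_add //; [apply: leq_trans l1 _|apply: leq_trans l2 _];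
    by rewrite leq_mul2l powN ?orbT // ?leq_maxl ?leq_maxr.
- case/andP: wf => wp wq.
  have [t e le] : exists2 t, exec (if eval s g != 0 then compile p else compile q) s t
      (if eval s g != 0 then run p s else run q s) &
      t <= (weight p + weight q) * N ^ maxn (depth p) (depth q).
    case: ifP => _; [have [t e le] := IHp s wp sN | have [t e le] := IHq s wq sN];
      exists t => //; apply: leq_trans le _; apply: leq_mul;
      by rewrite ?leq_addr ?leq_addl ?powN ?leq_maxl ?leq_maxr.
  exists (expr_ops g + t).+1; first exact: exec_if.
  have := powN 0 _ (leq0n (maxn (depth p) (depth q))); rewrite expn0.
  rewrite mulSn mulnDl.
  move: le; move: (N ^ _) (weight p + weight q) => X w le X1.
  by have := leq_mul (leqnn (expr_ops g)) X1; lia.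
case/and4P: wf => v_bs b_bs v_p wp; pose K := weight p * N ^ depth p.
pose f s := set_var (run p s) v (var (run p s) v).+1.
have loop k s' : var s' v + k = var s' b ->
    (forall b, b \in bs -> var s' b <= N) ->
    exists2 t, exec (While (Ltn (Var v) (Var b))
                (Seq (compile p) (Assign v (Succ (Var v))))) s' t (iter k f s') &
      t <= 4 + k * (7 + K).
  have vb : (b == v) = false by apply/negP => /eqP eq_bv; rewrite -eq_bv b_bs in v_bs.
  elim: k s' => [|k IHk] s' vk s'N.
    exists 4 => //; apply: (exec_while_stop (g := Ltn (Var v) (Var b))).
    by rewrite /= -vk addn0 ltnn.
  have [t1 ex1 le1] := IHp s' wp s'N.
  have v1 : var (run p s') v = var s' v by rewrite run_var.
  have b1 c : c \in bs -> var (f s') c = var s' c.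
    move=> cb; have [eq_cv|/negPf cv] := eqVneq c v.
      by rewrite -eq_cv cb in v_bs.
    by rewrite /f /= cv bs_inv.
  have [||t2 ex2 le2] := IHk (f s').
  - by rewrite (b1 b) // -vk /f /= eqxx v1 addSnnS.
  - by move=> c cb; rewrite b1 ?s'N.
  exists (3 + (t1 + 3) + t2).+1; last by move: le1 le2; rewrite -/K; nia.
  rewrite iterSr; apply: (exec_while_loop (g := Ltn (Var v) (Var b))) ex2.
    by rewrite /= -vk; case: ltngtP => //; lia.
  apply: exec_seq ex1 _; exact: (@exec_assign (run p s') v (Succ (Var v))).
have vb : (b == v) = false by apply/negP => /eqP eq_bv; rewrite -eq_bv b_bs in v_bs.
have [||t ex le] := loop (var s b) (set_var s v 0).
- by rewrite /= eqxx vb.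
- move=> c cb /=; case: eqP => [eq_cv|_]; last exact: sN.
  by rewrite -eq_cv cb in v_bs.
exists (2 + t); first by apply: exec_seq ex; apply: (@exec_assign s v (Const 0)).
have bN := sN b b_bs; have := powN 0 _ (leq0n (depth p)).
rewrite expn0 expnS; move: le; rewrite /K; move: (N ^ _) (weight p) => a c.
move=> le a1; apply: leq_trans (_ : 6 + N * (7 + c * a) <= _).
  have := leq_mul bN (leqnn (7 + c * a)); lia.
nia.
Qed.

Lemma run_seq p q s : run (p ;; q) s = run q (run p s). Proof. by []. Qed.
Lemma run_assign v e s : run (PAssign v e) s = set_var s v (eval s e).
Proof. by []. Qed.
Lemma run_store a e1 e2 e s :
  run (PStore a e1 e2 e) s = set_cell s a (eval s e1) (eval s e2) (eval s e).
Proof. by []. Qed.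
Lemma run_if g p q s :
  run (PIf g p q) s = if eval s g != 0 then run p s else run q s.
Proof. by []. Qed.
Lemma run_skip s : run PSkip s = s. Proof. by []. Qed.
Definition runE := (run_seq, run_assign, run_store, run_if, run_skip).
Arguments run : simpl never.

(** * Augmenting paths and dead vertices *)

Section Mates.
Variables (n : nat) (E : nat -> nat -> bool).
Implicit Types (l c x y z : nat) (m w dead vis par : nat -> nat).

(** A matching is encoded by m : a right vertex x has the mate c if m x = c + 1 and is unmatched if
m x = 0.  Left vertices with an index below l are in use. *)
Definition is_matching l m : Prop :=
  (forall x, x < n -> m x != 0 -> (m x <= l) && E (m x).-1 x) /\
  (forall x y, x < n -> y < n -> m x != 0 -> m x = m y -> x = y).

Definition covers m c : Prop := exists2 x, x < n & m x = c.

Definition covered_below m l : {set 'I_n} := [set x : 'I_n | 0 < m x <= l].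

(** Optimality for every prefix of the left vertices at once: for the prefix of the states it means
that as few SCC vertices as possible are used, for the whole list that the matching is maximum. *)
Definition optimal_below l m : Prop := forall k m', k <= l -> is_matching k m' ->
  #|covered_below m' k| <= #|covered_below m k|.

Definition dead_closed m dead : Prop := forall x, x < n -> dead x != 0 ->
  m x != 0 /\ forall y, y < n -> E (m x).-1 y -> dead y != 0.

Definition exposed_dead l m dead : Prop := forall k, k < l ->
  covers m k.+1 \/ forall y, y < n -> E k y -> dead y != 0.

(** Counting by right vertices agrees with counting the covered left vertices, as m is injective. *)
Lemma covered_mono m m' l : is_matching l m ->
  (forall x, x < n -> m x != 0 -> covers m' (m x)) ->
  forall k, #|covered_below m k| <= #|covered_below m' k|.
Proof.
move=> [_ m_inj] cov k.
have [f fP] : exists f : 'I_n -> 'I_n, forall x : 'I_n, m x != 0 -> m' (f x) = m x.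
  apply: (@fin_all_exists _ _ (fun x y : 'I_n => m x != 0 -> m' y = m x)) => x.
  have [|mx0] := boolP (m x != 0); last by exists x.
  by move/(cov x (ltn_ord x)) => [y yn m'y]; exists (Ordinal yn).
rewrite -(card_in_imset (f := f)) => [|x y].
  apply/subset_leq_card/subsetP => _ /imsetP[x + ->]; rewrite !inE => xk.
  by rewrite fP //; lia.
rewrite !inE => /andP[mx _] /andP[my _] eq_f; apply/ord_inj/m_inj => //; first lia.
by rewrite -fP ?eq_f ?fP //; lia.
Qed.

(** Koenig's argument: dead right vertices together with the left vertices that are not mates of
dead vertices, nor exposed, cover all edges, and each of them meets one edge of m.  Concretely,
an edge of m' at a dead x is charged to x, and any other one to the mate of its left vertex. *)
Lemma dead_certificate l m dead : is_matching l m -> dead_closed m dead ->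
  exposed_dead l m dead -> forall m', is_matching l m' ->
  #|covered_below m' l| <= #|covered_below m l|.
Proof.
move=> [m_edge m_inj] deadP exposedP m' [m'_edge m'_inj].
(* f x is the right vertex to which the edge of m' at x is charged. *)
have [f fP] : exists f : 'I_n -> 'I_n, forall x : 'I_n, m' x != 0 ->
    if dead x != 0 then f x = x else (m (f x) = m' x) /\ dead (f x) = 0.
  apply: (@fin_all_exists _ _ (fun x y : 'I_n => m' x != 0 ->
    if dead x != 0 then y = x else (m y = m' x) /\ dead y = 0)) => x.
  have [|_] := boolP (m' x != 0); last by exists x.
  move=> m'x; have [dx|dx] := boolP (dead x != 0); first by exists x.
  have /andP[le_l Ex] := m'_edge x (ltn_ord x) m'x.
  have [|[y yn my]|closed] := exposedP (m' x).-1; first lia; last first.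
    by case/negP: dx; apply: closed (ltn_ord x) Ex.
  exists (Ordinal yn) => _ /=; split; first lia.
  apply/eqP; apply: contraNT dx => dy; have [_ closed] := deadP y yn dy.
  by apply: closed => //; rewrite my.
rewrite -(card_in_imset (f := f)) => [|x y].
  apply/subset_leq_card/subsetP => _ /imsetP[x + ->]; rewrite !inE => /andP[x0 xl].
  have := fP x; have -> : m' x != 0 by lia.
  move/(_ isT); case: ifP => [dx -> |_ [-> _]]; last by rewrite x0.
  have [mx _] := deadP x (ltn_ord x) dx.
  by have /andP[-> _] := m_edge x (ltn_ord x) mx; rewrite lt0n mx.
rewrite !inE => /andP[x0 _] /andP[y0 _] eq_f.
have := fP x; have := fP y; have -> : m' x != 0 by lia. have -> : m' y != 0 by lia.
rewrite eq_f => /(_ isT) + /(_ isT).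
case: ifP => [dy eq_y|_ [my fy]]; case: ifP => [dx eq_x|_ [mx fx]].
- by rewrite -eq_x.
- by rewrite eq_y in fx; rewrite fx in dy.
- by rewrite eq_x in fy; rewrite fy in dx.
apply/ord_inj/m'_inj => //; [lia | by rewrite -mx my].
Qed.

Record outer_inv l m dead : Prop := OuterInv {
  oi_matching : is_matching l m;
  oi_values : forall x, x < n -> dead x = 0 \/ dead x = 2;
  oi_dead : dead_closed m dead;
  oi_exposed : exposed_dead l m dead;
  oi_optimal : optimal_below l m }.

Section Search.
Variables (l : nat) (m dead : nat -> nat).
Hypothesis inv_l : outer_inv l m dead.
Hypothesis m_root : m n = l.+1.

(** Processed during the current search; dead vertices carry the same mark 2 but belong to
earlier searches.  Index n is a fictitious right vertex matched to the root l. *)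
Definition scanned vis y := (vis y == 2) && ((y == n) || (dead y == 0)).

(** w is the matching obtained by following the search path from the root to y, except that the
left mate of y, if any, is left without a partner; when y is unmatched, w is the augmented
matching.  Storing w for each scanned y dispenses with walking back along a path. *)
Record rerouting vis w y : Prop := Rerouting {
  re_matching : is_matching l.+1 w;
  re_free : forall x, x < n -> m y != 0 -> w x != m y;
  re_covers : forall x, x <= n -> m x != 0 -> m x != m y -> covers w (m x);
  re_same : forall x, x < n -> ~~ scanned vis x -> w x = m x }.

(** vis is 0 for unseen, 1 for seen and 2 for processed vertices.  A seen vertex remembers the
processed vertex par from which it was found.  The root is its own parent, and its row of W
starts as a copy of the matching. *)
Record search_inv vis par (W : nat -> nat -> nat) : Prop := SearchInv {
  si_values : forall y, y <= n -> vis y <= 2;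
  si_root : vis n != 0;
  si_dead : forall y, y < n -> dead y != 0 -> vis y = 2;
  si_par : forall y, y <= n -> vis y = 1 ->
    if y == n then par y = n /\ forall x, x < n -> W n x = m x
    else [/\ par y <= n, scanned vis (par y), m (par y) != 0 & E (m (par y)).-1 y];
  si_rows : forall y, y <= n -> scanned vis y -> rerouting vis (W y) y;
  si_closed : forall y, y <= n -> scanned vis y -> m y != 0 /\
    forall x, x < n -> E (m y).-1 x -> vis x != 0 }.

Lemma root_inj x : x < n -> m x != m n.
Proof.
move=> xn; rewrite m_root; have [[m_edge _] _ _ _ _] := inv_l.
by have [->//|/(m_edge x xn)/andP[+ _]] := eqVneq (m x) 0; lia.
Qed.

Lemma mate_inj x y : x <= n -> y <= n -> m x != 0 -> m x = m y -> x = y.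
Proof.
move=> xn yn mx eq_m; have [[_ m_inj] _ _ _ _] := inv_l.
have [x_n|x_n] := eqVneq x n; have [y_n|y_n] := eqVneq y n; subst => //.
- have H : y < n by lia.
  by case/eqP: (root_inj H).
- have H : x < n by lia.
  by case/eqP: (root_inj H).
by apply: m_inj => //; lia.
Qed.

Lemma init_search_inv vis par W :
  (forall y, y < n -> vis y = dead y) -> vis n = 1 -> par n = n ->
  (forall x, x < n -> W n x = m x) -> search_inv vis par W.
Proof.
move=> vis_dead vis_n par_n Wn; have [_ dead02 _ _ _] := inv_l.
have no_scan y : y <= n -> scanned vis y = false.
  move=> yn; rewrite /scanned; have [->|y_n] := eqVneq y n; first by rewrite vis_n.
  have lt_y : y < n by lia.
  by rewrite vis_dead //; case: (dead02 y lt_y) => ->.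
have vis1 y : y <= n -> vis y = 1 -> y = n.
  move=> yn; have [//|y_n] := eqVneq y n; have lt_y : y < n by lia.
  by rewrite vis_dead //; case: (dead02 y lt_y) => ->.
split=> [y yn||y yn dy|y yn v1|y yn|y yn]; last 2 first.
- by rewrite no_scan.
- by rewrite no_scan.
- have [->|y_n] := eqVneq y n; first by rewrite vis_n.
  have lt_y : y < n by lia.
  by rewrite vis_dead //; case: (dead02 y lt_y) => ->.
- by rewrite vis_n.
- by rewrite vis_dead //; case: (dead02 y yn) dy => ->.
by rewrite (vis1 y yn v1) eqxx.
Qed.

Variables (vis par : nat -> nat) (W : nat -> nat -> nat).
Hypothesis inv_s : search_inv vis par W.

Section Scan.
Variables (y : nat) (vis' : nat -> nat) (w : nat -> nat).
Hypotheses (le_yn : y <= n) (vis_y : vis y = 1).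
Hypothesis vis'E : forall z, z <= n -> vis' z = if z == y then 2 else vis z.
Hypothesis wE : forall x, x < n -> w x = if x == y then m (par y) else W (par y) x.

Lemma live_y : (y == n) || (dead y == 0).
Proof.
have [//|yn /=] := eqVneq y n; apply/negPn/negP => dy.
by have := si_dead inv_s (y := y); rewrite vis_y dy => /(_ _ isT); lia.
Qed.

Lemma scannedE z : z <= n -> scanned vis' z = (z == y) || scanned vis z.
Proof.
move=> zn; rewrite /scanned vis'E //.
by have [->|//] := eqVneq z y; rewrite live_y.
Qed.

(** The row of y arises from that of its parent p by giving y to the left mate of p.  Since y has
not been processed before, the row of p still agrees with m at y. *)
Lemma scan_rerouting : rerouting vis' w y.
Proof.
have [[m_edge m_inj] _ _ _ _] := inv_l.
have := si_par inv_s le_yn vis_y; case: eqP => [y_n [par_n Wn]|/eqP y_n].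
  have wm x : x < n -> w x = m x.
    by move=> xn; rewrite wE // par_n Wn // y_n ltn_eqF.
  split=> [|x xn _|x xn m0 neq_m|x xn _]; last exact: wm.
  - split=> [x xn|x z xn zn]; rewrite !wm //.
      by move/(m_edge x xn) => /andP[/leqW -> ->].
    exact: m_inj.
  - by rewrite wm // y_n root_inj.
  - have [x_n|x_n] := eqVneq x n; first by rewrite x_n y_n eqxx in neq_m.
    by exists x; rewrite ?wm //; lia.
have lt_yn : y < n by lia.
case=> par_n par_scan mp0 Ep; set p := par y in par_n par_scan mp0 Ep *.
have [[W_edge W_inj] W_free W_cov W_same] := si_rows inv_s par_n par_scan.
have scan_y : scanned vis y = false by rewrite /scanned vis_y.
have Wy : W p y = m y by rewrite W_same ?scan_y.
have p_y : p != y by apply: contraTneq par_scan => ->; rewrite scan_y.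
have wy : w y = m p by rewrite wE // eqxx.
have wN x : x < n -> x != y -> w x = W p x by move=> xn xy; rewrite wE // (negPf xy).
have mp_le : m p <= l.+1.
  have [->|p_n] := eqVneq p n; first by rewrite m_root.
  have p_lt : p < n by lia.
  by have /andP[] := m_edge p p_lt mp0; lia.
split.
- split=> [x xn|x z xn zn].
    have [->|xy] := eqVneq x y; first by rewrite wy Ep mp_le.
    by rewrite wN //; apply: W_edge.
  have [->|xy] := eqVneq x y; have [->//|zy] := eqVneq z y.
  + rewrite wy wN // => _ eq_m; case/negP: (W_free z zn mp0); apply/eqP.
    by rewrite eq_m.
  + rewrite wy wN // => _ eq_m; case/negP: (W_free x xn mp0); apply/eqP.
    exact: eq_m.
  by rewrite !wN //; apply: W_inj.
- move=> x xn my0; have [->|xy] := eqVneq x y.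
    by rewrite wy; apply: contra_neq p_y => eq_m; apply: mate_inj.
  rewrite wN // -Wy; apply: contra_neq xy => eq_w; apply: W_inj => //.
  by rewrite eq_w Wy.
- move=> x xn mx0 neq_m; have [eq_p|neq_p] := eqVneq (m x) (m p).
    by exists y; rewrite ?wy.
  have [z zn Wz] := W_cov x xn mx0 neq_p; exists z => //.
  by rewrite wN //; apply: contraNneq neq_m => zy; rewrite -Wz zy Wy.
move=> x xn; rewrite scannedE ?(ltnW xn) // negb_or => /andP[xy nscan].
by rewrite wN // W_same.
Qed.

(** Dead vertices are never entered, so that the dead set is still closed after augmenting. *)
Lemma accept_inv : m y = 0 -> outer_inv l.+1 w dead.
Proof.
move=> my0; have re := scan_rerouting.
have [m_l dead02 deadP exposedP opt] := inv_l.
have [w_match _ w_cov w_same] := re.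
have cov x : x <= n -> m x != 0 -> covers w (m x).
  by move=> xn mx; apply: w_cov => //; rewrite my0.
have deadw x : x < n -> dead x != 0 -> w x = m x.
  move=> xn dx; apply: w_same => //; apply/negP => /andP[_].
  by rewrite ltn_eqF //= (negPf dx).
have dead_w : dead_closed w dead.
  by move=> x xn dx; rewrite deadw //; apply: deadP.
have exp_w : exposed_dead l.+1 w dead.
  move=> k; rewrite ltnS leq_eqVlt => /orP[/eqP ->|/exposedP[[x xn mx]|]].
  - by left; rewrite -m_root; apply: cov; rewrite ?m_root.
  - by left; rewrite -mx; apply: cov; rewrite ?mx // ltnW.
  by right.
split=> // k m' le_k m'P; move: le_k; rewrite leq_eqVlt => /orP[/eqP eq_k|lt_k].
  by rewrite eq_k in m'P *; apply: (dead_certificate w_match dead_w exp_w).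
apply: leq_trans (opt k m' lt_k m'P) _; apply: (covered_mono m_l) => x xn.
exact/cov/ltnW.
Qed.

Variables (vis2 par2 : nat -> nat) (W2 : nat -> nat -> nat).
Hypothesis vis2E : forall z, z <= n -> vis2 z =
  if (z < n) && E (m y).-1 z && (vis' z == 0) then 1 else vis' z.
Hypothesis par2E : forall z, z <= n -> par2 z =
  if (z < n) && E (m y).-1 z && (vis' z == 0) then y else par z.
Hypothesis W2E : forall z x, z <= n -> x < n ->
  W2 z x = if z == y then w x else W z x.

Lemma expand_inv : m y != 0 -> search_inv vis2 par2 W2.
Proof.
move=> my0; have vis2_ge z : z <= n -> vis z != 0 -> vis2 z != 0.
  move=> zn vz; rewrite vis2E //; case: ifP => // _; rewrite vis'E //.
  by case: ifP.
have scan2 z : z <= n -> scanned vis2 z = (z == y) || scanned vis z.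
  move=> zn; rewrite -scannedE // /scanned vis2E //; case: ifP => //.
  by case/andP=> _ /eqP ->.
have rows_ext z w' v : z <= n -> rerouting vis w' z ->
    (forall x, x < n -> v x = w' x) -> rerouting vis2 v z.
  move=> zn [[e_ i_] f_ c_ s_] vE; split.
  - by split=> [x xn|x t xn tn]; rewrite !vE //; [apply: e_|apply: i_].
  - by move=> x xn; rewrite vE //; apply: f_.
  - move=> x xn mx neq; have [t tn wt] := c_ x xn mx neq; exists t => //.
    by rewrite vE.
  move=> x xn; rewrite scan2 ?(ltnW xn) // negb_or => /andP[_ nx].
  by rewrite vE ?s_.
split.
- move=> z zn; rewrite vis2E //; case: ifP => // _; rewrite vis'E //.
  by case: ifP => // _; apply: (si_values inv_s).
- by apply: vis2_ge => //; apply: si_root inv_s.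
- move=> z zn dz; have vz := si_dead inv_s zn dz; rewrite vis2E ?vis'E ?(ltnW zn) // vz.
  by case: (z == y); rewrite andbF.
- move=> z zn; rewrite vis2E // par2E //; case: ifP => [/andP[/andP[lt_z Ez] _] _|].
    rewrite ltn_eqF //; split=> //.
    by rewrite scan2 // eqxx.
  rewrite vis'E //; have [//|z_y] := eqVneq z y; move=> _ v1.
  have := si_par inv_s zn v1; case: eqP => [z_n [par_n Wn]|/eqP z_n [par_n sc mp0 Ep]].
    split=> // x xn; rewrite W2E // -z_n (negPf z_y) z_n; exact: Wn.
  by split=> //; rewrite scan2 // sc orbT.
- move=> z zn; rewrite scan2 // => /orP[/eqP ->|sc]; last first.
    have neq_zy : z != y by apply: contraTneq sc => ->; rewrite /scanned vis_y.
    apply: rows_ext (si_rows inv_s zn sc) _ => // x xn.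
    by rewrite W2E // (negPf neq_zy).
  have [[e_ i_] f_ c_ s_] := scan_rerouting; split.
  - by split=> [x xn|x t xn tn]; rewrite !W2E // !eqxx; [apply: e_|apply: i_].
  - by move=> x xn; rewrite W2E // eqxx; apply: f_.
  - move=> x xn mx neq; have [t tn wt] := c_ x xn mx neq; exists t => //.
    by rewrite W2E // eqxx.
  move=> x xn; rewrite scan2 -?scannedE ?(ltnW xn) // => /(s_ x xn).
  by rewrite W2E // eqxx.
move=> z zn; rewrite scan2 // => /orP[/eqP ->|sc].
  split=> // x xn Ex; rewrite vis2E ?(ltnW xn) // xn Ex /=.
  by case: ifP => // /negbT.
have [mz closed] := si_closed inv_s zn sc; split=> // x xn Ex.
by apply: vis2_ge; rewrite ?(ltnW xn) //; apply: closed.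
Qed.
End Scan.

(** When no seen vertex is left to process, everything that has been seen becomes dead. *)
Lemma fail_inv dead' : (forall y, y <= n -> vis y != 1) ->
  (forall y, y < n -> dead' y = if vis y != 0 then 2 else 0) ->
  outer_inv l.+1 m dead'.
Proof.
move=> no1 dead'E; have [m_l dead02 deadP exposedP opt] := inv_l.
have sub y : y < n -> dead y != 0 -> dead' y != 0.
  by move=> yn /(si_dead inv_s yn) vy; rewrite dead'E // vy.
have vis2 y : y <= n -> vis y != 0 -> vis y = 2.
  by move=> yn; have := si_values inv_s yn; have := no1 y yn; lia.
have match_m : is_matching l.+1 m.
  by case: m_l => e i; split=> // x xn /(e x xn)/andP[/leqW -> ->].
have dead'_closed : dead_closed m dead'.
  move=> x xn; rewrite dead'E //; case: ifP => // vx _.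
  have [dx|dx] := boolP (dead x != 0).
    have [mx closed] := deadP x xn dx; split=> // y yn Ey.
    by apply: sub => //; apply: closed.
  have sc : scanned vis x.
    by rewrite /scanned vis2 ?(ltnW xn) //= -[dead x == 0]negbK dx orbT.
  have [mx closed] := si_closed inv_s (ltnW xn) sc; split=> // y yn Ey.
  by rewrite dead'E // closed.
have exp_m : exposed_dead l.+1 m dead'.
  move=> k; rewrite ltnS leq_eqVlt => /orP[/eqP ->|/exposedP[[x xn mx]|closed]].
  - right=> y yn Ey; have sc : scanned vis n.
      by rewrite /scanned eqxx vis2 //; apply: si_root inv_s.
    have [_ closed] := si_closed inv_s (leqnn n) sc.
    by rewrite dead'E // closed // m_root.
  - by left; exists x.
  by right=> y yn /(closed y yn); apply: sub.
split=> //.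
  by move=> x xn; rewrite dead'E //; case: ifP; [right|left].
move=> k m' le_k m'P; move: le_k; rewrite leq_eqVlt => /orP[/eqP eq_k|lt_k].
  by rewrite eq_k in m'P *; apply: (dead_certificate match_m dead'_closed exp_m).
exact: opt.
Qed.
End Search.
End Mates.

(** * The matching program *)

(** Memory layout.  Variables: 0 holds n, 1 the number beta of numbered SCCs, 2 the size of the
result, 3 n + beta, 4 n + 1; 5 to 10 are loop counters and temporaries (7 in the innermost loops),
and 11 signals a successful search.  Arrays: 0 to 4 are those of
the specification, 5 holds the reachability relation, row 0 of 6 the representatives of the
SCCs, row 0 of 7 the matching m, row 0 of 8 the dead set, row 0 of 9 the marks vis, row 0 of 10
the parents, and 11 the rows of reroutings. *)
Definition Row a e := Cell a (Const 0) e.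
Definition StoreRow a e1 e := PStore a (Const 0) e1 e.

(** Variable 8 receives a vertex to be processed, or n + 1 if there is none. *)
Definition pick_marked : prog :=
  PAssign 8 (Var 4) ;;
  PFor 7 4 (PIf (Eqn (Row 9 (Var 7)) (Const 1)) (PAssign 8 (Var 7)) PSkip).

Lemma run_pick_marked n s : var s 4 = n.+1 ->
  (var (run pick_marked s) 8 = n.+1 /\ forall y, y <= n -> arr s 9 0 y != 1) \/
  (var (run pick_marked s) 8 <= n /\ arr s 9 0 (var (run pick_marked s) 8) = 1).
Proof.
move=> s4; rewrite /pick_marked !runE /=; set s1 := set_var _ _ _.
pose I k s' := (var s' 8 = n.+1 /\ forall y, y < k -> arr s 9 0 y != 1) \/
  (var s' 8 <= n /\ arr s 9 0 (var s' 8) = 1).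
set loop := PFor 7 4 _; suff: I (var s1 4) (run loop s1) by rewrite {1}/s1 /= s4.
apply: run_for_ind => //=; first by left.
rewrite s4 => k s' kn s'7 [_ /= eqa] Is'; rewrite /I !runE /= eqa // s'7.
have [v1|v1] := eqVneq (arr s 9 0 k) 1; first by right; split.
case: Is' => [[v8 none]|[le v8]]; [left|by right].
by split=> // y; rewrite ltnS leq_eqVlt => /orP[/eqP ->|/none].
Qed.

Definition copy_parent_row : prog :=
  PFor 7 0 (PStore 11 (Var 8) (Var 7) (Cell 11 (Var 9) (Var 7))).

Lemma run_copy_parent_row s z x : arr (run copy_parent_row s) 11 z x =
  if (z == var s 8) && (x < var s 0) then arr s 11 (var s 9) x else arr s 11 z x.
Proof.
pose I k s' := forall z x, arr s' 11 z x =
  if (z == var s 8) && (x < k) then arr s 11 (var s 9) x else arr s 11 z x.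
suff: I (var s 0) (run copy_parent_row s) by apply.
apply: run_for_ind => // [{}z {}x|k s' _ s'7 [eqv _] Is' {}z {}x].
  by rewrite ltn0 andbF.
rewrite !runE /= s'7 !eqv // !Is' ltnn andbF ltnS [x <= k]leq_eqVlt.
by have [_|_] := eqVneq z (var s 8); have [->|_] := eqVneq x k.
Qed.

Definition scan_row : prog :=
  StoreRow 9 (Var 8) (Const 2) ;;
  PAssign 9 (Row 10 (Var 8)) ;;
  copy_parent_row ;;
  PStore 11 (Var 8) (Var 8) (Row 7 (Var 9)).

Lemma run_scan_row n s y : var s 0 = n -> var s 8 = y ->
  [/\ forall z, arr (run scan_row s) 9 0 z = if z == y then 2 else arr s 9 0 z,
      forall x, x < n -> arr (run scan_row s) 11 y x =
        if x == y then arr s 7 0 (arr s 10 0 y) else arr s 11 (arr s 10 0 y) x &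
      forall z x, z != y -> arr (run scan_row s) 11 z x = arr s 11 z x].
Proof.
move=> s0 s8; rewrite /scan_row !runE /= s8.
set s1 := set_var _ 9 _.
split=> [z|x xn|z x zy].
- by rewrite run_arr.
- rewrite !run_var //= s8 eqxx /= !run_copy_parent_row /= s8 s0 eqxx xn /=.
  by rewrite run_arr.
by rewrite !run_var //= s8 (negPf zy) /= run_copy_parent_row /= s8 (negPf zy).
Qed.

Definition mark_neighbours : prog :=
  PFor 7 0 (PIf (Cell 2 (Var 10) (Var 7))
    (PIf (Row 9 (Var 7)) PSkip
      (StoreRow 9 (Var 7) (Const 1) ;; StoreRow 10 (Var 7) (Var 8))) PSkip).

Lemma run_mark_neighbours s z :
  let fresh := [&& z < var s 0, arr s 2 (var s 10) z != 0 & arr s 9 0 z == 0] in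
  arr (run mark_neighbours s) 9 0 z = (if fresh then 1 else arr s 9 0 z) /\
  arr (run mark_neighbours s) 10 0 z = (if fresh then var s 8 else arr s 10 0 z).
Proof.
pose fresh k z := [&& z < k, arr s 2 (var s 10) z != 0 & arr s 9 0 z == 0].
pose I k s' := forall z,
  arr s' 9 0 z = (if fresh k z then 1 else arr s 9 0 z) /\
  arr s' 10 0 z = (if fresh k z then var s 8 else arr s 10 0 z).
suff: I (var s 0) (run mark_neighbours s) by apply.
apply: run_for_ind => // k s' _ s'7 [eqv eqa] Is' {}z.
have freshS : fresh k.+1 z = fresh k z || 
    [&& z == k, arr s 2 (var s 10) k != 0 & arr s 9 0 k == 0].
  rewrite /fresh ltnS [z <= k]leq_eqVlt; have [->|_] := eqVneq z k; last by rewrite orbF.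
  by rewrite ltnn.
have [I9 I10] := Is' z; have [Ik9 _] := Is' k.
have fk : fresh k k = false by rewrite /fresh ltnn.
rewrite fk in Ik9.
rewrite !runE /= s'7 !eqv // (eqa 2) // Ik9 freshS.
case: (arr s 2 (var s 10) k != 0) => /=; last by rewrite andbF orbF /= I9 I10.
have [vk|vk] := eqVneq (arr s 9 0 k) 0; last by rewrite /= !andbF orbF /= I9 I10.
rewrite /= andbT orbC.
by have [->|_] := eqVneq z k; rewrite ?I9 ?I10.
Qed.

Definition accept_row : prog :=
  PFor 7 0 (StoreRow 7 (Var 7) (Cell 11 (Var 8) (Var 7))).

Lemma run_accept_row s x : x < var s 0 ->
  arr (run accept_row s) 7 0 x = arr s 11 (var s 8) x.
Proof.
pose I k s' := forall x, x < k -> arr s' 7 0 x = arr s 11 (var s 8) x.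
suff: I (var s 0) (run accept_row s) by apply.
apply: run_for_ind => // k s' _ s'7 [eqv eqa] Is' {}x.
rewrite ltnS [x <= k]leq_eqVlt !runE /= s'7 !eqv // (eqa 11) //.
by have [->|_ /= /Is' ->] := eqVneq x k.
Qed.

(** One vertex is processed: its rerouting is computed, and it is either accepted as the end of an
augmenting path, or the neighbours of its mate are marked. *)
Definition search_round : prog :=
  PIf (Var 11) PSkip
   (pick_marked ;;
    PIf (Ltn (Var 8) (Var 4))
      (scan_row ;;
       PIf (Row 7 (Var 8))
         (PAssign 10 (Pred (Row 7 (Var 8))) ;; mark_neighbours)
         (accept_row ;; PAssign 11 (Const 1)))
      PSkip).

Definition edge_in (G : nat -> nat -> nat) l x := G l x != 0.

Definition searching n l s : Prop :=
  [/\ var s 11 = 0, outer_inv n (edge_in (arr s 2)) l (arr s 7 0) (arr s 8 0),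
      arr s 7 0 n = l.+1 &
      search_inv n (edge_in (arr s 2)) l (arr s 7 0) (arr s 8 0) (arr s 9 0)
        (arr s 10 0) (arr s 11)].

Definition accepted n l s : Prop :=
  var s 11 = 1 /\ outer_inv n (edge_in (arr s 2)) l.+1 (arr s 7 0) (arr s 8 0).

Definition exhausted n s : Prop := forall y, y <= n -> arr s 9 0 y != 1.

Definition num_scanned n s := #|[set y : 'I_n.+1 | arr s 9 0 y == 2]|.

(** The number of processed vertices grows until the search succeeds or is exhausted, so n + 1
rounds are enough. *)
Lemma run_search_round n l s : var s 0 = n -> var s 4 = n.+1 -> searching n l s ->
  let s' := run search_round s in
  accepted n l s' \/
  (searching n l s' /\
   (exhausted n s' \/
    ~ exhausted n s /\ num_scanned n s < num_scanned n s')).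
Proof.
move=> s0 s4 [s11 inv_o root inv_s] /=.
rewrite /search_round run_if /= s11 /= run_seq; move def_s1: (run pick_marked s) => s1.
rewrite run_if run_skip /=.
have arr1 : arr s1 = arr s by apply/funext => a; rewrite -def_s1 run_arr.
have v1 w : w \notin assigned pick_marked -> var s1 w = var s w.
  by rewrite -def_s1; apply: run_var.
rewrite (v1 4) // s4.
case: (run_pick_marked s4) => -[]; rewrite def_s1 => s1_8.
  move=> none; rewrite s1_8 ltnn /=; right; split.
    by split; rewrite ?arr1 // v1.
  by left; rewrite /exhausted arr1.
move=> vis_y; rewrite ltnS s1_8 /= run_seq; set y := var s1 8 in s1_8 vis_y *.
move def_s2: (run scan_row s1) => s2.
have [vis2 row2 rows2] := @run_scan_row n s1 y (etrans (v1 0 isT) s0) erefl.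
rewrite def_s2 in vis2 row2 rows2.
have arr2 a : a \notin stored scan_row -> arr s2 a = arr s a.
  by move=> h; rewrite -def_s2 run_arr ?arr1.
have v2 w : w \notin assigned scan_row -> var s2 w = var s1 w.
  by rewrite -def_s2; apply: run_var.
rewrite arr1 in vis2 row2 rows2.
rewrite run_if /= (arr2 7) // (v2 8) // -/y.
case: ifP => [my|/negbFE/eqP my].
  right; rewrite run_seq run_assign; set s3 := set_var s2 10 _.
  move def_s': (run mark_neighbours s3) => s'.
  have arr' a : a \in [:: 2; 7; 8] -> arr s' a = arr s a.
    by rewrite !inE -def_s' => /or3P[] /eqP ->; rewrite run_arr //= arr2.
  have mark z : z <= n ->
      let fresh := (z < n) && edge_in (arr s 2) (arr s 7 0 y).-1 z &&
        (arr s2 9 0 z == 0) in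
      arr s' 9 0 z = (if fresh then 1 else arr s2 9 0 z) /\
      arr s' 10 0 z = (if fresh then y else arr s 10 0 z).
    have := run_mark_neighbours s3 z; rewrite def_s'.
    rewrite /= (v2 0) // (v1 0) // s0 (arr2 2) // (arr2 7) // (arr2 10) //.
    by rewrite (v2 8) // -/y !andbA.
  have arr11 : arr s' 11 = arr s2 11 by rewrite -def_s' run_arr.
  split.
    split; rewrite ?(arr' 2) ?(arr' 7) ?(arr' 8) //.
      by rewrite -def_s' run_var //= (v2 11) // (v1 11).
    apply: (expand_inv inv_o root inv_s s1_8 vis_y (vis' := arr s2 9 0)
      (w := arr s2 11 y)) => // [z zn|z zn|z x zn xn].
    - by case: (mark z zn).
    - by case: (mark z zn).
    by rewrite arr11; have [->//|/rows2] := eqVneq z y.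
  right; split; first by move=> /(_ y s1_8); rewrite vis_y.
  apply: proper_card; apply/properP; split.
    apply/subsetP => z; rewrite !inE => vz; have zn : z <= n by have := ltn_ord z.
    have [-> _] := mark z zn; rewrite vis2 (eqP vz) if_same.
    by case: ifP => // /andP[].
  exists (Ordinal (s1_8 : y < n.+1)); rewrite !inE /= ?vis_y //.
  by have [-> _] := mark y s1_8; rewrite vis2 eqxx andbF.
left; rewrite run_seq run_assign; move def_s3: (run accept_row s2) => s3; split=> //=.
have arr3 a : a \in [:: 2; 8] -> arr s3 a = arr s a.
  by rewrite !inE -def_s3 => /orP[] /eqP ->; rewrite run_arr // arr2.
rewrite (arr3 2) // (arr3 8) //.
apply: (accept_inv inv_o root inv_s s1_8 vis_y (vis' := arr s2 9 0)) => //.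
move=> x xn; rewrite -def_s3 run_accept_row; last by rewrite (v2 0) // (v1 0) // s0.
by rewrite (v2 8) // row2.
Qed.

Definition search : prog := PFor 6 4 search_round.

Lemma run_search n l s : var s 0 = n -> var s 4 = n.+1 -> searching n l s ->
  let s' := run search s in
  accepted n l s' \/ (searching n l s' /\ exhausted n s').
Proof.
move=> s0 s4 srch /=.
pose I k s' := accepted n l s' \/
  (searching n l s' /\ (exhausted n s' \/ k <= num_scanned n s')).
suff: I n.+1 (run search s).
  move=> [acc|[srch' [exh|le_n]]]; [by left|by right|right; split=> // y yn].
  have : [set y : 'I_n.+1 | arr (run search s) 9 0 y == 2] == setT.
    by rewrite eqEcard subsetT cardsT card_ord.
  by move/eqP/setP/(_ (Ordinal (yn : y < n.+1))); rewrite !inE => /eqP ->.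
rewrite -s4; apply: run_for_ind => //; first by right; split=> //; right.
move=> k s' _ _ [eqv eqa] [acc|[srch' scan]].
  left; case: acc => s11 acc; rewrite /search_round run_if /= s11 run_skip.
  by split.
have s'0 : var s' 0 = n by rewrite eqv.
have s'4 : var s' 4 = n.+1 by rewrite eqv.
have := run_search_round s'0 s'4 srch'; cbv zeta.
move: (run search_round s') => t [acc|[srch_t more]]; [by left|right; split=> //].
case: more => [exh|[not_exh lt_num]]; first by left.
by case: scan => [//|le_k]; right; exact: leq_ltn_trans lt_num.
Qed.

Definition copy_dead : prog := PFor 7 0 (StoreRow 9 (Var 7) (Row 8 (Var 7))).

Lemma run_copy_dead s x : x < var s 0 -> arr (run copy_dead s) 9 0 x = arr s 8 0 x.
Proof.
pose I k s' := forall x, x < k -> arr s' 9 0 x = arr s 8 0 x.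
suff: I (var s 0) (run copy_dead s) by apply.
apply: run_for_ind => // k s' _ s'7 [eqv eqa] Is' {}x.
rewrite ltnS [x <= k]leq_eqVlt !runE /= s'7 (eqa 8) //.
by have [->|_ /= /Is' ->] := eqVneq x k.
Qed.

Definition copy_mates : prog :=
  PFor 7 0 (PStore 11 (Var 0) (Var 7) (Row 7 (Var 7))).

Lemma run_copy_mates s x : x < var s 0 ->
  arr (run copy_mates s) 11 (var s 0) x = arr s 7 0 x.
Proof.
pose I k s' := forall x, x < k -> arr s' 11 (var s 0) x = arr s 7 0 x.
suff: I (var s 0) (run copy_mates s) by apply.
apply: run_for_ind => // k s' _ s'7 [eqv eqa] Is' {}x.
rewrite ltnS [x <= k]leq_eqVlt !runE /= s'7 (eqa 7) // (eqv 0) // eqxx /=.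
by have [->|_ /= /Is' ->] := eqVneq x k.
Qed.

(** Dead vertices start with mark 2, hence are never entered; vertex n stands for the root. *)
Definition start_search : prog :=
  copy_dead ;;
  StoreRow 9 (Var 0) (Const 1) ;;
  StoreRow 7 (Var 0) (Succ (Var 5)) ;;
  StoreRow 10 (Var 0) (Var 0) ;;
  copy_mates ;;
  PAssign 11 (Const 0).

Lemma outer_inv_ext n E l m m' dead : (forall x, x < n -> m' x = m x) ->
  outer_inv n E l m dead -> outer_inv n E l m' dead.
Proof.
move=> eqm [[m_edge m_inj] dead02 deadP exposedP opt].
have cov c : covers n m c -> covers n m' c.
  by case=> x xn mx; exists x; rewrite ?eqm.
split=> //.
- split=> [x xn|x y xn yn]; rewrite !eqm //; [exact: m_edge|exact: m_inj].
- by move=> x xn; rewrite eqm //; apply: deadP.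
- by move=> k /exposedP[/cov|]; [left|right].
move=> k m2 le_k m2P; apply: leq_trans (opt k m2 le_k m2P) _.
by apply: subset_leq_card; apply/subsetP => x; rewrite !inE eqm.
Qed.

Lemma run_start_search n l s : var s 0 = n -> var s 5 = l ->
  outer_inv n (edge_in (arr s 2)) l (arr s 7 0) (arr s 8 0) ->
  searching n l (run start_search s).
Proof.
move=> s0 s5 inv_o; rewrite /start_search run_seq.
have vis1 := @run_copy_dead s; have fr := run_frame copy_dead s.
move: (run copy_dead s) vis1 fr => s1 vis1 [v1 a1].
rewrite run_seq run_store run_seq run_store run_seq run_store run_seq.
set s2 := set_cell _ 10 _ _ _.
have W2 := @run_copy_mates s2; have fr := run_frame copy_mates s2.
move: (run copy_mates s2) W2 fr => s3 W3 [v3 a3].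
rewrite run_assign.
have a2 a : a \notin [:: 7; 9; 10] -> arr s2 a = arr s1 a.
  rewrite !inE !negb_or => /and3P[/negPf a7 /negPf a9 /negPf a10].
  by rewrite /s2 /= a7 a9 a10.
have mE x : arr s3 7 0 x = if x == n then l.+1 else arr s 7 0 x.
  by rewrite (a3 7) //= (v1 0) // (v1 5) // s0 s5 (a1 7).
have inv3 : outer_inv n (edge_in (arr s 2)) l (arr s3 7 0) (arr s 8 0).
  by apply: outer_inv_ext inv_o => x xn; rewrite mE ltn_eqF.
rewrite /searching /= (a3 2) // (a3 8) // (a2 2) // (a2 8) // (a1 2) // (a1 8) //.
split=> //; first by rewrite mE eqxx.
have s20 : var s2 0 = n by rewrite /= v1.
apply: init_search_inv => //.
- by rewrite mE eqxx.
- move=> y yn; rewrite (a3 9) //= (v1 0) // s0 ltn_eqF //.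
  by rewrite vis1 ?s0.
- by rewrite (a3 9) //= (v1 0) // s0 eqxx.
- by rewrite (a3 10) //= (v1 0) // s0 eqxx.
by move=> x xn; rewrite (a3 7) // -s20 W3 // s20.
Qed.

Definition extend_dead : prog :=
  PFor 7 0 (PIf (Row 9 (Var 7)) (StoreRow 8 (Var 7) (Const 2)) PSkip).

Lemma run_extend_dead s x : x < var s 0 -> arr (run extend_dead s) 8 0 x =
  if arr s 9 0 x != 0 then 2 else arr s 8 0 x.
Proof.
pose I k s' := forall x, arr s' 8 0 x =
  if (x < k) && (arr s 9 0 x != 0) then 2 else arr s 8 0 x.
suff: I (var s 0) (run extend_dead s) by move=> -> ->.
apply: run_for_ind => // k s' _ s'7 [eqv eqa] Is' {}x.
rewrite ltnS [x <= k]leq_eqVlt !runE /= s'7 (eqa 9) //.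
have [->|neq_xk] /= := eqVneq x k.
  by case: ifP => //= _; rewrite ?eqxx // Is' ltnn.
by case: ifP => _ /=; rewrite ?(negPf neq_xk) Is'.
Qed.

Definition try_vertex : prog :=
  start_search ;; search ;; PIf (Var 11) PSkip extend_dead.

Lemma run_try_vertex n l s : var s 0 = n -> var s 4 = n.+1 -> var s 5 = l ->
  outer_inv n (edge_in (arr s 2)) l (arr s 7 0) (arr s 8 0) ->
  let s' := run try_vertex s in
  outer_inv n (edge_in (arr s' 2)) l.+1 (arr s' 7 0) (arr s' 8 0).
Proof.
move=> s0 s4 s5 inv_o /=; rewrite /try_vertex run_seq.
have srch := run_start_search s0 s5 inv_o; have [v1 _] := run_frame start_search s.
move: (run start_search s) srch v1 => s1 srch v1; rewrite run_seq.
have s10 : var s1 0 = n by rewrite v1.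
have s14 : var s1 4 = n.+1 by rewrite v1.
have := run_search s10 s14 srch; cbv zeta; have [v2 _] := run_frame search s1.
move: (run search s1) v2 => s2 v2 [[s2_11 acc]|[[s2_11 inv2 root sinv] exh]].
  by rewrite run_if /= s2_11 run_skip.
rewrite run_if /= s2_11 /=.
have dead' := @run_extend_dead s2; have [_ a3] := run_frame extend_dead s2.
move: (run extend_dead s2) dead' a3 => s3 dead' a3.
rewrite (a3 2) // (a3 7) //; apply: (fail_inv inv2 root sinv exh) => y yn.
rewrite dead'; last by rewrite v2 // s10.
have [_ dead02 _ _ _] := inv2; case: eqP => //= v0.
case: (dead02 y yn) => // d2.
by have := si_dead sinv yn; rewrite d2 v0 => /(_ isT).
Qed.

Definition write_row : prog :=
  PFor 7 0 (PStore 3 (Var 5) (Var 7) (Eqn (Row 7 (Var 7)) (Succ (Var 5)))).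

Lemma run_write_row s l x : arr (run write_row s) 3 l x =
  if (l == var s 5) && (x < var s 0) then nat_of_bool (arr s 7 0 x == l.+1)
  else arr s 3 l x.
Proof.
pose I k s' := forall l x, arr s' 3 l x =
  if (l == var s 5) && (x < k) then nat_of_bool (arr s 7 0 x == l.+1) else arr s 3 l x.
suff: I (var s 0) (run write_row s) by apply.
apply: run_for_ind => // [{}l {}x|k s' _ s'7 [eqv eqa] Is' {}l {}x].
  by rewrite andbF.
rewrite ltnS [x <= k]leq_eqVlt !runE /= s'7 (eqa 7) // (eqv 5) // Is'.
by have [->|_] := eqVneq l (var s 5); have [->|_] := eqVneq x k.
Qed.

Definition write_matching : prog := PFor 5 3 write_row.

Lemma run_write_matching s l x : l < var s 3 -> x < var s 0 ->
  arr (run write_matching s) 3 l x = (arr s 7 0 x == l.+1).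
Proof.
move=> + xn; pose I k s' := forall l, l < k -> arr s' 3 l x = (arr s 7 0 x == l.+1).
suff: I (var s 3) (run write_matching s) by apply.
apply: run_for_ind => // k s' _ s'5 [eqv eqa] Is' {}l.
rewrite ltnS leq_eqVlt /= run_write_row s'5 eqv // xn (eqa 7) // andbT.
by have [->|_ /= /Is' ->] := eqVneq l k.
Qed.

Definition match_program : prog := PFor 5 3 try_vertex ;; write_matching.

Lemma run_match_program n s : var s 0 = n -> var s 4 = n.+1 ->
  (forall x, arr s 7 0 x = 0) -> (forall x, arr s 8 0 x = 0) ->
  let s' := run match_program s in
  outer_inv n (edge_in (arr s 2)) (var s 3) (arr s' 7 0) (arr s' 8 0) /\
  forall l x, l < var s 3 -> x < n -> arr s' 3 l x = (arr s' 7 0 x == l.+1).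
Proof.
move=> s0 s4 mate0 dead0 /=; rewrite /match_program run_seq.
pose I k s' := outer_inv n (edge_in (arr s' 2)) k (arr s' 7 0) (arr s' 8 0).
have : I (var s 3) (run (PFor 5 3 try_vertex) s).
  apply: run_for_ind => // [|k s' _ s'5 [eqv eqa] Is'].
    split=> [|x _|x _|//|k m' k0].
    - by split=> [x _|x y _ _]; rewrite /= mate0.
    - by left; apply: dead0.
    - by rewrite /= dead0.
    move: k0; rewrite leqn0 => /eqP -> _.
    rewrite (eq_card0 (A := covered_below n m' 0)) //.
    by move=> x; rewrite !inE; case: (m' x).
  by apply: run_try_vertex => //; rewrite eqv.
have := run_frame (PFor 5 3 try_vertex) s.
move: (run (PFor 5 3 try_vertex) s) => s1 [v1 a1]; rewrite /I (a1 2) // => inv1.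
have W2 := @run_write_matching s1; have [v2 a2] := run_frame write_matching s1.
move: (run write_matching s1) W2 a2 => s2 W2 a2.
rewrite (a2 7) // (a2 8) //; split=> // l x ll xn.
by rewrite W2 ?v1 // s0.
Qed.

(** * From mates to a minimum-weight maximum matching *)

Section FromMates.
Variables (n : nat) (A : 'M[bool]_n) (beta : nat) (N : 'I_beta -> {set 'I_n}).
Local Notation left := ('I_n + 'I_beta)%type.
Local Notation row := (@left_row n beta).
Implicit Types (M : {set left * 'I_n}) (l : left).

Lemma left_row_lt (l : left) : row l < n + beta.
Proof. by case: l => i /=; rewrite ?ltn_add2l // ltn_addr. Qed.

Lemma left_row_inj : injective row.
Proof.
move=> [i|i] [j|j] //= eq_ij.
- by rewrite (ord_inj eq_ij).
- by have := ltn_ord i; rewrite eq_ij; lia.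
- by have := ltn_ord j; rewrite -eq_ij; lia.
by congr inr; apply/ord_inj/(addnI eq_ij).
Qed.

(** With [left_row_inj], the rows number the left vertices from 0 to n + beta - 1. *)
Lemma left_row_onto k : k < n + beta -> exists l, row l = k.
Proof.
move=> lt_k; have [lt_kn|le_nk] := ltnP k n; first by exists (inl (Ordinal lt_kn)).
have lt : k - n < beta by lia.
by exists (inr (Ordinal lt)) => /=; lia.
Qed.

Definition mates (M : {set left * 'I_n}) (x : nat) : nat :=
  if [pick p in M | p.2 == x :> nat] is Some p then (row p.1).+1 else 0.

Lemma matesP M l (x : 'I_n) : {in M &, injective snd} ->
  (mates M x == (row l).+1) = ((l, x) \in M).
Proof.
move=> M_snd; rewrite /mates; case: pickP => [[l' y] /= /andP[l'y /eqP/ord_inj eq_yx]|none].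
  rewrite eq_yx in l'y *; rewrite eqSS (inj_eq left_row_inj).
  apply/eqP/idP => [<- //|lx]; by have := M_snd _ _ l'y lx erefl => -[].
by apply/esym/negP => lx; have := none (l, x); rewrite /= lx eqxx.
Qed.

Lemma mates_unmatched M (x : 'I_n) : (mates M x != 0) = (x \in snd @: M).
Proof.
rewrite /mates; case: pickP => [[l y] /= /andP[ly /eqP/ord_inj eq_yx]|none].
  by apply/esym/imsetP; exists (l, y).
apply/esym/imsetP => -[[l y] ly /= eq_xy].
by have := none (l, y); rewrite /= ly eq_xy eqxx.
Qed.

Lemma mates_matching M : matching (aug_edge A N) M ->
  forall E : nat -> nat -> bool,
  (forall l x, E (row l) (nat_of_ord x) = aug_edge A N l x) ->
  forall k, (forall p, p \in M -> row p.1 < k) -> is_matching n E k (mates M).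
Proof.
move=> [M_edge M_fst M_snd] E EP k M_lt.
have ex x : x < n -> mates M x != 0 ->
    exists l (y : 'I_n), [/\ y = x :> nat, mates M x = (row l).+1 & (l, y) \in M].
  rewrite /mates; case: pickP => // [[l y] /= /andP[ly /eqP eq_yx]] _ _.
  by exists l, y.
split=> [x xn /(ex x xn)[l [y [eq_yx -> ly]]]|x y xn yn /(ex x xn)[l [z [<- -> lz]]]].
  by rewrite (M_lt _ ly) /= -eq_yx (EP l y) (M_edge _ ly).
move=> eq_m; have my : mates M y != 0 by rewrite -eq_m.
have [l' [t [eq_ty my' l't]]] := ex y yn my; rewrite my' in eq_m.
case: eq_m => /left_row_inj eq_l; rewrite -eq_l in l't.
by rewrite -eq_ty; have := M_fst _ _ lz l't erefl => -[->].
Qed.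

Lemma card_mates M k : {in M &, injective snd} ->
  #|covered_below n (mates M) k| = #|[set p in M | row p.1 < k]|.
Proof.
move=> M_snd; rewrite -(card_in_imset (f := snd)) => [|p q]; last first.
  by rewrite !inE => /andP[pM _] /andP[qM _]; apply: M_snd.
apply: eq_card => x; rewrite !inE; apply/idP/imsetP => [/andP[x0 xk]|[[l y]]].
  have : x \in snd @: M by rewrite -mates_unmatched; lia.
  case/imsetP => -[l y] /= ly eq_xy; exists (l, y) => //.
  rewrite inE ly /=; move: ly; rewrite -eq_xy -matesP // => /eqP mx.
  by rewrite mx in xk.
rewrite inE /= -matesP // => /andP[/eqP my lt_k] ->.
by rewrite my.
Qed.

(** An edge costs 2, less 1 if its left end is a state: a maximum matching is cheap when it covers
many states. *)
Lemma cost_mates M :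
  matching_cost (@aug_cost n beta) M + #|[set p in M | row p.1 < n]| = 2 * #|M|.
Proof.
rewrite /matching_cost -sum1_card.
rewrite (eq_bigl (fun p => (p \in M) && (row p.1 < n))); last by move=> p; rewrite inE.
rewrite big_mkcondr -big_split -sum1_card big_distrr /=.
apply: eq_bigr => -[[i|i] x] _ /=; first by rewrite ltn_ord.
by rewrite ltnNge leq_addr.
Qed.

Definition matching_of (m : nat -> nat) : {set left * 'I_n} :=
  [set p : left * 'I_n | m p.2 == (row p.1).+1].

(** Optimality on the prefix n + beta makes the matching maximum; optimality on the prefix n of
the states then makes its cost minimal. *)
Lemma matching_of_optimal (E : nat -> nat -> bool) m dead :
  (forall l x, E (row l) (nat_of_ord x) = aug_edge A N l x) ->
  outer_inv n E (n + beta) m dead -> step3_result A N (matching_of m).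
Proof.
move=> EP [[m_edge m_inj] _ _ _ opt]; set M := matching_of m.
have M_match : matching (aug_edge A N) M.
  split=> [[l x]|[l x] [l' x']|[l x] [l' x']]; rewrite !inE /=.
  - move=> /eqP mx; have := m_edge x (ltn_ord x).
    by rewrite mx /= EP => /(_ isT)/andP[].
  - move=> /eqP mx /eqP mx' eq_l; congr (_, _) => //; apply/ord_inj/m_inj => //.
      by rewrite mx.
    by rewrite mx mx' eq_l.
  move=> /eqP mx /eqP mx' eq_x; congr (_, _) => //; apply: left_row_inj.
  by move: mx'; rewrite -eq_x mx => -[].
have [_ _ M_snd] := M_match.
have mE (x : 'I_n) : mates M x = m x.
  have [mx0|mx0] := eqVneq (m x) 0.
    apply/eqP; rewrite mx0 -[_ == _]negbK mates_unmatched; apply/imsetP => -[[l y]].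
    by rewrite inE /= => /eqP my eq_xy; rewrite -eq_xy mx0 in my.
  have /andP[le_m _] := m_edge x (ltn_ord x) mx0.
  have [l ml] := @left_row_onto (m x).-1 ltac:(lia).
  by apply/eqP; rewrite -[m x]prednK ?lt0n // -ml matesP // inE /= ml prednK // lt0n.
have cov_eq k : covered_below n (mates M) k = covered_below n m k.
  by apply/setP => x; rewrite !inE mE.
have all_lt M' : [set p in M' | row p.1 < n + beta] = M' :> {set left * 'I_n}.
  by apply/setP => p; rewrite inE left_row_lt andbT.
have bound M' : matching (aug_edge A N) M' -> forall k, k <= n + beta ->
    #|[set p in M' | row p.1 < k]| <= #|[set p in M | row p.1 < k]|.
  move=> M'_match k le_k; have [M'_edge M'_fst M'_snd] := M'_match.
  rewrite -(card_mates _ M_snd) cov_eq.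
  pose M'k := [set p in M' | row p.1 < k].
  have sub p : p \in M'k -> p \in M' by rewrite inE => /andP[].
  have M'k_match : matching (aug_edge A N) M'k.
    split=> [p /sub/M'_edge//|p q /sub pM /sub qM|p q /sub pM /sub qM].
      exact: M'_fst.
    exact: M'_snd.
  have [_ _ M'k_snd] := M'k_match.
  have -> : [set p in M' | row p.1 < k] = [set p in M'k | row p.1 < k].
    by apply/setP => p; rewrite !inE -andbA andbb.
  rewrite -(card_mates _ M'k_snd); apply: opt => //.
  by apply: mates_matching => // p; rewrite inE => /andP[].
have M_max : maximum_matching (aug_edge A N) M.
  by split=> // M' M'_match; have := bound M' M'_match _ (leqnn _); rewrite !all_lt.
split=> // M' [M'_match M'_max].
have cardM' : #|M'| = #|M|.
  by apply/eqP; rewrite eqn_leq M'_max // andbT; apply: M_max.2.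
have := cost_mates M; have := cost_mates M'; rewrite cardM'.
have := bound M' M'_match n (leq_addr _ _).
move: (#|[set p in M' | _]|) (#|[set p in M | _]|); lia.
Qed.
End FromMates.

(** * Reachability program *)

Definition copy_row a b : prog :=
  PFor 7 0 (PStore b (Var 5) (Var 7) (Cell a (Var 5) (Var 7))).

Lemma run_copy_row a b s i x : a != b -> arr (run (copy_row a b) s) b i x =
  if (i == var s 5) && (x < var s 0) then arr s a i x else arr s b i x.
Proof.
move=> neq_ab; pose I k s' := forall i x, arr s' b i x =
  if (i == var s 5) && (x < k) then arr s a i x else arr s b i x.
suff: I (var s 0) (run (copy_row a b) s) by apply.
apply: run_for_ind => // [{}i {}x|k s' _ s'7 [eqv eqa] Is' {}i {}x].
  by rewrite andbF.
rewrite ltnS [x <= k]leq_eqVlt !runE /= eqxx s'7 (eqa a) ?inE // (eqv 5) // Is'.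
by have [->|_] := eqVneq i (var s 5); have [->|_] := eqVneq x k.
Qed.

Definition init_reach : prog :=
  PFor 5 0 (copy_row 0 5 ;; PStore 5 (Var 5) (Var 5) (Const 1)).

Lemma run_init_reach s i x : i < var s 0 -> x < var s 0 ->
  arr (run init_reach s) 5 i x = if i == x then 1 else arr s 0 i x.
Proof.
move=> + xn; pose I k s' := forall i, i < k ->
  arr s' 5 i x = if i == x then 1 else arr s 0 i x.
suff: I (var s 0) (run init_reach s) by apply.
apply: run_for_ind => // k s' _ s'5 [eqv eqa] Is' {}i.
rewrite ltnS leq_eqVlt run_seq run_store /= run_copy_row // run_var // s'5.
rewrite (eqv 0) // (eqa 0) // xn andbT.
have [->|_ /= /Is' ->] //= := eqVneq i k; by rewrite eq_sym.
Qed.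

Definition relax_row : prog :=
  PFor 7 0 (PIf (Cell 5 (Var 8) (Var 7)) (PStore 5 (Var 5) (Var 7) (Const 1)) PSkip).

Lemma run_relax_row s i x : arr (run relax_row s) 5 i x =
  if [&& i == var s 5, x < var s 0 & arr s 5 (var s 8) x != 0] then 1
  else arr s 5 i x.
Proof.
pose I k s' := forall i x, arr s' 5 i x =
  if [&& i == var s 5, x < k & arr s 5 (var s 8) x != 0] then 1 else arr s 5 i x.
suff: I (var s 0) (run relax_row s) by apply.
apply: run_for_ind => // [{}i {}x|k s' _ s'7 [eqv eqa] Is' {}i {}x].
  by rewrite andbF.
rewrite ltnS [x <= k]leq_eqVlt !runE /= s'7 (eqv 8) //.
rewrite [arr s' 5 (var s 8) k]Is' ltnn andbF /=.
have [nz|z] := boolP (arr s 5 (var s 8) k != 0) => /=.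
  rewrite (eqv 5) // Is'; have [_|_] := eqVneq i (var s 5) => //=.
  by have [->|_] := eqVneq x k; rewrite ?nz.
rewrite Is'; have [->|//] := eqVneq x k.
by rewrite (negPf z) !andbF.
Qed.

(** Stage k of Warshall's algorithm, with k in variable 8.  Working in place is harmless because
the stage changes neither row k nor column k. *)
Definition relax_stage : prog :=
  PFor 5 0 (PIf (Cell 5 (Var 5) (Var 8)) relax_row PSkip).

Lemma run_relax_stage s i x : i < var s 0 -> x < var s 0 ->
  (arr (run relax_stage s) 5 i x != 0) =
  (arr s 5 i x != 0) || (arr s 5 i (var s 8) != 0) && (arr s 5 (var s 8) x != 0).
Proof.
move=> lt_i xn; pose r i j := arr s 5 i j != 0.
pose I k s' := forall i j, j < var s 0 \/ j = var s 8 -> (arr s' 5 i j != 0) = r i j ||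
  [&& i < k, j < var s 0, r i (var s 8) & r (var s 8) j].
suff: I (var s 0) (run relax_stage s).
  by move=> /(_ i x (or_introl xn)) ->; rewrite lt_i xn.
clear i x lt_i xn; apply: run_for_ind => // [i j _|k s' lt_k s'5 [eqv eqa] Is' i j hj].
  by rewrite orbF.
have piv : (arr s' 5 k (var s 8) != 0) = r k (var s 8).
  by rewrite Is' ?ltnn ?orbF //; right.
have piv_row t : t < var s 0 -> (arr s' 5 (var s 8) t != 0) = r (var s 8) t.
  move=> tn; rewrite Is'; last by left.
  by case: (r (var s 8) t); rewrite ?andbF.
rewrite run_if /= s'5 (eqv 8) // piv ltnS [i <= k]leq_eqVlt.
case: ifP => rk.
  rewrite /= run_relax_row s'5 (eqv 0) // (eqv 8) //.
  have [->|_] /= := eqVneq i k; last by rewrite Is'.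
  rewrite rk /=; have [tn|tn] := ltnP j (var s 0); last first.
    by rewrite /= Is' // ltnn.
  rewrite piv_row //; case: ifP => // rj.
    by rewrite orbT.
  by rewrite Is' // ltnn.
rewrite run_skip /= Is' //; have [->|_] := eqVneq i k => //=.
by rewrite rk !andbF.
Qed.

Definition close_reach : prog := PFor 8 0 relax_stage.

(** After stage t the relation is transitive through all pivots up to t: a step through an earlier
pivot composes with the new shortcuts.  Q is a transitive relation that bounds it from above,
to be instantiated with reachability. *)
Lemma run_close_reach s (Q : nat -> nat -> Prop) :
  let n := var s 0 in
  (forall i j, i < n -> j < n -> arr s 5 i j != 0 -> Q i j) ->
  (forall i j k, Q i j -> Q j k -> Q i k) ->
  let r i j := arr (run close_reach s) 5 i j != 0 in
  [/\ forall i j, i < n -> j < n -> r i j -> Q i j,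
      forall i j, i < n -> j < n -> arr s 5 i j != 0 -> r i j &
      forall i j k, i < n -> j < n -> k < n -> r i j -> r j k -> r i k].
Proof.
move=> n baseQ transQ r.
pose I t s' := [/\ forall i j, i < n -> j < n -> arr s' 5 i j != 0 -> Q i j,
  forall i j, i < n -> j < n -> arr s 5 i j != 0 -> arr s' 5 i j != 0 &
  forall i j k, i < n -> j < n -> k < n -> j < t ->
    arr s' 5 i j != 0 -> arr s' 5 j k != 0 -> arr s' 5 i k != 0].
suff: I n (run close_reach s) by case=> I1 I2 I3; split=> // i j k ? jn ?; apply: I3.
apply: run_for_ind => //.
move=> t s' tn s'8 [eqv eqa] [I1 I2 I3].
have step i x : i < n -> x < n -> (arr (run relax_stage s') 5 i x != 0) =
    (arr s' 5 i x != 0) || (arr s' 5 i t != 0) && (arr s' 5 t x != 0).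
  by move=> ? ?; rewrite run_relax_stage ?(eqv 0) // s'8.
rewrite /I (_ : arr (set_var _ 8 t.+1) = arr (run relax_stage s')) //.
split=> [i j ni nj|i j ni nj|i j k ni nj nk].
- rewrite step // => /orP[|/andP[it tj]]; first exact: I1.
  by apply: transQ (I1 i t _ _ it) (I1 t j _ _ tj).
- by rewrite step // => h; rewrite I2.
rewrite ltnS leq_eqVlt !step // => jt.
have T (a b c : nat) : a < n -> b < n -> c < n -> b < t -> arr s' 5 a b != 0 ->
  arr s' 5 b c != 0 -> arr s' 5 a c != 0 := @I3 a b c.
move: jt => /orP[/eqP jt|jt].
  rewrite jt; move=> /orP[it|/andP[it _]] /orP[tk|/andP[_ tk]]; by rewrite it tk orbT.
move=> /orP[ij|/andP[it tj]] /orP[jk|/andP[jt' tk]].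
- by rewrite (T i j k).
- by rewrite (T i j t) // tk orbT.
- by rewrite it (T t j k) // orbT.
by rewrite it tk orbT.
Qed.

(** * Numbering the non-top linked components *)

Lemma iota_last k : iota 0 k.+1 = iota 0 k ++ [:: k].
Proof. by rewrite -[in LHS]addn1 iotaD. Qed.

Section Representatives.
Variables (n : nat) (r : nat -> nat -> bool).

(** x lies in a non-top linked SCC, and is its least element: this numbers each such SCC once. *)
Definition is_rep x := all (fun y => r y x ==> (r x y && (x <= y))) (iota 0 n).
Definition reps k := [seq x <- iota 0 k | is_rep x].

Lemma repsS k : reps k.+1 = reps k ++ (if is_rep k then [:: k] else [::]).
Proof. by rewrite /reps iota_last filter_cat. Qed.

Lemma size_reps k : size (reps k) <= k.
Proof. by rewrite -[X in _ <= X](size_iota 0 k) size_filter count_size. Qed.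
End Representatives.

Definition entry s i j : bool := arr s 5 i j != 0.

Definition test_rep : prog :=
  PAssign 9 (Const 1) ;;
  PFor 7 0 (PIf (Cell 5 (Var 7) (Var 5))
    (PIf (Cell 5 (Var 5) (Var 7))
       (PIf (Ltn (Var 7) (Var 5)) (PAssign 9 (Const 0)) PSkip)
       (PAssign 9 (Const 0)))
    PSkip).

Lemma run_test_rep s :
  var (run test_rep s) 9 = is_rep (var s 0) (entry s) (var s 5).
Proof.
rewrite /test_rep run_seq run_assign; set s1 := set_var s 9 _.
pose I k s' := var s' 9 = is_rep k (entry s) (var s 5).
apply: (@run_for_ind I 7 0 _ s1) => // k s' _ s'7 [eqv eqa] Is'.
rewrite /I /is_rep iota_last all_cat /= andbT !runE /=.
rewrite s'7 (eqv 5) //= (eqa 5) //= -/(entry s k (var s 5)) -/(entry s (var s 5) k).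
move: Is'; rewrite /I /is_rep => Is'.
case: (entry s k (var s 5)) => /=; last by rewrite andbT Is'.
case: (entry s (var s 5) k) => /=; last by rewrite andbF.
by rewrite [var s 5 <= k]leqNgt; case: (k < var s 5) => /=; rewrite ?andbF ?andbT.
Qed.

Definition write_component : prog :=
  PFor 7 0 (PIf (Cell 5 (Var 7) (Var 5)) (PStore 1 (Var 1) (Var 7) (Const 1)) PSkip).

Lemma run_write_component s i y : arr (run write_component s) 1 i y =
  if [&& i == var s 1, y < var s 0 & entry s y (var s 5)] then 1 else arr s 1 i y.
Proof.
pose I k s' := forall i y, arr s' 1 i y =
  if [&& i == var s 1, y < k & entry s y (var s 5)] then 1 else arr s 1 i y.
suff: I (var s 0) (run write_component s) by apply.
apply: run_for_ind => // [{}i {}y|k s' _ s'7 [eqv eqa] Is' {}i {}y].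
  by rewrite andbF.
rewrite ltnS [y <= k]leq_eqVlt !runE /= s'7 (eqv 5) // (eqa 5) //.
rewrite -/(entry s k (var s 5)).
have [ek|/negPf ek] := boolP (entry s k (var s 5)) => /=.
  rewrite (eqv 1) // Is'; have [_|_] := eqVneq i (var s 1) => //=.
  by have [->|_] := eqVneq y k; rewrite ?ek.
by rewrite Is'; have [->|//] := eqVneq y k; rewrite ek !andbF.
Qed.

Definition number_vertex : prog :=
  test_rep ;;
  PIf (Var 9)
    (write_component ;; StoreRow 6 (Var 1) (Var 5) ;;
     PAssign 1 (Succ (Var 1)) ;; PAssign 3 (Succ (Var 3)))
    PSkip.

Definition number_components : prog := PFor 5 0 number_vertex.

Definition numbered s0 rs s : Prop :=
  [/\ var s 1 = size rs, var s 3 = var s0 0 + size rs,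
      forall i, i < size rs -> arr s 6 0 i = nth 0 rs i,
      forall i y, i < size rs -> y < var s0 0 -> arr s 1 i y = entry s0 y (nth 0 rs i)
    & forall i y, size rs <= i -> arr s 1 i y = 0].

Lemma run_number_vertex s0 k rs s : var s 0 = var s0 0 -> var s 5 = k ->
  arr s 5 = arr s0 5 -> numbered s0 rs s ->
  numbered s0 (rs ++ (if is_rep (var s0 0) (entry s0) k then [:: k] else [::]))
    (run number_vertex s).
Proof.
move=> s_0 s_5 s_a5 [v1 v3 a6 a1 a1z]; rewrite /number_vertex run_seq.
have ent : entry s = entry s0 by rewrite /entry s_a5.
have tst := run_test_rep s; have [vt at_] := run_frame test_rep s.
move: (run test_rep s) tst vt at_ => s1; rewrite s_0 s_5 ent => s1_9 vt at_.
have num1 : numbered s0 rs s1.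
  by split; rewrite ?vt ?at_.
rewrite run_if /= s1_9; case: (is_rep _ _ k) => /=; last by rewrite cats0 run_skip.
rewrite run_seq; have comp := run_write_component s1.
have [vc ac] := run_frame write_component s1.
move: (run write_component s1) comp vc ac => s2 comp vc ac.
rewrite !runE; have sz : size (rs ++ [:: k]) = (size rs).+1 by rewrite size_cat addn1.
split; rewrite /= ?sz.
- by rewrite vc // vt // v1.
- by rewrite vc // vt // v3 addnS.
- move=> i; rewrite vc // vt // v1 vc // vt // s_5 ltnS leq_eqVlt nth_cat.
  rewrite ac // at_ //; have [->|neq] /= := eqVneq i (size rs).
    by rewrite ltnn subnn.
  by move=> lt_i; rewrite lt_i a6.
- have ent1 : entry s1 = entry s0 by rewrite -ent /entry at_.
  move=> i y; rewrite ltnS leq_eqVlt => lt_i yn.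
  rewrite comp ent1 (vt 1) // (vt 0) // (vt 5) // v1 s_0 s_5 yn nth_cat at_ //.
  case/orP: lt_i => [/eqP ->|lt_i]; last by rewrite (ltn_eqF lt_i) lt_i a1.
  rewrite eqxx ltnn subnn /= (a1z _ _ (leqnn _)).
  by case: (entry s0 y k).
move=> i y lt_i; rewrite comp vt // v1 gtn_eqF //= at_ // a1z //.
exact: ltnW.
Qed.

Definition scc_program : prog :=
  PAssign 4 (Succ (Var 0)) ;; PAssign 3 (Var 0) ;;
  init_reach ;; close_reach ;; number_components.

Lemma run_scc_program n s (Q : nat -> nat -> Prop) : var s 0 = n -> var s 1 = 0 ->
  (forall i y, arr s 1 i y = 0) ->
  (forall i j, i < n -> j < n -> arr s 0 i j != 0 -> Q i j) ->
  (forall i, Q i i) -> (forall i j k, Q i j -> Q j k -> Q i k) ->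
  let s' := run scc_program s in
  exists r : nat -> nat -> bool,
  [/\ var s' 4 = n.+1,
      [/\ forall i j, i < n -> j < n -> r i j -> Q i j,
          forall i, i < n -> r i i,
          forall i j, i < n -> j < n -> arr s 0 i j != 0 -> r i j &
          forall i j k, i < n -> j < n -> k < n -> r i j -> r j k -> r i k],
      var s' 1 = size (reps n r n) /\ var s' 3 = n + size (reps n r n),
      forall i, i < size (reps n r n) -> arr s' 6 0 i = nth 0 (reps n r n) i &
      forall i y, i < size (reps n r n) -> y < n ->
        arr s' 1 i y = r y (nth 0 (reps n r n) i)].
Proof.
move=> s0 s1 a1 edgeQ reflQ transQ /=; rewrite /scc_program.
rewrite run_seq run_assign run_seq run_assign run_seq; set t0 := set_var _ 3 _.
have t0_0 : var t0 0 = n by [].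
have init := @run_init_reach t0; have [v1 b1] := run_frame init_reach t0.
move: (run init_reach t0) init v1 b1 => t1 init v1 b1; rewrite run_seq.
have t1_0 : var t1 0 = n by rewrite v1.
have [||clsQ cls_ext cls_trans] := @run_close_reach t1 Q.
- move=> i j; rewrite t1_0 => ni nj; rewrite init ?t0_0 //.
  by have [-> _|_] := eqVneq i j; [apply: reflQ | apply: edgeQ].
- exact: transQ.
have [v2 b2] := run_frame close_reach t1.
move: (run close_reach t1) clsQ cls_ext cls_trans v2 b2 => t2 clsQ cls_ext cls_trans v2 b2.
rewrite t1_0 in clsQ cls_ext cls_trans.
have t2_0 : var t2 0 = n by rewrite v2.
pose I k s' := numbered t2 (reps n (entry t2) k) s'.
have numI : I n (run number_components t2).
  rewrite -[X in I X]t2_0; apply: run_for_ind => // [|k s' lt_k s'5 [eqv eqa] Is'].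
    split=> //= [||i y _].
    - by rewrite v2 // v1.
    - by rewrite v2 // v1 // t2_0 addn0 /= s0.
    by rewrite b2 // b1 // a1.
  rewrite /I repsS -[X in is_rep X _ _]t2_0.
  have [] // := @run_number_vertex t2 k (reps n (entry t2) k) s' _ s'5 _ Is'.
    by rewrite eqv.
  by rewrite eqa.
have [v3 b3] := run_frame number_components t2.
move: (run number_components t2) numI v3 b3 => t3 [n1 n3 n6 nc _] v3 b3.
exists (entry t2); split.
- by rewrite v3 // v2 // v1 //= s0.
- split=> //.
  + by move=> i ni; apply: cls_ext => //; rewrite init ?eqxx // ?t0_0.
  + move=> i j ni nj aij; apply: cls_ext => //; rewrite init ?t0_0 //.
    by case: ifP.
- by rewrite n1 n3 t2_0.
- exact: n6.
by move=> i y li yn; apply: nc => //; rewrite t2_0.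
Qed.

(** * Cost program *)

Definition state_costs : prog := PFor 5 0 (copy_row 0 2).

Lemma run_state_costs s i x : x < var s 0 -> arr (run state_costs s) 2 i x =
  if i < var s 0 then arr s 0 i x else arr s 2 i x.
Proof.
move=> xn; pose I k s' := forall i, arr s' 2 i x =
  if i < k then arr s 0 i x else arr s 2 i x.
suff: I (var s 0) (run state_costs s) by apply.
apply: run_for_ind => // k s' _ s'5 [eqv eqa] Is' {}i.
rewrite ltnS leq_eqVlt /= run_copy_row // s'5 (eqv 0) // (eqa 0) // xn andbT Is'.
by have [->|_] := eqVneq i k.
Qed.

Definition component_row : prog :=
  PFor 7 0 (PIf (Cell 1 (Var 5) (Var 7)) (PStore 2 (Var 8) (Var 7) (Const 2)) PSkip).

Lemma run_component_row s l x : arr (run component_row s) 2 l x =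
  if [&& l == var s 8, x < var s 0 & arr s 1 (var s 5) x != 0] then 2
  else arr s 2 l x.
Proof.
pose I k s' := forall l x, arr s' 2 l x =
  if [&& l == var s 8, x < k & arr s 1 (var s 5) x != 0] then 2 else arr s 2 l x.
suff: I (var s 0) (run component_row s) by apply.
apply: run_for_ind => // [{}l {}x|k s' _ s'7 [eqv eqa] Is' {}l {}x].
  by rewrite andbF.
rewrite ltnS [x <= k]leq_eqVlt !runE /= s'7 (eqv 5) // (eqa 1) //.
have [nz|/negPf z] := boolP (arr s 1 (var s 5) k != 0) => /=.
  rewrite (eqv 8) // Is'; have [_|_] := eqVneq l (var s 8) => //=.
  by have [->|_] := eqVneq x k; rewrite ?nz.
by rewrite Is'; have [->|//] := eqVneq x k; rewrite z !andbF.
Qed.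

Definition component_costs : prog :=
  PAssign 8 (Var 0) ;;
  PFor 5 1 (component_row ;; PAssign 8 (Succ (Var 8))).

Lemma run_component_costs s l x : x < var s 0 ->
  arr (run component_costs s) 2 l x =
  if [&& var s 0 <= l, l < var s 0 + var s 1 & arr s 1 (l - var s 0) x != 0] then 2
  else arr s 2 l x.
Proof.
move=> xn; rewrite /component_costs run_seq run_assign; set s1 := set_var s 8 _.
pose I k s' := var s' 8 = var s 0 + k /\ forall l, arr s' 2 l x =
  if [&& var s 0 <= l, l < var s 0 + k & arr s 1 (l - var s 0) x != 0] then 2
  else arr s 2 l x.
suff: I (var s 1) (run (PFor 5 1 (component_row ;; PAssign 8 (Succ (Var 8)))) s1).
  by case=> _; apply.
apply: (@run_for_ind I 5 1 _ s1) => // [|k s' _ s'5 [eqv eqa] [s'8 Is']].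
  split=> [|{}l]; first by rewrite /= addn0.
  by rewrite addn0; case: (ltnP l (var s 0)).
split=> [|{}l]; first by rewrite run_seq /= run_var // s'8 addnS.
rewrite run_seq /= run_component_row s'8 s'5 (eqv 0) //= xn (eqa 1) //= Is'.
have [->|neq] /= := eqVneq l (var s 0 + k).
  by rewrite leq_addr addnS ltnS leqnn addKn ltnn.
by rewrite addnS ltnS [l <= _]leq_eqVlt (negPf neq).
Qed.

Definition cost_program : prog := state_costs ;; component_costs.

Lemma run_cost_program n s : var s 0 = n -> (forall l x, arr s 2 l x = 0) ->
  let s' := run cost_program s in
  (forall i x, i < n -> x < n -> arr s' 2 i x = arr s 0 i x) /\
  (forall i x, i < var s 1 -> x < n ->
     arr s' 2 (n + i) x = if arr s 1 i x != 0 then 2 else 0).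
Proof.
move=> s0 z2 /=; rewrite /cost_program run_seq.
have [v1 a1] := run_frame state_costs s.
have st_s i x := @run_state_costs s i x.
move: (run state_costs s) st_s v1 a1 => s1 st_s v1 a1; rewrite s0 in st_s.
split=> i x ni xn; rewrite run_component_costs ?v1 ?s0 // (a1 1) //.
  by rewrite leqNgt ni /= st_s // ni.
by rewrite leq_addr ltn_add2l ni addKn /= st_s // ltnNge leq_addr /= z2.
Qed.

(** * Selection program *)

Definition unmatched_or_theta : prog :=
  PFor 7 0 (PIf (Row 7 (Var 7))
    (PIf (Ltn (Var 0) (Row 7 (Var 7))) (StoreRow 4 (Var 7) (Const 1)) PSkip)
    (StoreRow 4 (Var 7) (Const 1))).

Lemma run_unmatched_or_theta s x : (forall x, arr s 4 0 x = 0) -> x < var s 0 ->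
  arr (run unmatched_or_theta s) 4 0 x =
  ((arr s 7 0 x == 0) || (var s 0 < arr s 7 0 x)).
Proof.
move=> z4; pose I k s' := forall x, arr s' 4 0 x =
  (x < k) && ((arr s 7 0 x == 0) || (var s 0 < arr s 7 0 x)).
suff: I (var s 0) (run unmatched_or_theta s) by move=> -> ->.
apply: run_for_ind => // k s' _ s'7 [eqv eqa] Is' {}x.
rewrite ltnS [x <= k]leq_eqVlt !runE /= s'7 (eqa 7) // (eqv 0) //.
have [m0|m0] := eqVneq (arr s 7 0 k) 0 => /=.
  by have [->|_] := eqVneq x k; rewrite ?m0 ?Is'.
have [lt|ge] := ltnP (var s 0) (arr s 7 0 k) => /=; rewrite Is' //.
  by have [->|_] := eqVneq x k; rewrite ?lt ?orbT.
by have [->|//] := eqVneq x k; rewrite (negPf m0) [var s 0 < _]ltnNge ge ltnn.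
Qed.

Definition test_covered : prog :=
  PAssign 9 (Const 0) ;;
  PFor 7 0 (PIf (Eqn (Row 7 (Var 7)) (Var 8)) (PAssign 9 (Const 1)) PSkip).

Lemma run_test_covered s :
  var (run test_covered s) 9 = has (fun x => arr s 7 0 x == var s 8) (iota 0 (var s 0)).
Proof.
rewrite /test_covered run_seq run_assign; set s1 := set_var s 9 _.
pose I k s' := var s' 9 = has (fun x => arr s 7 0 x == var s 8) (iota 0 k).
apply: (@run_for_ind I 7 0 _ s1) => // k s' _ s'7 [eqv eqa] Is'.
rewrite /I iota_last has_cat /= orbF !runE /= s'7 (eqv 8) //= (eqa 7) //= .
by case: (arr s 7 0 k == var s 8) => /=; rewrite ?orbT ?orbF.
Qed.

Definition select_in_uncovered : prog :=
  PAssign 8 (Var 0) ;;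
  PFor 5 1 (PAssign 8 (Succ (Var 8)) ;; test_covered ;;
            PIf (Var 9) PSkip (StoreRow 4 (Row 6 (Var 5)) (Const 1))).

Definition covered_row s l := has (fun x => arr s 7 0 x == l.+1) (iota 0 (var s 0)).

Lemma run_select_in_uncovered s x :
  arr (run select_in_uncovered s) 4 0 x =
  if has (fun i => ~~ covered_row s (var s 0 + i) && (arr s 6 0 i == x))
       (iota 0 (var s 1)) then 1 else arr s 4 0 x.
Proof.
rewrite /select_in_uncovered run_seq run_assign; set s1 := set_var s 8 _.
set body := (_ ;; _ ;; _).
pose I k s' := var s' 8 = var s 0 + k /\ forall x, arr s' 4 0 x =
  if has (fun i => ~~ covered_row s (var s 0 + i) && (arr s 6 0 i == x)) (iota 0 k)
  then 1 else arr s 4 0 x.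
suff: I (var s 1) (run (PFor 5 1 body) s1) by case=> _; apply.
apply: (@run_for_ind I 5 1 _ s1) => // [|k s' _ s'5 [eqv eqa] [s'8 Is']].
  by split=> //=; rewrite addn0.
rewrite /body run_seq run_assign run_seq; set s2 := set_var s' 8 _.
have tst := run_test_covered s2; have [vt a_t] := run_frame test_covered s2.
move: (run test_covered s2) tst vt a_t => s3 s3_9 vt a_t.
have s2_8 : var s2 8 = (var s 0 + k).+1 by rewrite /= s'8.
rewrite s2_8 /= (eqv 0) //= (eqa 7) //= in s3_9.
have s38 : var s3 8 = var s 0 + k.+1 by rewrite vt // s2_8 addnS.
split=> [|{}x].
  by rewrite run_if; case: ifP => _; rewrite ?runE /= s38.
rewrite iota_last has_cat /= orbF run_if /= s3_9 -/(covered_row s (var s 0 + k)).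
case: (covered_row s (var s 0 + k)) => /=.
  by rewrite run_skip orbF a_t //= Is'.
rewrite (vt 5) //= s'5 (a_t 6) //= (a_t 4) //= (eqa 6) //= Is' eq_sym.
by case: (_ == x) => /=; rewrite ?orbT ?orbF.
Qed.

Definition count_selected : prog :=
  PAssign 2 (Const 0) ;;
  PFor 7 0 (PIf (Row 4 (Var 7)) (PAssign 2 (Succ (Var 2))) PSkip).

Lemma run_count_selected s :
  var (run count_selected s) 2 = count (fun x => arr s 4 0 x != 0) (iota 0 (var s 0)).
Proof.
rewrite /count_selected run_seq run_assign; set s1 := set_var s 2 _.
pose I k s' := var s' 2 = count (fun x => arr s 4 0 x != 0) (iota 0 k).
apply: (@run_for_ind I 7 0 _ s1) => // k s' _ s'7 [eqv eqa] Is'.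
rewrite /I iota_last count_cat /= addn0 !runE /= s'7 (eqa 4) //=.
by case: (arr s 4 0 k != 0) => /=; rewrite Is' ?addn1 ?addn0.
Qed.

Definition select_program : prog :=
  unmatched_or_theta ;; select_in_uncovered ;; count_selected.

Lemma run_select_program n s : var s 0 = n -> (forall x, arr s 4 0 x = 0) ->
  let s' := run select_program s in
  var s' 2 = count (fun x => arr s' 4 0 x != 0) (iota 0 n) /\
  forall x, x < n -> arr s' 4 0 x =
    ((arr s 7 0 x == 0) || (n < arr s 7 0 x)) ||
    has (fun i => ~~ has (fun y => arr s 7 0 y == (n + i).+1) (iota 0 n) &&
                  (arr s 6 0 i == x)) (iota 0 (var s 1)).
Proof.
move=> s0 z4 /=; rewrite /select_program run_seq.
have un x := @run_unmatched_or_theta s x z4.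
have [v1 a1] := run_frame unmatched_or_theta s.
move: (run unmatched_or_theta s) un v1 a1 => s1 un v1 a1; rewrite run_seq.
have sel := run_select_in_uncovered s1.
have [v2 a2] := run_frame select_in_uncovered s1.
move: (run select_in_uncovered s1) sel v2 a2 => s2 sel v2 a2.
have cnt := run_count_selected s2; have [v3 a3] := run_frame count_selected s2.
move: (run count_selected s2) cnt v3 a3 => s3 cnt v3 a3.
rewrite (a3 4) // cnt v2 // v1 // s0; split=> // x xn.
rewrite sel un ?s0 // /covered_row (v1 0) // s0 (v1 1) // (a1 7) // (a1 6) //.
by case: (has _ _); rewrite ?orbT ?orbF.
Qed.

(** * Execution of the four programs *)

Section Execution.
Variables (n : nat) (A : 'M[bool]_n).
Local Notation conn := (connect (digraph A)).

Lemma input_adjacency (x y : 'I_n) : arr (input_memory A) 0 x y = digraph A x y.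
Proof.
rewrite /=; congr nat_of_bool; apply/existsP/idP => [[k /existsP[l]]|Axy].
  by case/and3P=> /eqP/ord_inj -> /eqP/ord_inj ->.
by exists x; apply/existsP; exists y; rewrite !eqxx.
Qed.

Lemma input_zero a i j : a != 0 -> arr (input_memory A) a i j = 0.
Proof.
move=> /negPf a0 /=; apply/eqP; rewrite eqb0; apply/existsPn => k.
by apply/existsPn => l; rewrite a0.
Qed.

Variable r : nat -> nat -> bool.
Hypothesis rE : forall x y : 'I_n, r x y = conn x y.

Lemma is_repP (x : 'I_n) :
  reflect (forall y : 'I_n, conn y x -> conn x y /\ x <= y) (is_rep n r x).
Proof.
apply: (iffP allP) => [rep y yx|rep k].
  have := rep y; rewrite mem_iota ltn_ord !rE yx => /(_ isT)/andP[-> ->].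
  by [].
rewrite mem_iota => kn; have := rep (Ordinal (kn : k < n)); rewrite -!rE /=.
by move=> repk; apply/implyP => /repk[-> ->].
Qed.

Definition component (i : 'I_(size (reps n r n))) : {set 'I_n} :=
  [set y : 'I_n | r y (nth 0 (reps n r n) i)].

Lemma rep_of (i : 'I_(size (reps n r n))) :
  exists2 x : 'I_n, is_rep n r x & nth 0 (reps n r n) i = x.
Proof.
have := mem_nth 0 (ltn_ord i); rewrite mem_filter mem_iota => /andP[rep lt_n].
by exists (Ordinal (lt_n : _ < n)).
Qed.

Lemma component_scc (i : 'I_(size (reps n r n))) (x : 'I_n) :
  is_rep n r x -> nth 0 (reps n r n) i = x ->
  component i = scc A x /\ is_source A x.
Proof.
move=> /is_repP rep nx; split.
  apply/setP => y; rewrite !inE nx rE; apply/idP/andP => [yx|[]//].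
  by case: (rep y yx).
by apply/forallP => y; apply/implyP => /rep[].
Qed.

(** The representatives are the least elements of the non-top linked SCCs. *)
Lemma components_step1 : step1_result A component.
Proof.
split=> [i j eq_ij|C].
  have [x rx nx] := rep_of i; have [y ry ny] := rep_of j.
  have xj : x \in component j by rewrite -eq_ij inE nx rE connect0.
  have yi : y \in component i by rewrite eq_ij inE ny rE connect0.
  rewrite inE ny rE in xj; rewrite inE nx rE in yi.
  have [_ le_xy] := is_repP _ rx _ yi; have [_ le_yx] := is_repP _ ry _ xj.
  apply/ord_inj/eqP; rewrite -(nth_uniq 0 (ltn_ord i) (ltn_ord j)).
    by rewrite nx ny eqn_leq le_xy le_yx.
  by rewrite filter_uniq ?iota_uniq.
split=> [[i <-]|/non_top_linkedP[x /forallP src ->]].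
  have [x rx nx] := rep_of i; have [-> src] := component_scc rx nx.
  by apply/non_top_linkedP; exists x.
have [y yC min_y] := @arg_minnP _ x (mem (scc A x)) (@nat_of_ord n) (scc_refl A x).
have /andP[xy yx] : conn x y && conn y x by move: yC; rewrite !inE.
have ry : is_rep n r y.
  apply/is_repP => z zy; have zx := connect_trans zy yx.
  have xz := implyP (src z) zx.
  split; first exact: connect_trans yx xz.
  by apply: (min_y z); have : z \in scc A x by rewrite inE xz.
have y_in : (y : nat) \in reps n r n by rewrite mem_filter ry mem_iota ltn_ord.
have lt_i : index (y : nat) (reps n r n) < size (reps n r n) by rewrite index_mem.
exists (Ordinal lt_i).
have [-> _] := @component_scc (Ordinal lt_i) y ry (nth_index _ y_in).
exact: eq_scc.
Qed.
End Execution.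

(** The loop bounds n, beta, n + beta and n + 1 are at most N = 2 n + 1, which is at most 3 n for
n > 0; whence the factor 27. *)
Lemma programs_execute :
  exists C, forall n (A : 'M[bool]_n), exists S t,
    executes_algorithm1 A (compile scc_program) (compile cost_program)
      (compile match_program) (compile select_program) S t /\
    (0 < n -> t <= C * n ^ 3).
Proof.
exists (27 * (weight scc_program + weight cost_program + weight match_program +
  weight select_program)) => n A.
pose s0 := input_memory A; pose s1 := run scc_program s0.
pose s2 := run cost_program s1; pose s3 := run match_program s2.
pose s4 := run select_program s3.
(* Reachability, extended to all numbers so as to be reflexive and transitive. *)
pose Q i j := i = j \/ exists x y : 'I_n, [/\ x = i :> nat, y = j :> nat &
  connect (digraph A) x y].
have [||||||] := @run_scc_program n s0 Q.
- by [].
- by [].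
- by move=> i y; apply: input_zero.
- move=> i j ni nj; rewrite (input_adjacency A (Ordinal ni) (Ordinal nj)) => Aij.
  right; exists (Ordinal ni), (Ordinal nj); split=> //; apply: connect1.
  by case: (digraph _ _ _) Aij.
- by left.
- move=> i j k [<- //|[x [y [xi yj xy]]]] [<-|[y' [z [y'j zk yz]]]].
    by right; exists x, y.
  right; exists x, z; split=> //; apply: connect_trans xy _.
  by have -> : y = y' by apply: ord_inj; rewrite yj.
rewrite -/s1; move=> r [s1_4 [rQ r_refl r_edge r_trans] [s1_1 s1_3] s1_6 s1_a1].
have rE (x y : 'I_n) : r x y = connect (digraph A) x y.
  apply/idP/idP => [/rQ|].
    case=> // [/ord_inj ->|[x' [y' [/ord_inj -> /ord_inj ->]]] //].
    exact: connect0.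
  case/connectP=> p; elim: p x => [|z p IHp] x /=.
    by move=> _ ->; apply: r_refl.
  case/andP=> Axz pP /(IHp z pP) rzy; apply: r_trans rzy => //.
  by apply: r_edge => //; rewrite (input_adjacency A x z) Axz.
set rs := reps n r n in s1_1 s1_3 s1_6 s1_a1.
pose beta := size rs; pose N := @component n r.
have s1_0 : var s1 0 = n by rewrite run_var.
have zero1 a i j : a \notin stored scc_program -> a != 0 -> arr s1 a i j = 0.
  by move=> h a0; rewrite run_arr // input_zero.
have [cost_state cost_comp] :=
  @run_cost_program n s1 s1_0 (fun l x => zero1 2 l x isT isT).
rewrite -/s2 s1_1 in cost_state cost_comp.
have v2 w : w \notin assigned cost_program -> var s2 w = var s1 w by apply: run_var.
have a2 a : a \notin stored cost_program -> arr s2 a = arr s1 a by apply: run_arr.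
have s2_0 : var s2 0 = n by rewrite v2.
have s2_4 : var s2 4 = n.+1 by rewrite v2.
have s2_3 : var s2 3 = n + beta by rewrite v2 // s1_3.
have graph2 : holds_weighted_graph A N s2.
  move=> [y|i] x /=.
    rewrite cost_state // run_arr // (input_adjacency A y x).
    by case: (digraph A y x).
  by rewrite cost_comp // s1_a1 // inE; case: (r x _).
have [||||match_inv match_arr] := @run_match_program n s2.
- by [].
- by [].
- by move=> x; rewrite a2 // zero1.
- by move=> x; rewrite a2 // zero1.
rewrite -/s3 s2_3 in match_inv match_arr.
pose M := @matching_of n beta (arr s3 7 0).
have step3 : step3_result A N M.
  apply: matching_of_optimal match_inv => l x.
  by rewrite /edge_in graph2; case: (aug_edge A N l x) => //; case: l.
have v3 w : w \notin assigned match_program -> var s3 w = var s2 w by apply: run_var.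
have a3 a : a \notin stored match_program -> arr s3 a = arr s2 a by apply: run_arr.
have s3_0 : var s3 0 = n by rewrite v3.
have s3_1 : var s3 1 = beta by rewrite v3 // v2 // s1_1.
have zero3 x : arr s3 4 0 x = 0 by rewrite a3 // a2 // zero1.
have [sel_count sel_arr] := @run_select_program n s3 s3_0 zero3.
rewrite -/s4 s3_1 in sel_count sel_arr.
have rep6 (i : 'I_beta) : arr s3 6 0 i = nth 0 rs i by rewrite a3 // a2 // s1_6.
set m := arr s3 7 0 in match_inv match_arr M step3 sel_arr.
have inM l (x : 'I_n) : ((l, x) \in M) = (m x == (left_row l).+1) by rewrite inE.
have m_le (x : 'I_n) : m x != 0 -> exists l : 'I_n + 'I_beta, m x = (left_row l).+1.
  case: match_inv => [[m_edge _] _ _ _ _] mx0.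
  have /andP[le_m _] := m_edge x (ltn_ord x) mx0.
  have [l rowl] := @left_row_onto n beta (m x).-1 ltac:(lia).
  by exists l; rewrite rowl prednK // lt0n.
have covE (i : 'I_beta) : has (fun y => m y == (n + i).+1) (iota 0 n) =
    (i \notin uncovered_SCCs M).
  rewrite inE; apply/hasP/forallPn => [[y]|[y]].
    rewrite mem_iota => yn my; exists (Ordinal (yn : y < n)).
    by rewrite negbK inM.
  by rewrite negbK inM => my; exists (y : nat) => //; rewrite mem_iota ltn_ord.
pose S := [set x : 'I_n | arr s4 4 0 x != 0].
have step4 : step4_result N M S.
  have [sel selP] : exists sel : 'I_beta -> 'I_n, forall i,
      is_rep n r (sel i) /\ nth 0 rs i = sel i.
    apply: (@fin_all_exists _ _ (fun (i : 'I_beta) (x : 'I_n) =>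
      is_rep n r x /\ nth 0 rs i = x)) => i.
    by have [x rx nx] := rep_of i; exists x.
  exists sel => [i _|]; first by have [_ nx] := selP i; rewrite inE -/rs nx r_refl.
  apply/setP => x; rewrite !in_setU inE sel_arr //.
  rewrite eqb0 negbK; congr (_ || _); last first.
    apply/hasP/imsetP => [[i]|[i iU ->]].
      rewrite mem_iota => ib /andP[nc /eqP eq_x].
      pose i' : 'I_beta := Ordinal (ib : i < beta); exists i'.
        by rewrite -[_ \in _]negbK -covE.
      by apply: ord_inj; have [_ <-] := selP i'; rewrite -eq_x -rep6.
    exists (i : nat); first by rewrite mem_iota ltn_ord.
    by rewrite covE iU rep6; have [_ ->] := selP i; rewrite eqxx.
  congr (_ || _).
    rewrite inE; apply/eqP/forallP => [mx0 l|none]; first by rewrite inM mx0.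
    apply/eqP; apply/negPn/negP => /m_le[l ml]; have := none l.
    by rewrite inM ml eqxx.
  rewrite inE; apply/idP/existsP => [lt_nm|[i]]; last first.
    by rewrite inM => /eqP -> /=; rewrite ltnS leq_addr.
  have [|[y|i] mx] := m_le x; first by lia.
    by have := ltn_ord y; move: lt_nm; rewrite mx /=; lia.
  by exists i; rewrite inM mx.
have output : holds_output S s4.
  split=> [|x]; last by rewrite inE sel_arr //; case: (_ || _).
  rewrite sel_count -sum1_count -sum1_card.
  have -> : iota 0 n = index_iota 0 n by rewrite /index_iota subn0.
  by rewrite big_mkord; apply: eq_bigl => x; rewrite inE.
pose K := n + n.+1.
have K0 : 0 < K by rewrite /K addnS.
have beta_n : beta <= n by apply: size_reps.
have [||t1 ex1 le1] := @exec_compile [:: 0] scc_program s0 K _ K0 _.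
- by [].
- by move=> b; rewrite inE => /eqP ->; apply: leq_addr.
have [||t2 ex2 le2] := @exec_compile [:: 0; 1] cost_program s1 K _ K0 _.
- by [].
- move=> b; rewrite !inE => /orP[] /eqP ->; rewrite ?s1_0 ?s1_1 /K; first exact: leq_addr.
  exact: leq_trans beta_n (leq_addr _ _).
have [||t3 ex3 le3] := @exec_compile [:: 0; 3; 4] match_program s2 K _ K0 _.
- by [].
- by move=> b; rewrite !inE => /or3P[] /eqP ->; rewrite ?s2_0 ?s2_3 ?s2_4 /K; lia.
have [||t4 ex4 le4] := @exec_compile [:: 0; 1] select_program s3 K _ K0 _.
- by [].
- move=> b; rewrite !inE => /orP[] /eqP ->; rewrite ?s3_0 ?s3_1 /K; first exact: leq_addr.
  exact: leq_trans beta_n (leq_addr _ _).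
exists S, (t1 + t2 + t3 + t4); split.
  exists beta, N, M, t1, t2, t3, t4, s1, s2, s3, s4; split=> //.
  - split=> //; split; first exact: components_step1.
    split=> // i x; rewrite s1_a1 // inE; by [].
  - split=> //; split=> // l x; rewrite inM match_arr //; exact: left_row_lt.
move=> n0; have cube (p : prog) t : t <= weight p * K ^ depth p -> depth p <= 3 ->
    t <= weight p * (27 * n ^ 3).
  move=> le_t d3; apply: leq_trans le_t _; rewrite leq_mul2l; apply/orP; right.
  apply: leq_trans (_ : K ^ 3 <= _); first by rewrite leq_pexp2l.
  by rewrite -[27]/(3 ^ 3) -expnMn leq_exp2r // /K; lia.
have := cube _ _ le1 isT; have := cube _ _ le2 isT.
have := cube _ _ le3 isT; have := cube _ _ le4 isT.
move: (weight _) (weight _) (weight _) (weight _) (n ^ 3); nia.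
Qed.

(** * Correctness and complexity *)

Theorem theorem11 (R : realType) :
  (forall (n : nat) (A : 'M[bool]_n) (S : {set 'I_n}),
     algorithm1_returns A S ->
     minimal_feasible R A S /\ is_min_number_dedicated R A #|S|)
  /\
  (exists (c1 c2 c3 c4 : cmd) (C : nat),
     forall (n : nat) (A : 'M[bool]_n),
     exists (S : {set 'I_n}) (t : nat),
       [/\ executes_algorithm1 A c1 c2 c3 c4 S t,
           minimal_feasible R A S,
           is_min_number_dedicated R A #|S|
         & 0 < n -> t <= C * n ^ 3]).
Proof.
split=> [n A S|]; first exact: algorithm1_correct.
have [C exec_C] := programs_execute.
exists (compile scc_program), (compile cost_program), (compile match_program).
exists (compile select_program), C => n A.
have [S [t [ex le_t]]] := exec_C n A; exists S, t.
have [min_S num_S] : minimal_feasible R A S /\ is_min_number_dedicated R A #|S|.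
  case: ex => beta [N [M [t1 [t2 [t3 [t4 [s1 [s2 [s3 [s4 run_steps]]]]]]]]]].
  case: run_steps => -[_ [step1 _]] _ [_ [step3 _]] [_ [step4 _]] _.
  by apply: algorithm1_correct; exists beta, N, M.
by split; first exact: ex.
Qed.
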